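(* Let $\Omega\subset\mathbb{R}^2$ be an open set of finite measure which is bounded and tiling, and let $\mathbf{A}(x)=\frac{B}{2}(-x_2,x_1)^T$ for some $B>0$. If the spectrum of $H_\Omega^N(\mathbf{A})$ is discrete, then for any $\gamma\geq0$ and $\lambda>0$ one has $$\operatorname{tr}\left(H_\Omega^N(\mathbf{A})-\lambda\right)_-^\gamma\geq|\Omega|\,\frac{B}{2\pi}\sum_{k=1}^\infty\left(B(2k-1)-\lambda\right)_-^\gamma.$$ If $\gamma\geq1$, then this is true without the assumption that $\Omega$ is bounded and tiling.
   Context: $\mathbf{D}=-i\nabla$. $H_\Omega^N(\mathbf{A})$ (magnetic Neumann Laplacian) is the self-adjoint operator in $L_2(\Omega)$ corresponding to the quadratic form $\int_\Omega|(\mathbf{D}-\mathbf{A})u|^2\,dx$ defined for $u\in L_2(\Omega)\cap H^1_{\mathrm{loc}}(\Omega)$ such that $(\mathbf{D}-\mathbf{A})u\in L_2(\Omega)$. The set $\Omega$ is called tiling if $\mathbb{R}^2$ can be decomposed, up to a set of measure zero, into a disjoint union of translated and rotated copies of $\Omega$. For $\gamma>0$, $\operatorname{tr}(H-\lambda)_-^\gamma=\sum_j(\lambda-\mu_j)_+^\gamma$, the sum over the eigenvalues $\mu_j$ of $H$ counting multiplicities; for $\gamma=0$ it is the number of eigenvalues less than $\lambda$. For real $s$, $s_-=\max\{-s,0\}$, and for $\gamma=0$, $s_-^0=1$ if $s<0$ and $s_-^0=0$ if $s\geq0$. $|\Omega|$ is Lebesgue measure. *)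

(* Defs.v *)
From HB Require Import structures.
From mathcomp Require Import all_boot all_order all_algebra.
From mathcomp Require Import all_classical all_reals all_analysis.
From mathcomp Require Export complex.
Set Implicit Arguments.
Unset Strict Implicit.
Unset Printing Implicit Defensive.
Import Order.TTheory GRing.Theory Num.Theory.
Import numFieldNormedType.Exports.
Local Open Scope classical_set_scope.
Local Open Scope ring_scope.
Local Open Scope complex_scope.

Notation leb2 R := (@lebesgue_measure R \x @lebesgue_measure R)%E.

Section Tiling.
Variable R : realType.
Implicit Types Om : set (R * R).

Definition rigid (t : R) (a x : R * R) : R * R :=
  (cos t * x.1 - sin t * x.2 + a.1, sin t * x.1 + cos t * x.2 + a.2).

Definition tiling Om : Prop :=
  exists (I : Type) (t : I -> R) (a : I -> R * R),
    trivIset [set: I] (fun i => rigid (t i) (a i) @` Om) /\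
    (leb2 R).-negligible (~` \bigcup_i (rigid (t i) (a i) @` Om)).

End Tiling.

(* An element of L_2(Om) is represented by a function on the whole plane whose
   values outside Om are irrelevant; equality is equality a.e. on Om. *)
Section L2.
Variable R : realType.
Implicit Types (Om : set (R * R)) (u v g : R * R -> R[i]).

Definition cmeasurable Om u : Prop :=
  measurable_fun Om (fun x => complex.Re (u x)) /\
  measurable_fun Om (fun x => complex.Im (u x)).

Definition cintegral Om u : R[i] :=
  (Rintegral (leb2 R) Om (fun x => complex.Re (u x))) +i*
  (Rintegral (leb2 R) Om (fun x => complex.Im (u x))).

Definition sqnorm Om u : \bar R :=
  (\int[leb2 R]_(x in Om)
     ((complex.Re (u x)) ^+ 2 + (complex.Im (u x)) ^+ 2)%:E)%E.

Definition inL2 Om u : Prop := cmeasurable Om u /\ (sqnorm Om u < +oo)%E.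

Definition inner Om u v : R[i] := cintegral Om (fun x => u x * ((v x)^*)%C).

Definition inL2loc Om u : Prop :=
  cmeasurable Om u /\
  forall K, compact K -> K `<=` Om -> (sqnorm K u < +oo)%E.

(* linear independence in L_2(Om) *)
Definition independent Om n (u : 'I_n -> R * R -> R[i]) : Prop :=
  forall c : 'I_n -> R[i],
    {ae leb2 R, forall x, Om x -> \sum_(i < n) c i * u i x = 0} ->
    forall i, c i = 0.

End L2.

Section Sobolev.
Variable R : realType.
Implicit Types (Om : set (R * R)) (u g : R * R -> R[i]) (phi : R * R -> R).

Definition smooth phi : Prop :=
  forall s : seq (R * R),
    let psi := foldr (fun (e : R * R) f => fun x => 'D_e f x) phi s in
    continuous psi /\ forall x e, derivable psi x e.

Definition test_function Om phi : Prop :=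
  smooth phi /\
  exists2 K, compact K /\ K `<=` Om & forall x, ~ K x -> phi x = 0.

Definition is_weak_deriv Om (e : R * R) u g : Prop :=
  inL2loc Om g /\
  forall phi, test_function Om phi ->
    cintegral Om (fun x => u x * ('D_e phi x)%:C) =
    - cintegral Om (fun x => g x * (phi x)%:C).

(* A chosen representative, determined up to a.e. equality on Om. *)
Definition weak_deriv Om (e : R * R) u : R * R -> R[i] :=
  xget (fun=> 0) [set g | is_weak_deriv Om e u g].

Definition inH1loc Om u : Prop :=
  [/\ inL2loc Om u, exists g, is_weak_deriv Om (1, 0) u g &
      exists g, is_weak_deriv Om (0, 1) u g].

End Sobolev.

Section MagneticNeumann.
Variable R : realType.
Implicit Types (Om : set (R * R)) (A : R * R -> R * R).
Implicit Types (u v f : R * R -> R[i]).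

(* the two components of (D - A) u, where D = -i grad *)
Definition momentum1 Om A u : R * R -> R[i] :=
  fun x => - 'i%C * weak_deriv Om (1, 0) u x - ((A x).1)%:C * u x.

Definition momentum2 Om A u : R * R -> R[i] :=
  fun x => - 'i%C * weak_deriv Om (0, 1) u x - ((A x).2)%:C * u x.

Definition form_domain Om A u : Prop :=
  [/\ inL2 Om u, inH1loc Om u,
      inL2 Om (momentum1 Om A u) & inL2 Om (momentum2 Om A u)].

(* sesquilinear form with diagonal \int_Om |(D - A) u|^2 *)
Definition magnetic_form Om A u v : R[i] :=
  inner Om (momentum1 Om A u) (momentum1 Om A v) +
  inner Om (momentum2 Om A u) (momentum2 Om A v).

(* Graph of the self-adjoint operator associated with the form (first
   representation theorem): u is in the operator domain and H u = f. *)
Definition magnetic_neumann Om A u f : Prop :=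
  [/\ form_domain Om A u, inL2 Om f &
      forall v, form_domain Om A v -> magnetic_form Om A u v = inner Om f v].

Definition homogeneous_field (B : R) : R * R -> R * R :=
  fun x => (B / 2 * - x.2, B / 2 * x.1).

End MagneticNeumann.

(* Spectral notions for an operator in L_2(Om) given by its graph. *)
Section Spectrum.
Variables (R : realType) (Om : set (R * R)).
Variable H : (R * R -> R[i]) -> (R * R -> R[i]) -> Prop.

(* H - z maps its domain onto L_2(Om) and has a bounded inverse; the bound
   (with f = 0) contains injectivity. *)
Definition resolvent_set : set R[i] :=
  [set z | (forall f, inL2 Om f -> exists u, H u (fun x => f x + z * u x)) /\
     exists M : R, forall u f, inL2 Om f -> H u (fun x => f x + z * u x) ->
       (sqnorm Om u <= M%:E * sqnorm Om f)%E].

Definition spectrum : set R[i] := ~` resolvent_set.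

(* dimension of ker (H - z), possibly +oo *)
Definition multiplicity (z : R[i]) : \bar R :=
  ereal_sup [set m | exists n : nat, m = (n%:R)%:E /\
    exists u : 'I_n -> R * R -> R[i],
      (forall i, H (u i) (fun x => z * u i x)) /\ independent Om u].

Definition discrete_spectrum : Prop :=
  forall z, spectrum z ->
    [/\ exists2 e : R, 0 < e &
          forall w, spectrum w -> Normc.normc (w - z) < e -> w = z,
        (0 < multiplicity z)%E & (multiplicity z < +oo)%E].

(* s_-^g; the convention at g = 0 differs from powR, for which 0 `^ 0 = 1 *)
Definition neg_pow (g s : R) : R :=
  if g == 0 then (s < 0)%R%:R else (Num.max (- s) 0) `^ g.

(* Sum over the eigenvalues, which are real since H is self-adjoint. *)
Definition tr_neg_pow (g l : R) : \bar R :=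
  (\esum_(m in [set: R]) ((neg_pow g (m - l))%:E * multiplicity m%:C))%E.

End Spectrum.

(* Main.v *)
Require Import Defs.
From HB Require Import structures.
From mathcomp Require Import all_boot all_order all_algebra.
From mathcomp Require Import all_classical all_reals all_analysis.
From mathcomp Require Import measurable_realfun.
From mathcomp Require Import ring lra.
Import Order.TTheory GRing.Theory Num.Theory.
Import numFieldNormedType.Exports.
Set Implicit Arguments.
Unset Strict Implicit.
Unset Printing Implicit Defensive.
Local Open Scope classical_set_scope.
Local Open Scope ring_scope.
Local Open Scope complex_scope.

(* The Landau functions, indexed by a level k (energy B (2 k + 1)) and an angular
   index m, are orthonormal in L_2(R^2), and for fixed k the sum over m of their
   squared moduli is the constant B / (2 pi).

   If gamma >= 1, restrict the Landau functions to Om.  Expanding a restriction in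
   eigenfunctions psi_j of the Neumann operator and using the tangent line of the
   convex function s |-> (s - lambda)_-^gamma at the Landau energy bounds
   phi(energy) * mass + phi'(energy) * (form - energy * mass) by
   sum_j phi(mu_j) |<restriction, psi_j>|^2.  Sum over m < M and over the levels:
   Bessel's inequality in L_2(R^2) bounds the right-hand side by the trace, and as
   M tends to infinity the mass tends to |Om| B / (2 pi) while the linear terms
   cancel.

   If Om is tiling, it is enough that the number of eigenvalues mu_j <= B (2 l + 1)
   is at least (l + 1) |Om| B / (2 pi) when B (2 l + 1) < lambda; Abel summation then
   gives every gamma >= 0.  If there were fewer, then a nonzero combination of Landau
   functions with k <= l and m < J could be made orthogonal to these eigenfunctions on
   each of the tiles close to the disc of area about 2 pi J / B.  Its energy on the
   plane is at most B (2 l + 1) times its mass, but on each tile it is larger by a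
   fixed factor, and the mass off the tiles used is negligible by Chebyshev's
   inequality for high moments.  The number of tiles is bounded by comparing
   the lowest level with the Poisson distribution. *)

(** The Neumann form imposes nothing at the boundary, so restrictions of smooth plane functions are
    admissible and their energy is known pointwise: if [fp], [fm] are the images of [f] under the
    level shifts, the form is [B] times the integral of |fp|^2 + |fm|^2. On Om the level k thus has
    energy B ((k + 1) mass(k + 1) + k mass(k - 1)); only the sum over all m, whose density is the
    same at every level, restores B (2 k + 1). On a tile the rigid motion is compensated by a gauge
    factor, so the energies on disjoint tiles add up to at most the plane energy. The obstacle is
    then the edge of the disc: the count of tiles and the escaping mass may be lost only by factors
    t^j with t near 1. The mass is confined because multiplication by the conjugate of w raises the
    level but lowers m, so that the p-th moment in |w|^2 is at most (t J)^p times the mass once J is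
    large, whatever the combination. Of the spectrum only this is used: for each s there are
    finitely many eigenfunctions below s, and the form is at least s on their orthogonal complement.
    They come from minimizing the Rayleigh quotient; a minimizer exists because the spectrum is
    isolated at the infimum. *)

(* Fixing the instance arguments of conjugation and of the real embedding keeps
   them syntactically unique, so that they can be rewritten. *)
Definition cj (R : realType) (z : R[i]) : R[i] := (z^*)%C.
Definition rc (R : realType) (t : R) : R[i] := (t%:C)%C.

Section ComplexParts.
Variable R : realType.
Implicit Types z w : R[i].

Lemma ReD z w : complex.Re (z + w) = complex.Re z + complex.Re w.
Proof. by case: z w => [a b] [c d]. Qed.

Lemma ImD z w : complex.Im (z + w) = complex.Im z + complex.Im w.
Proof. by case: z w => [a b] [c d]. Qed.

Lemma ReN z : complex.Re (- z) = - complex.Re z.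
Proof. by case: z. Qed.

Lemma ImN z : complex.Im (- z) = - complex.Im z.
Proof. by case: z. Qed.

Lemma ReM z w : complex.Re (z * w) =
  complex.Re z * complex.Re w - complex.Im z * complex.Im w.
Proof. by case: z w => [a b] [c d]. Qed.

Lemma ImM z w : complex.Im (z * w) =
  complex.Re z * complex.Im w + complex.Im z * complex.Re w.
Proof. by case: z w => [a b] [c d]. Qed.

Lemma ReJ z : complex.Re (cj z) = complex.Re z.
Proof. by case: z. Qed.

Lemma ImJ z : complex.Im (cj z) = - complex.Im z.
Proof. by case: z. Qed.

Lemma complex_eqP z w :
  complex.Re z = complex.Re w -> complex.Im z = complex.Im w -> z = w.
Proof. by case: z w => [a b] [c d] /= -> ->. Qed.

Lemma realcM (t : R) z : rc t * z = (t * complex.Re z) +i* (t * complex.Im z).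
Proof. by case: z => a b; apply: complex_eqP; rewrite ?ReM ?ImM /= !mul0r ?subr0 ?addr0. Qed.

Lemma Re_rc (t : R) : complex.Re (rc t) = t. Proof. by []. Qed.

Lemma Im_rc (t : R) : complex.Im (rc t) = 0. Proof. by []. Qed.

Lemma cj_rc (t : R) : cj (rc t) = rc t.
Proof. by apply: complex_eqP; rewrite ?ReJ ?ImJ ?Im_rc ?oppr0. Qed.

Lemma cj0 : cj (0 : R[i]) = 0.
Proof. by rewrite /cj conjc0. Qed.

Lemma realcD (s t : R) : rc (s + t) = rc s + rc t.
Proof. by apply: complex_eqP; rewrite ?ReD ?ImD ?Im_rc /= ?addr0. Qed.

Lemma realcN (s : R) : rc (- s) = - rc s.
Proof. by apply: complex_eqP; rewrite /= ?oppr0. Qed.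

Lemma realcB (s t : R) : rc (s - t) = rc s - rc t.
Proof. by rewrite realcD realcN. Qed.

Lemma realcMM (s t : R) : rc (s * t) = rc s * rc t.
Proof. by rewrite realcM /= mulr0. Qed.

Definition sqn z : R := complex.Re z ^+ 2 + complex.Im z ^+ 2.

Lemma sqn_ge0 z : 0 <= sqn z.
Proof. by rewrite addr_ge0 ?sqr_ge0. Qed.

Lemma sqnM z w : sqn (z * w) = sqn z * sqn w.
Proof. by rewrite /sqn ReM ImM; ring. Qed.

Lemma mulJ z : z * cj z = rc (sqn z).
Proof. by apply: complex_eqP; rewrite ?ReM ?ImM ReJ ImJ /= /sqn; ring. Qed.

Lemma sqnJ z : sqn (cj z) = sqn z.
Proof. by rewrite /sqn ReJ ImJ sqrrN. Qed.

Lemma sqn0_eq0 z : sqn z = 0 -> z = 0.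
Proof.
move=> /eqP; rewrite paddr_eq0 ?sqr_ge0 // !sqrf_eq0 => /andP[/eqP a /eqP b].
exact: complex_eqP.
Qed.

Lemma sqnD_le z w : sqn (z + w) <= 2 * sqn z + 2 * sqn w.
Proof.
rewrite /sqn ReD ImD.
have h (a b : R) : (a + b) ^+ 2 <= 2 * a ^+ 2 + 2 * b ^+ 2.
  rewrite -subr_ge0 (_ : _ - _ = (a - b) ^+ 2) ?sqr_ge0 //; ring.
have := h (complex.Re z) (complex.Re w); have := h (complex.Im z) (complex.Im w); lra.
Qed.

Lemma imaginary_sqr : 'i%C * 'i%C = -1 :> R[i].
Proof. by apply: complex_eqP; rewrite ?ReM ?ImM ?ReN ?ImN /=; ring. Qed.

Lemma cj_imaginary : cj 'i%C = - 'i%C :> R[i].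
Proof. by apply: complex_eqP; rewrite ?ReJ ?ImJ ?ReN ?ImN //= oppr0. Qed.

Lemma cjK z : cj (cj z) = z.
Proof. by apply: complex_eqP; rewrite ?ReJ ?ImJ ?opprK. Qed.

Lemma conjcD z w : cj (z + w) = cj z + cj w.
Proof. by apply: complex_eqP; rewrite ?ReD ?ImD ?ReJ ?ImJ ?ReD ?ImD ?opprD. Qed.

Lemma conjcN z : cj (- z) = - cj z.
Proof. by apply: complex_eqP; rewrite !(ReJ, ImJ, ReN, ImN). Qed.

Lemma conjcM z w : cj (z * w) = cj z * cj w.
Proof. by apply: complex_eqP; rewrite ?ReM ?ImM ?ReJ ?ImJ ?ReM ?ImM ?ReJ ?ImJ; ring. Qed.

End ComplexParts.

(** * Hermitian forms and discrete spectra *)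
Section SemiInner.
Variables (R : realType) (X : lmodType R[i]).

(** Only semidefinite, and only on a predicate [L]: elements of L_2 are represented by functions on
    the plane, so a null function need not be 0, and [inner] or [magnetic_form] obeys the laws only
    on its domain. *)
Record sip (L : X -> Prop) (ip : X -> X -> R[i]) : Prop := Sip {
  sip_add : forall u v, L u -> L v -> L (u + v);
  sip_scale : forall (a : R[i]) u, L u -> L (a *: u);
  sip_ipDl : forall u v w, L u -> L v -> L w -> ip (u + v) w = ip u w + ip v w;
  sip_ipZl : forall (a : R[i]) u w, L u -> L w -> ip (a *: u) w = a * ip u w;
  sip_ipC : forall u v, L u -> L v -> ip v u = cj (ip u v);
  sip_ge0 : forall u, L u -> 0 <= complex.Re (ip u u)
}.

Section Theory.
Variables (L : X -> Prop) (ip : X -> X -> R[i]).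
Hypothesis S : sip L ip.

Definition rip u v : R := complex.Re (ip u v).
Definition nsq u : R := rip u u.

Let LD := sip_add S.
Let LZ := sip_scale S.

Lemma sip_opp u : L u -> L (- u).
Proof. by move=> Lu; rewrite -scaleN1r; exact: LZ. Qed.

Lemma sip_sub u v : L u -> L v -> L (u - v).
Proof. by move=> Lu Lv; apply: LD => //; exact: sip_opp. Qed.

Lemma ipNl u w : L u -> L w -> ip (- u) w = - ip u w.
Proof. by move=> Lu Lw; rewrite -scaleN1r (sip_ipZl S) // mulN1r. Qed.

Lemma ipBl u v w : L u -> L v -> L w -> ip (u - v) w = ip u w - ip v w.
Proof. by move=> Lu Lv Lw; rewrite (sip_ipDl S) // ?ipNl //; exact: sip_opp. Qed.

Lemma ipDr u v w : L u -> L v -> L w -> ip u (v + w) = ip u v + ip u w.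
Proof.
move=> Lu Lv Lw; rewrite (sip_ipC S (LD Lv Lw) Lu) (sip_ipDl S) // conjcD.
by rewrite -(sip_ipC S Lv Lu) -?(sip_ipC S Lw Lu).
Qed.

Lemma ipZr (a : R[i]) u v : L u -> L v -> ip u (a *: v) = cj a * ip u v.
Proof.
move=> Lu Lv; rewrite (sip_ipC S (LZ a Lv) Lu) (sip_ipZl S) // conjcM.
by rewrite -(sip_ipC S Lv Lu) -?(sip_ipC S Lw Lu).
Qed.

Lemma ipNr u v : L u -> L v -> ip u (- v) = - ip u v.
Proof.
move=> Lu Lv; rewrite -scaleN1r ipZr //.
by apply: complex_eqP; rewrite ?ReM ?ImM ?ReN ?ImN ReJ ImJ /=; ring.
Qed.

Lemma ipBr u v w : L u -> L v -> L w -> ip u (v - w) = ip u v - ip u w.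
Proof. by move=> Lu Lv Lw; rewrite ipDr ?ipNr //; exact: sip_opp. Qed.

Lemma ip0l v : L v -> ip 0 v = 0.
Proof. by move=> Lv; rewrite -(scale0r v) (sip_ipZl S) // mul0r. Qed.

Lemma ripC u v : L u -> L v -> rip u v = rip v u.
Proof. by move=> Lu Lv; rewrite /rip (sip_ipC S Lu Lv) ReJ. Qed.

Lemma ripDl u v w : L u -> L v -> L w -> rip (u + v) w = rip u w + rip v w.
Proof. by move=> *; rewrite /rip (sip_ipDl S) // ReD. Qed.

Lemma ripBl u v w : L u -> L v -> L w -> rip (u - v) w = rip u w - rip v w.
Proof. by move=> *; rewrite /rip ipBl // ReD ReN. Qed.

Lemma ripDr u v w : L u -> L v -> L w -> rip u (v + w) = rip u v + rip u w.
Proof. by move=> *; rewrite /rip ipDr // ReD. Qed.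

Lemma ripBr u v w : L u -> L v -> L w -> rip u (v - w) = rip u v - rip u w.
Proof. by move=> *; rewrite /rip ipBr // ReD ReN. Qed.

Lemma ripZr (t : R) u v : L u -> L v -> rip u (rc t *: v) = t * rip u v.
Proof. by move=> *; rewrite /rip ipZr // cj_rc realcM. Qed.

Lemma nsq_ge0 u : L u -> 0 <= nsq u.
Proof. exact: (sip_ge0 S). Qed.

Lemma ip_nsq u : L u -> ip u u = rc (nsq u).
Proof.
move=> Lu; apply: complex_eqP => //=.
have /(congr1 (@complex.Im R)) := sip_ipC S Lu Lu.
rewrite ImJ => h; lra.
Qed.

Lemma nsqZ (a : R[i]) u : L u -> nsq (a *: u) = sqn a * nsq u.
Proof.
move=> Lu; rewrite /nsq /rip (sip_ipZl S) ?ipZr //; last exact: LZ.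
by rewrite mulrA mulJ ip_nsq // realcM.
Qed.

Lemma nsqZr (t : R) u : L u -> nsq (rc t *: u) = t ^+ 2 * nsq u.
Proof. by move=> Lu; rewrite nsqZ // /sqn /= expr0n addr0. Qed.

Lemma nsqD u v : L u -> L v -> nsq (u + v) = nsq u + 2 * rip u v + nsq v.
Proof.
move=> Lu Lv; rewrite /nsq ripDl ?ripDr //; last exact: LD.
by rewrite (ripC Lv Lu); ring.
Qed.

Lemma nsqB u v : L u -> L v -> nsq (u - v) = nsq u - 2 * rip u v + nsq v.
Proof.
move=> Lu Lv; rewrite /nsq ripBl ?ripBr //; last exact: sip_sub.
by rewrite (ripC Lv Lu); ring.
Qed.

Lemma cauchy_schwarz u v : L u -> L v -> rip u v ^+ 2 <= nsq u * nsq v.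
Proof.
move=> Lu Lv.
have P (t : R) : 0 <= nsq u + 2 * (t * rip u v) + t ^+ 2 * nsq v.
  by rewrite -nsqZr // -ripZr // -nsqD //; [apply: nsq_ge0; apply: LD => //|]; exact: LZ.
have := nsq_ge0 Lv; rewrite le_eqVlt => /orP[/eqP v0|v0].
  (* For a null [v] the polynomial is affine in t; this value of t makes it negative unless
     [rip u v] is 0. *)
  rewrite -v0 mulr0; have := P (- (nsq u + 1) / rip u v).
  case: (eqVneq (rip u v) 0) => [->|r0]; first by rewrite expr0n.
  rewrite divfK // -v0 mulr0 addr0; have := nsq_ge0 Lu; lra.
have := P (- rip u v / nsq v).
have -> : nsq u + 2 * (- rip u v / nsq v * rip u v) + (- rip u v / nsq v) ^+ 2 * nsq v
   = nsq u - rip u v ^+ 2 / nsq v by field; rewrite gt_eqF.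
by rewrite subr_ge0 ler_pdivrMr.
Qed.

Lemma nsqD_le u v : L u -> L v -> nsq (u + v) <= 2 * nsq u + 2 * nsq v.
Proof.
move=> Lu Lv; have : 0 <= nsq (u - v) by apply: nsq_ge0; exact: sip_sub.
rewrite nsqB // nsqD //; lra.
Qed.

Lemma nsqB_le u v : L u -> L v -> nsq (u - v) <= 2 * nsq u + 2 * nsq v.
Proof.
move=> Lu Lv; have : 0 <= nsq (u + v) by apply: nsq_ge0; exact: LD.
rewrite nsqB // nsqD //; lra.
Qed.

Lemma nsqN u : L u -> nsq (- u) = nsq u.
Proof.
move=> Lu; rewrite -scaleN1r nsqZ //.
by rewrite (_ : sqn _ = 1) ?mul1r // /sqn /= oppr0 expr0n addr0 sqrrN expr1n.
Qed.

(** This stands in for definiteness: changing a vector by a null one changes no inner product. The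
    imaginary part is obtained by testing against ['i *: v]. *)
Lemma nsq0_ip u v : L u -> L v -> nsq u = 0 -> ip u v = 0.
Proof.
move=> Lu Lv u0.
have r0 w : L w -> rip u w = 0.
  move=> Lw; have := cauchy_schwarz Lu Lw; rewrite u0 mul0r => h.
  by apply/eqP; rewrite -sqrf_eq0 eq_le h sqr_ge0.
apply: complex_eqP; first exact: r0.
have := r0 ('i *: v) (LZ _ Lv).
by rewrite /rip ipZr // ReM ReJ ImJ /= mul0r sub0r mulN1r opprK.
Qed.

Lemma cauchy_schwarzC u v : L u -> L v -> sqn (ip u v) <= nsq u * nsq v.
Proof.
move=> Lu Lv; set z := ip u v.
have Lzv : L (z *: v) by exact: LZ.
have := cauchy_schwarz Lu Lzv; rewrite /rip ipZr // -/z mulrC mulJ /= nsqZ //.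
have := sqn_ge0 z; rewrite le_eqVlt => /orP[/eqP <-|z0].
  by rewrite mulr_ge0 ?nsq_ge0.
by rewrite mulrCA expr2 ler_pM2l.
Qed.

Lemma sip_sum (T : finType) (c : T -> R[i]) (u : T -> X) : (exists u0, L u0) ->
  (forall i, L (u i)) -> L (\sum_(i : T) c i *: u i).
Proof.
move=> [u0 Lu0] Lu; elim/big_ind : _ => //.
  by rewrite -(scale0r u0); exact: LZ.
by move=> i _; exact: LZ.
Qed.

Lemma ip_suml (T : finType) (c : T -> R[i]) (u : T -> X) v : L v ->
  (forall i, L (u i)) -> ip (\sum_(i : T) c i *: u i) v = \sum_(i : T) c i * ip (u i) v.
Proof.
move=> Lv Lu.
suff [] : L (\sum_(i : T) c i *: u i) /\
  ip (\sum_(i : T) c i *: u i) v = \sum_(i : T) c i * ip (u i) v by [].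
apply: (big_ind2 (fun x y => L x /\ ip x v = y)).
- by split; [rewrite -(scale0r v); exact: LZ|exact: ip0l].
- by move=> x a y b [Lx <-] [Ly <-]; split; [exact: LD|rewrite (sip_ipDl S)].
- by move=> i _; split; [exact: LZ|rewrite (sip_ipZl S)].
Qed.

End Theory.

End SemiInner.

(** * Operators given by a form: resolvent estimates and eigenvectors *)

Section Spectral.
Variables (R : realType) (X : lmodType R[i]).
Variables (L D : X -> Prop) (ip Q : X -> X -> R[i]).
Hypotheses (SL : sip L ip) (SD : sip D Q) (DL : forall u, D u -> L u).

Definition graph u f : Prop := [/\ D u, L f & forall v, D v -> Q u v = ip f v].

(** Real points are enough, since the whole spectral argument stays on the real axis. *)
Definition regular (z : R) : Prop :=
  (forall f, L f -> exists u, graph u (f + rc z *: u)) /\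
  exists M : R, forall u f, L f -> graph u (f + rc z *: u) ->
    nsq ip u <= M * nsq ip f.

Definition orthonormal (T : finType) (u : T -> X) : Prop :=
  forall i j, ip (u i) (u j) = (i == j)%:R.

Hypothesis isolated : forall z, ~ regular z ->
  exists2 e : R, 0 < e & forall w, w != z -> `|w - z| < e -> regular w.
Hypothesis finite_mult : forall z, exists n, forall u : 'I_n -> X,
  (forall i, graph (u i) (rc z *: u i)) -> ~ orthonormal u.
Hypothesis complete : forall u : nat -> X, (forall n, L (u n)) ->
  (forall e, 0 < e -> exists N, forall n m, (N <= n)%N -> (N <= m)%N ->
     nsq ip (u n - u m) <= e) ->
  exists2 v, L v & forall e, 0 < e -> exists N, forall n, (N <= n)%N ->
     nsq ip (u n - v) <= e.

Let LD := sip_add SL.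
Let LZ := sip_scale SL.
Let LB u v : L u -> L v -> L (u - v) := @sip_sub _ _ _ _ SL u v.
Let DD := sip_add SD.
Let DZ := sip_scale SD.
Let DB u v : D u -> D v -> D (u - v) := @sip_sub _ _ _ _ SD u v.

Lemma graph_add u f u' f' : graph u f -> graph u' f' -> graph (u + u') (f + f').
Proof.
case=> Du Lf h [Du' Lf' h']; split; [exact: DD|exact: LD|move=> v Dv].
by rewrite (sip_ipDl SD) // (sip_ipDl SL) ?h ?h' //; exact: DL.
Qed.

Lemma graph_scale (a : R[i]) u f : graph u f -> graph (a *: u) (a *: f).
Proof.
case=> Du Lf h; split; [exact: DZ|exact: LZ|move=> v Dv].
by rewrite (sip_ipZl SD) // (sip_ipZl SL) ?h //; exact: DL.
Qed.

Lemma graph_sub u f u' f' : graph u f -> graph u' f' -> graph (u - u') (f - f').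
Proof.
move=> h h'; rewrite -!(scaleN1r u') -(scaleN1r f').
by apply: graph_add => //; exact: graph_scale.
Qed.

Lemma graph_ae u f f' : L f' -> nsq ip (f - f') = 0 -> graph u f -> graph u f'.
Proof.
move=> Lf' ff' [Du Lf h]; split => // v Dv; rewrite h //.
apply/eqP; rewrite -subr_eq0 -(ipBl SL) //; last exact: DL.
by apply/eqP; apply: (nsq0_ip SL) => //; [exact: LB|exact: DL].
Qed.

Lemma graph_sym u f v g : graph u f -> graph v g -> ip f v = ip u g.
Proof.
case=> Du Lf h [Dv Lg h']; rewrite -h // (sip_ipC SD Dv Du) h' //.
by rewrite -(sip_ipC SL Lg) //; exact: DL.
Qed.

(** A bounded symmetric operator has its norm or the opposite of its norm in the spectrum; this is
    used for the inverse [K] of H - m. If the norm k of [K] exceeded 1/d, the points m + 1/k and m -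
    1/k would be regular, hence K - k, K + k and their product K^2 - k^2 would be bounded below; but
    K^2 - k^2 is small on nearly maximizing vectors. *)
Lemma resolvent_bound (m d : R) : 0 < d ->
  (forall w, `|w - m| < d -> regular w) ->
  forall u f, L f -> graph u (f + rc m *: u) -> d ^+ 2 * nsq ip u <= nsq ip f.
Proof.
move=> d0 reg.
have [surj [M0 HM0]] : regular m by apply: reg; rewrite subrr normr0.
(* A solution is unique only up to a null vector, so one is chosen; [uniq] compares any other with
   it. *)
pose K (f : X) : X := if pselect (L f) is left Lf then projT1 (cid (surj f Lf)) else 0.
have HK f : L f -> graph (K f) (f + rc m *: K f).
  by move=> Lf; rewrite /K; case: pselect => // Lf'; case: cid.
have LK f : L f -> L (K f) by move=> /HK[/DL].
have uniq u f : L f -> graph u (f + rc m *: u) -> nsq ip (u - K f) = 0.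
  move=> Lf hu; have := graph_sub hu (HK f Lf).
  rewrite opprD addrACA subrr -scalerBr => h.
  have Lu : L u by case: hu => /DL.
  have L0 : L 0 by rewrite -(scale0r f); exact: LZ.
  apply/eqP; rewrite eq_le (nsq_ge0 SL) ?andbT; last by apply: LB => //; exact: LK.
  by apply: le_trans (HM0 _ _ L0 h) _; rewrite /nsq /rip (ip0l SL) // mulr0.
pose A := [set x : R | exists2 f, L f & nsq ip f = 1 /\ x = nsq ip (K f)].
have Abd : has_ubound A.
  exists M0 => x [f Lf [f1 ->]]; have := HM0 _ _ Lf (HK f Lf); by rewrite f1 mulr1.
set k2 := sup A.
have HKk f : L f -> nsq ip (K f) <= k2 * nsq ip f.
  move=> Lf; have := nsq_ge0 SL Lf; rewrite le_eqVlt => /orP[/eqP f0|f0].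
    have := HM0 _ _ Lf (HK f Lf); by rewrite -f0 !mulr0.
  pose s := (Num.sqrt (nsq ip f))^-1.
  have s2 : s ^+ 2 * nsq ip f = 1.
    by rewrite exprVn sqr_sqrtr ?(ltW f0) // mulVf // gt_eqF.
  have Ls : L (rc s *: f) by exact: LZ.
  have : nsq ip (K (rc s *: f)) <= k2.
    apply: sup_upper_bound => //; last by exists (rc s *: f) => //; rewrite (nsqZr SL).
    by split=> //; exists (nsq ip (K (rc s *: f))), (rc s *: f) => //; rewrite (nsqZr SL).
  have h1 : graph (rc s *: K f) (rc s *: f + rc m *: (rc s *: K f)).
    rewrite scalerA mulrC -scalerA -scalerDr; apply: graph_scale; exact: HK.
  have := uniq _ _ Ls h1.
  set a := rc s *: K f; set b := K _ => ab0 hb.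
  have La : L a by apply: LZ; exact: LK.
  have Lb : L b by exact: LK.
  have ea : nsq ip a = nsq ip b.
    have h := nsq0_ip SL (LB La Lb) La ab0; have h' := nsq0_ip SL (LB La Lb) Lb ab0.
    move: h h'; rewrite !(ipBl SL) // => /subr0_eq e1 /subr0_eq e2.
    by rewrite /nsq /rip e1 (sip_ipC SL La Lb) ReJ e2.
  move: hb; rewrite -ea /a (nsqZr SL); last exact: LK.
  move=> hb; rewrite -(ler_pM2l (x := s ^+ 2)); last by rewrite exprn_gt0 // invr_gt0 sqrtr_gt0.
  by rewrite (mulrCA _ k2) s2 mulr1.
have [kd|] := leP (k2 * d ^+ 2) 1.
  move=> u f Lf hu.
  have Lu : L u by case: hu => /DL.
  have e : nsq ip u = nsq ip (K f).
    have u0 := uniq _ _ Lf hu; have LKf := LK _ Lf.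
    have h := nsq0_ip SL (LB Lu LKf) Lu u0; have h' := nsq0_ip SL (LB Lu LKf) LKf u0.
    move: h h'; rewrite !(ipBl SL) // => /subr0_eq e1 /subr0_eq e2.
    by rewrite /nsq /rip e1 (sip_ipC SL Lu LKf) ReJ e2.
  rewrite e; have h := HKk _ Lf; have f0 := nsq_ge0 SL Lf.
  have d2 : 0 < d ^+ 2 by rewrite exprn_gt0.
  apply: le_trans (ler_wpM2l (ltW d2) h) _.
  by rewrite mulrA (mulrC (d ^+ 2)) -[leRHS]mul1r ler_wpM2r.
move=> kd; exfalso.
have k20 : 0 < k2.
  rewrite ltNge; apply/negP => k2n; have : k2 * d ^+ 2 <= 0.
    by rewrite mulr_le0_ge0 // sqr_ge0.
  by move=> h; have := lt_le_trans kd h; rewrite ltr10.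
pose k := Num.sqrt k2.
have k0 : 0 < k by rewrite sqrtr_gt0.
have k2E : k ^+ 2 = k2 by rewrite sqr_sqrtr // ltW.
have kd1 : k^-1 < d.
  rewrite invf_plt ?posrE //; rewrite -(ltr_pM2r d0) mulVf ?gt_eqF //.
  rewrite -(ltr_pXn2r (n := 2)) ?nnegrE ?ler01 ?mulr_ge0 ?(ltW k0) ?(ltW d0) //.
  by rewrite expr1n exprMn k2E.
(* With r = (K - s) g, the vector K g solves the resolvent equation at m + 1/s with right-hand side
   - r / s. *)
have below (s : R) : s != 0 -> `|s^-1| < d -> exists2 C, 0 < C &
    forall g, L g -> nsq ip g <= C * nsq ip (K g - rc s *: g).
  move=> s0 sd; have [|_ [M HM]] := reg (m + s^-1); first by rewrite addrC addKr.
  exists (2 * s ^- 2 * (`|M| * s ^- 2 + 1)).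
    apply: mulr_gt0; last by apply: ltr_wpDl => //; rewrite mulr_ge0 // invr_ge0 exprn_even_ge0.
    by rewrite mulr_gt0 // invr_gt0 exprn_even_gt0.
  move=> g Lg; set r := K g - rc s *: g.
  have LKg := LK _ Lg.
  have Lr : L r by apply: LB => //; exact: LZ.
  have sg : g = rc s^-1 *: (K g - r).
    by rewrite /r opprB addrC subrK scalerA -realcMM mulVf // scale1r.
  have h : graph (K g) (- (rc s^-1 *: r) + rc (m + s^-1) *: K g).
    have := HK _ Lg; rewrite {2}sg scalerBr realcD scalerDl.
    by rewrite (addrC (rc s^-1 *: K g)) -addrA (addrC (rc s^-1 *: K g)).
  have L1 : L (rc s^-1 *: r) by exact: LZ.
  have := HM _ _ (sip_opp SL L1) h.
  rewrite (nsqN SL) // (nsqZr SL) // => hK.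
  rewrite {1}sg (nsqZr SL); last exact: LB.
  have r0 := nsq_ge0 SL Lr.
  have s2 : 0 < s^-1 ^+ 2 by rewrite exprn_even_gt0 //= invr_eq0.
  have := nsqB_le SL LKg Lr => hB.
  have hM : M * (s^-1 ^+ 2 * nsq ip r) <= `|M| * (s^-1 ^+ 2 * nsq ip r).
    by rewrite ler_wpM2r ?ler_norm // mulr_ge0 // ltW.
  rewrite -exprVn (_ : 2 * _ * _ * _ = s^-1 ^+ 2 * (2 * (`|M| * (s^-1 ^+ 2 * nsq ip r)) + 2 * nsq ip r)); last by ring.
  rewrite ler_pM2l //; lra.
have kN0 : k != 0 by rewrite gt_eqF.
have [C1 C10 H1] : exists2 C, 0 < C &
    forall g, L g -> nsq ip g <= C * nsq ip (K g - rc k *: g).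
  by apply: below => //; rewrite gtr0_norm // invr_gt0.
have [C2 C20 H2] : exists2 C, 0 < C &
    forall g, L g -> nsq ip g <= C * nsq ip (K g - rc (- k) *: g).
  by apply: below => //; rewrite ?oppr_eq0 // invrN normrN gtr0_norm // invr_gt0.
have Ksym f g : L f -> L g -> ip (K f) g = ip f (K g).
  move=> Lf Lg; have := graph_sym (HK f Lf) (HK g Lg).
  have LKf := LK f Lf; have LKg := LK g Lg.
  rewrite (sip_ipDl SL) ?(ipDr SL) ?(sip_ipZl SL) ?(ipZr SL) // ?cj_rc; do ?exact: LZ.
  by move=> /addIr ->.
(* (K - k) (K + k) f equals K^2 f - k^2 f up to a null vector, and |K^2 f| <= k |K f| bounds its
   squared norm by k^2 (k^2 |f|^2 - |K f|^2). *)
have main f : L f -> nsq ip f <= C1 * C2 * (k2 * (k2 * nsq ip f - nsq ip (K f))).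
  move=> Lf; have LKf := LK _ Lf; have LKKf := LK _ LKf.
  pose g := K f - rc (- k) *: f.
  have Lg : L g by apply: LB => //; exact: LZ.
  pose g' := K (K f) - rc k2 *: f.
  have Lg' : L g' by apply: LB => //; exact: LZ.
  have eK : nsq ip (K g - rc k *: g) = nsq ip g'.
    have h1 : graph (K (K f) - rc (- k) *: K f) (g + rc m *: (K (K f) - rc (- k) *: K f)).
      have := graph_sub (HK _ LKf) (graph_scale (rc (- k)) (HK _ Lf)).
      rewrite scalerDr opprD addrACA scalerA (mulrC (rc (- k))) -scalerA -scalerBr //.
    have LK1 : L (K (K f) - rc (- k) *: K f) by apply: LB => //; exact: LZ.
    have LKg := LK _ Lg.
    have := uniq _ _ Lg h1; set w := _ - _ => w0.
    have Lw : L w by exact: LB.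
    have -> : K g - rc k *: g = g' - w.
      rewrite /w /g' /g -k2E expr2 realcMM realcN !scaleNr !opprK -scalerA scalerDr.
      by rewrite opprB addrCA !opprD addrACA subrr add0r (addrC (- (rc k *: (rc k *: f)))).
    rewrite (nsqB SL) // w0 addr0 (ripC SL) // /rip (nsq0_ip SL) //=; lra.
  have hK : nsq ip g' = nsq ip (K (K f)) - 2 * (k2 * nsq ip (K f)) + k2 ^+ 2 * nsq ip f.
    rewrite (nsqB SL) ?(nsqZr SL) ?(ripZr SL) //; last exact: LZ.
    by rewrite /rip Ksym.
  have := H1 _ Lg; rewrite eK hK => hg.
  have := H2 _ Lf; rewrite -/g => hf.
  apply: le_trans hf _; rewrite (mulrC C1) -mulrA ler_pM2l //.
  apply: le_trans hg _; rewrite ler_pM2l //.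
  have := HKk _ LKf; nra.
have C0 : 0 < C1 * C2 by exact: mulr_gt0.
set C := C1 * C2 in main C0.
have Kb f : L f -> nsq ip (K f) <= (k2 - (C * k2)^-1) * nsq ip f.
  move=> Lf; have := main f Lf; rewrite mulrA => h.
  rewrite -(ler_pM2l (x := C * k2)); last exact: mulr_gt0.
  rewrite mulrA mulrBr mulfV ?gt_eqF ?mulr_gt0 // mulrBl mul1r; lra.
have : k2 <= k2 - (C * k2)^-1.
  apply: ge_sup; last by move=> x [f Lf [f1 ->]]; have := Kb _ Lf; rewrite f1 mulr1.
  apply/set0P/negP => /eqP A0; move: k20; rewrite /k2 A0 sup0 ltxx //.
have : 0 < (C * k2)^-1 by rewrite invr_gt0 mulr_gt0.
by move=> h1 h2; lra.
Qed.
Lemma graph_nsq_eq u f v : graph u f -> L v -> nsq ip (u - v) = 0 ->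
  nsq ip u = nsq ip v /\ forall w, L w -> ip u w = ip v w.
Proof.
move=> [/DL Lu _ _] Lv h.
have E w : L w -> ip u w = ip v w.
  move=> Lw; have := nsq0_ip SL (LB Lu Lv) Lw h; rewrite (ipBl SL) // => /eqP.
  by rewrite subr_eq0 => /eqP.
by split=> //; rewrite /nsq /rip E // (sip_ipC SL Lu Lv) ReJ E.
Qed.

Section Bottom.
Variable l : seq (X * R).
Hypothesis l_eig : forall p, p \in l -> graph p.1 (rc p.2 *: p.1) /\ nsq ip p.1 = 1.

Definition perp f := D f /\ forall p, p \in l -> ip f p.1 = 0.

Let Lp p : p \in l -> L p.1. Proof. by move=> /l_eig[[/DL]]. Qed.

Lemma perpD f g : perp f -> perp g -> perp (f + g).
Proof.
move=> [Df hf] [Dg hg]; split; first exact: DD.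
by move=> p on_plane; rewrite (sip_ipDl SL) ?hf ?hg ?addr0 //; [exact: DL|exact: DL|exact: Lp].
Qed.

Lemma perpZ (a : R[i]) f : perp f -> perp (a *: f).
Proof.
move=> [Df hf]; split; first exact: DZ.
by move=> p on_plane; rewrite (sip_ipZl SL) ?hf ?mulr0 //; [exact: DL|exact: Lp].
Qed.

Lemma perpB f g : perp f -> perp g -> perp (f - g).
Proof. by move=> hf hg; rewrite -scaleN1r; apply: perpD => //; exact: perpZ. Qed.

(** Pairing the equation for [u] with an eigenvector gives (p.2 - z) <u, p.1> = 0, and p.2 differs
    from z because an eigenvalue is never regular. *)
Lemma perp_resolvent (z : R) u f : regular z -> L f -> (forall p, p \in l -> ip f p.1 = 0) ->
  graph u (f + rc z *: u) -> perp u.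
Proof.
move=> [_ [M HM]] Lf hf hu; have Du : D u by case: hu.
have Lu := DL Du.
split=> // p on_plane; have [hp p1] := l_eig on_plane.
have Lp1 := Lp on_plane.
have pz : p.2 - z != 0.
  apply/eqP => /eqP; rewrite subr_eq0 => /eqP pz.
  have L0 : L 0 by rewrite -(scale0r f); exact: LZ.
  have := HM p.1 0 L0; rewrite add0r -pz => /(_ hp).
  by rewrite p1 /nsq /rip (ip0l SL) // mulr0 ler10.
have := graph_sym hu hp.
rewrite (sip_ipDl SL) ?(sip_ipZl SL) ?hf ?add0r ?(ipZr SL) ?cj_rc //; last exact: LZ.
move/eqP; rewrite eq_sym -subr_eq0 -mulrBl -realcB mulf_eq0 => /orP[/eqP|/eqP //].
by move=> /(congr1 (@complex.Re R)) /= /eqP; rewrite (negbTE pz).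
Qed.

Variable a : R.
Hypothesis a_low : forall f, perp f -> a * nsq ip f <= nsq Q f.
Hypothesis a_adh : forall e, 0 < e -> exists f, [/\ perp f, nsq ip f = 1 & nsq Q f < a + e].

(** The form of H - a, nonnegative on [perp] because [a] bounds the Rayleigh quotient there. Its
    Cauchy-Schwarz inequality does the work of a functional calculus. *)
Definition qa u v := Q u v - rc a * ip u v.

Lemma nsq_qa u : D u -> nsq qa u = nsq Q u - a * nsq ip u.
Proof. by move=> Du; rewrite /nsq /rip /qa ReD ReN realcM. Qed.

Lemma sip_qa : sip perp qa.
Proof.
split; [exact: perpD|exact: perpZ| | | | ].
- move=> u v w [Du _] [Dv _] [Dw _]; rewrite /qa (sip_ipDl SD) // (sip_ipDl SL); try exact: DL.
  by rewrite mulrDr opprD addrACA.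
- move=> b u w [Du _] [Dw _]; rewrite /qa (sip_ipZl SD) // (sip_ipZl SL); try exact: DL.
  by rewrite mulrBr mulrCA.
- move=> u v [Du _] [Dv _]; rewrite /qa (sip_ipC SD Du) // (sip_ipC SL (DL Du)); try exact: DL.
  by rewrite conjcD conjcN conjcM cj_rc.
- by move=> u pu; have := a_low pu; rewrite -[complex.Re _]/(nsq qa u) nsq_qa ?subr_ge0 //; case: pu.
Qed.

Lemma graph_qa u g v : graph u (g + rc a *: u) -> D v -> L g -> qa u v = ip g v.
Proof.
move=> [Du _ h] Dv Lg; rewrite /qa h // (sip_ipDl SL) ?(sip_ipZl SL) ?addrK //; try exact: DL.
by apply: LZ; exact: DL.
Qed.

(** For a unit [f] with [qa f f] very small and u = (H - a)^-1 f, Cauchy-Schwarz for [qa] gives 1 =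
    (qa u f)^2 <= <f, u> qa f f, while <f, u> is bounded by the resolvent. *)
Lemma not_regular_bottom : ~ regular a.
Proof.
move=> ra; have [surj [M HM]] := ra.
have e0 : 0 < (2 * (`|M| + 1))^-1 by rewrite invr_gt0 mulr_gt0 // ltr_wpDl.
have [f [pf f1 fa]] := a_adh e0.
have Lf : L f by case: pf => /DL.
have [u hu] := surj f Lf.
have pu : perp u by apply: (perp_resolvent ra Lf) => //; case: pf.
have [Du Df] : D u /\ D f by case: pu; case: pf.
have := cauchy_schwarz sip_qa pu pf.
rewrite /rip (graph_qa hu) // -/(rip ip f f) -/(nsq _ _) f1 expr1n.
rewrite (nsq_qa Df) f1 mulr1 {1}/nsq /rip (graph_qa hu) // -/(rip _ _ _).
have := cauchy_schwarz SL Lf (DL Du); rewrite f1 mul1r => h1.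
have := HM _ _ Lf hu; rewrite f1 mulr1 => h2.
set x := rip ip f u in h1 *; set y := nsq Q f - a => h3.
have y0 : 0 <= y by have := a_low pf; rewrite f1 mulr1 /y; lra.
have x2 : x <= `|M| + 1.
  have : x ^+ 2 <= `|M| by rewrite (le_trans h1) // (le_trans h2) // ler_norm.
  have := sqr_ge0 (x - 1); have : 0 <= `|M| by []. nra.
have : y < (2 * (`|M| + 1))^-1 by rewrite /y; lra.
have Mp : 0 < `|M| + 1 by rewrite ltr_wpDl.
move=> yl.
have : x * y <= (`|M| + 1) * y by rewrite ler_wpM2r.
have : (`|M| + 1) * y < (`|M| + 1) * (2 * (`|M| + 1))^-1 by rewrite ltr_pM2l.
rewrite invfM mulrCA mulfV ?gt_eqF //; lra.
Qed.

(** The vectors h_n = t_n (H - a + t_n)^-1 f, with t_n decreasing to 0, approximate the projection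
    of [f] on the kernel of H - a. The spectral gap above the isolated point [a] makes them a Cauchy
    sequence, and keeps their limit away from 0 because the energy of [f] lies inside the gap. *)
Lemma bottom_eigenvector : exists u, [/\ perp u, nsq ip u = 1 & graph u (rc a *: u)].
Proof.
have [e e0 He] := isolated not_regular_bottom.
(* A third of the isolation radius: the interval of radius d about a + d then consists of regular
   points, and so do all the a - t_n with t_n <= d. *)
pose d := e / 3; have d0 : 0 < d by rewrite divr_gt0.
have de : e = 3 * d by rewrite /d; field.
(* Expanding the square in [resolvent_bound] at a + d leaves this. It expresses that a point x of
   the spectrum of H - a on the nonnegative side satisfies 2 d x <= x^2. *)
have gap u g : L g -> graph u (g + rc a *: u) -> 2 * d * rip ip g u <= nsq ip g.
  move=> Lg hu; have Lu : L u by case: hu => /DL.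
  have h : graph u ((g - rc d *: u) + rc (a + d) *: u).
    by rewrite realcD scalerDl addrCA addrNK addrC.
  have Lr : L (g - rc d *: u) by apply: LB => //; exact: LZ.
  have := resolvent_bound d0 _ Lr h.
  rewrite (nsqB SL) ?(nsqZr SL) ?(ripZr SL) //; last exact: LZ.
  have reg w : `|w - (a + d)| < d -> regular w.
    rewrite ltr_distl => /andP[w1 w2]; apply: He; first by apply/negP => /eqP wa; lra.
    rewrite gtr0_norm; lra.
  by move=> /(_ reg); lra.
have [f [pf f1 fa]] : exists f, [/\ perp f, nsq ip f = 1 & nsq Q f < a + d] by exact: a_adh.
have Lf : L f by case: pf => /DL.
have Df : D f by case: pf.
pose t n : R := d / n.+1%:R.
have t0 n : 0 < t n by rewrite divr_gt0.
have td n : t n <= d by rewrite ler_pdivrMr // ler_peMr ?(ltW d0) // ler1n.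
have regt n : regular (a - t n).
  have := t0 n; have := td n => h1 h2; apply: He; first by apply/negP => /eqP wa; lra.
  by rewrite addrAC subrr add0r normrN gtr0_norm //; lra.
have ex n : exists u, graph u (f + rc (a - t n) *: u) by case: (regt n) => /(_ f Lf).
pose u n := projT1 (cid (ex n)).
have hu n : graph (u n) (f + rc (a - t n) *: u n) by rewrite /u; case: cid.
have pu n : perp (u n) by apply: (perp_resolvent (regt n) Lf) => //; case: pf.
have Du n : D (u n) by case: (pu n).
have Lu n : L (u n) by exact: DL.
pose h n := rc (t n) *: u n.
have ph n : perp (h n) by exact: perpZ.
have Dh n : D (h n) by case: (ph n).
have Lh n : L (h n) by exact: DL.
have hu' n : graph (u n) ((f - h n) + rc a *: u n).
  have := hu n; rewrite realcB scalerBl -/(h n) addrA addrAC //.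
have Lfh n : L (f - h n) by exact: LB.
have hpos n : 0 <= rip ip (f - h n) (h n).
  rewrite (ripZr SL) // mulr_ge0 ?(ltW (t0 n)) //.
  by have := nsq_ge0 sip_qa (pu n); rewrite /nsq /rip (graph_qa (hu' n)).
have hle n : nsq ip (f - h n) <= 1.
  have := hpos n; rewrite (ripBl SL) // -/(nsq ip (h n)) (nsqB SL) // f1.
  have := nsq_ge0 SL (Lh n); lra.
(* Cauchy-Schwarz for [qa] at u_n and f, where H - a maps u_n to f - h_n; the factor [qa] of u_n is
   controlled by [gap]. *)
have fh n : nsq ip (f - h n) <= (2 * d)^-1 * (nsq Q f - a).
  have pfh : perp (f - h n) by exact: perpB.
  have Dfh : D (f - h n) by case: pfh.
  have := cauchy_schwarz sip_qa (pu n) pf.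
  rewrite (nsq_qa Df) f1 mulr1.
  have -> : rip qa (u n) f = rip ip (f - h n) f by rewrite /rip (graph_qa (hu' n)).
  have -> : nsq qa (u n) = rip ip (f - h n) (u n) by rewrite /nsq /rip (graph_qa (hu' n)).
  move=> h1.
  have h2 := gap _ _ (Lfh n) (hu' n).
  have := hpos n; rewrite (ripBl SL) // (ripC SL Lf) // -/(nsq _ _) => h3.
  have h4 : nsq ip (f - h n) <= rip ip (f - h n) f.
    by rewrite {1}/nsq (ripBr SL) // gerBl hpos.
  have h5 := nsq_ge0 SL (Lfh n).
  set x := nsq ip (f - h n) in h1 h2 h4 h5 *; set y := rip ip (f - h n) f in h1 h4.
  set w := rip ip (f - h n) (u n) in h1 h2; set q := nsq Q f - a in h1 *.
  have q0 : 0 <= q by have := a_low pf; rewrite f1 mulr1 /q; lra.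
  have : x ^+ 2 <= x * ((2 * d)^-1 * q).
    apply: le_trans (_ : y ^+ 2 <= _); first by rewrite ler_pXn2r ?nnegrE // (le_trans h5).
    apply: le_trans h1 _; rewrite mulrA ler_wpM2r // mulrC -ler_pdivrMl ?invr_gt0 ?mulr_gt0 //.
    by rewrite invrK.
  rewrite expr2; move: h5; rewrite le_eqVlt => /orP[/eqP <- _|x0]; last by rewrite ler_pM2l.
  by rewrite mulr_ge0 // invr_ge0 mulr_ge0 // ltW.
(* H - a maps k = u_m - u_n to v = h_n - h_m, and maps v to [r], which is of order t_n + t_m.
   Cauchy-Schwarz for [qa] at k and v together with [gap] gives 2 d |v|^2 <= <r, v>. *)
have cau n m : nsq ip (h n - h m) <= (2 * d) ^- 2 * (2 * t n ^+ 2 + 2 * t m ^+ 2).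
  set v := h n - h m.
  pose k := u m - u n.
  have pk : perp k by exact: perpB.
  have pv : perp v by exact: perpB.
  have [Dk Dv] : D k /\ D v by case: pk; case: pv.
  have [Lk Lv] := (DL Dk, DL Dv).
  have gk : graph k (v + rc a *: k).
    have -> : v = (f - h m) - (f - h n) by rewrite opprB addrC addrA subrK.
    by have := graph_sub (hu' m) (hu' n); rewrite opprD addrACA -scalerBr.
  pose r := rc (t n) *: (f - h n) - rc (t m) *: (f - h m).
  have Lr : L r by apply: LB; exact: LZ.
  have gv : graph v (r + rc a *: v).
    have := graph_sub (graph_scale (rc (t n)) (hu' n)) (graph_scale (rc (t m)) (hu' m)).
    rewrite (scalerDr (rc (t n)) (f - h n)) (scalerDr (rc (t m)) (f - h m)) opprD addrACA.
    have C i : rc (t i) *: (rc a *: u i) = rc a *: h i by rewrite /h !scalerA mulrC.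
    by rewrite !C -scalerBr.
  have Lr2 : nsq ip r <= 2 * t n ^+ 2 + 2 * t m ^+ 2.
    apply: le_trans (nsqB_le SL (LZ _ (Lfh n)) (LZ _ (Lfh m))) _.
    rewrite !(nsqZr SL) //; apply: lerD; rewrite ler_pM2l //.
      by rewrite -[leRHS]mulr1 ler_wpM2l ?sqr_ge0.
    by rewrite -[leRHS]mulr1 ler_wpM2l ?sqr_ge0.
  have := cauchy_schwarz sip_qa pk pv.
  rewrite {1}/rip (graph_qa gk) // -!/(rip _ _ _) -/(nsq _ _) => h1.
  have e1 : nsq qa k = rip ip v k by rewrite /nsq /rip (graph_qa gk).
  have e2 : nsq qa v = rip ip r v by rewrite /nsq /rip (graph_qa gv).
  have g1 := gap _ _ Lv gk.
  have g2 := nsq_ge0 sip_qa pv; have g3 := nsq_ge0 sip_qa pk.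
  have g4 := cauchy_schwarz SL Lr Lv.
  rewrite e1 e2 in h1; rewrite e2 in g2; rewrite e1 in g3.
  have g5 := nsq_ge0 SL Lv; have g6 := nsq_ge0 SL Lr.
  apply: le_trans (ler_wpM2l _ Lr2); last by rewrite invr_ge0 sqr_ge0.
  set x := nsq ip v in h1 g1 g4 g5 *; set y := rip ip v k in h1 g1 g3.
  set z := rip ip r v in h1 g2 g4; set q := nsq ip r in g4 g6 *.
  have c0 : 0 < 2 * d by rewrite mulr_gt0.
  set c := 2 * d in c0 g1 *.
  move: g5; rewrite le_eqVlt => /orP[/eqP <-|x0].
    by rewrite mulr_ge0 // invr_ge0 sqr_ge0.
  have h2 : c * x <= z.
    rewrite -(ler_pM2l x0) mulrCA -expr2 (le_trans (ler_wpM2l (ltW c0) h1)) //.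
    by rewrite mulrA ler_wpM2r.
  have h3 : (c * x) ^+ 2 <= q * x.
    by apply: le_trans g4; rewrite ler_pXn2r ?nnegrE // mulr_ge0 ?ltW.
  rewrite mulrC ler_pdivlMr ?exprn_gt0 // -(ler_pM2r x0).
  by rewrite (_ : x * c ^+ 2 * x = (c * x) ^+ 2) //; ring.
have tsmall e1 : 0 < e1 -> exists N, forall n, (N <= n)%N -> t n ^+ 2 <= e1.
  move=> e10; exists `|Num.ceil (d ^+ 2 / e1)|%N => n Nn.
  have n1 : d ^+ 2 / e1 <= n.+1%:R.
    apply: le_trans (ceil_ge _) _; apply: le_trans (ler_norm _) _.
    by rewrite -intr_norm -natr_absz ler_nat (leq_trans Nn).
  rewrite /t expr_div_n ler_pdivrMr ?exprn_gt0 // -ler_pdivrMl // mulrC.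
  by apply: le_trans n1 _; rewrite expr2 -[leLHS]mulr1 ler_wpM2l // ler1n.
have cauchy_h e1 : 0 < e1 -> exists N, forall n m, (N <= n)%N -> (N <= m)%N ->
    nsq ip (h n - h m) <= e1.
  move=> e10.
  have c0 : 0 < (2 * d) ^+ 2 by rewrite exprn_gt0 // mulr_gt0.
  have [N HN] := tsmall (e1 * (2 * d) ^+ 2 / 4) (divr_gt0 (mulr_gt0 e10 c0) (ltr0Sn _ _)).
  exists N => n m nN mN; apply: le_trans (cau n m) _.
  rewrite mulrC ler_pdivrMr //; have := HN _ nN; have := HN _ mN; lra.
have [v Lv hv] := complete Lh cauchy_h.
(* The limit [v] is known only to lie in [L]. The bounded inverse at the regular point a - d yields
   a vector [x] of the operator domain that differs from [v] by a null vector. *)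
have [r0 regr] : exists r0, r0 = a - d /\ regular r0.
  exists (a - d); split=> //; apply: He; first by apply/negP => /eqP wa; lra.
  by rewrite addrAC subrr add0r normrN gtr0_norm //; lra.
case: regr => r0E regr; have [surj [M HM]] := regr.
have [x hx] := surj (rc d *: v) (LZ _ Lv).
have Lx : L x by case: hx => /DL.
have xv : nsq ip (x - v) = 0.
  apply/eqP; rewrite eq_le (nsq_ge0 SL) ?andbT; last exact: LB.
  apply/ler_addgt0Pl => e1 e10; rewrite addr0.
  pose M1 : R := `|M| + 1.
  have M10 : 0 < M1 by rewrite ltr_wpDl.
  pose e2 : R := e1 / (4 * (M1 * (d ^+ 2 + 1) + 1)).
  have den : 0 < 4 * (M1 * (d ^+ 2 + 1) + 1).
    by apply: mulr_gt0 => //; apply: ltr_wpDl => //; rewrite mulr_ge0 ?(ltW M10) // addr_ge0 ?sqr_ge0.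
  have e20 : 0 < e2 by rewrite divr_gt0.
  have [N1 HN1] := hv e2 e20; have [N2 HN2] := tsmall e2 e20.
  pose n := maxn N1 N2.
  have a1 := HN1 n (leq_maxl _ _); have a2 := HN2 n (leq_maxr _ _).
  have gh : graph (h n) ((rc (t n) *: (f - h n) + rc d *: h n) + rc r0 *: h n).
    have := graph_scale (rc (t n)) (hu' n).
    rewrite scalerDr scalerA mulrC -scalerA -/(h n) -addrA -scalerDl -realcD.
    by rewrite r0E (addrC d) subrK.
  have gd := graph_sub hx gh.
  rewrite opprD addrACA -scalerBr in gd.
  set w := rc d *: v - _ in gd.
  have wE : w = rc d *: (v - h n) - rc (t n) *: (f - h n).
    by rewrite /w (scalerBr (rc d)) opprD addrCA addrC.
  have Lw : L w by rewrite wE; apply: LB; apply: LZ => //; exact: LB.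
  have := HM _ _ Lw gd => b1.
  have b2 : nsq ip w <= (2 * d ^+ 2 + 2) * e2.
    rewrite wE; apply: le_trans (nsqB_le SL (LZ _ (LB Lv (Lh n))) (LZ _ (Lfh n))) _.
    rewrite !(nsqZr SL) //; last exact: LB.
    have -> : nsq ip (v - h n) = nsq ip (h n - v).
      by rewrite -opprB (nsqN SL) //; exact: LB.
    have := ler_wpM2l (sqr_ge0 d) a1; have := ler_wpM2l (sqr_ge0 (t n)) (hle n); lra.
  have b3 : nsq ip (x - h n) <= M1 * ((2 * d ^+ 2 + 2) * e2).
    apply: le_trans b1 _; have w0 := nsq_ge0 SL Lw.
    apply: le_trans (_ : M1 * nsq ip w <= _); last by rewrite ler_pM2l.
    by rewrite ler_wpM2r // (le_trans (ler_norm M)) // lerDl.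
  have b4 : nsq ip (x - v) <= 2 * nsq ip (x - h n) + 2 * nsq ip (h n - v).
    rewrite -[x - v](_ : (x - h n) + (h n - v) = x - v); last by rewrite addrA subrK.
    by apply: (nsqD_le SL); exact: LB.
  apply: le_trans b4 _.
  apply: le_trans (_ : 4 * (M1 * (d ^+ 2 + 1) + 1) * e2 <= _); last first.
    by rewrite mulrC divfK // gt_eqF.
  by lra.
have [xv1 xv2] := graph_nsq_eq hx Lv xv.
have gx : graph x (rc a *: x).
  have : graph x (rc d *: x + rc r0 *: x).
    apply: graph_ae hx; first by apply: LD; exact: LZ.
    rewrite opprD addrACA subrr addr0 -scalerBr (nsqZr SL); last exact: LB.
    by rewrite -opprB (nsqN SL) ?xv ?mulr0 //; exact: LB.
  by rewrite -scalerDl -realcD r0E addrC subrK.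
have px : perp x.
  split; first by case: gx.
  move=> p on_plane; have Lp1 := Lp on_plane; rewrite xv2 //; apply: sqn0_eq0.
  apply/eqP; rewrite eq_le sqn_ge0 andbT; apply/ler_addgt0Pl => e1 e10; rewrite addr0.
  have [N HN] := hv e1 e10; have := HN N (leqnn _).
  have [_ hp0] := ph N; have := cauchy_schwarzC SL (LB (Lh N) Lv) Lp1.
  rewrite (ipBl SL) // hp0 // sub0r (l_eig on_plane).2 mulr1.
  by rewrite /sqn ReN ImN !sqrrN; apply: le_trans.
(* By [fh] the vectors f - h_n have squared norm at most q < 1 while [f] is a unit vector, so h_n
   does not tend to 0. *)
have x0 : 0 < nsq ip x.
  rewrite lt_neqAle (nsq_ge0 SL) // andbT; apply/negP => /eqP x0.
  have q1 : (2 * d)^-1 * (nsq Q f - a) < 1.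
    by rewrite mulrC ltr_pdivrMr ?mulr_gt0 // mul1r; lra.
  set q := _ * _ in q1 fh.
  pose e1 := ((1 - q) / 4) ^+ 2.
  have e10 : 0 < e1 by rewrite exprn_gt0 // divr_gt0 // subr_gt0.
  have [N HN] := hv e1 e10; have h1 := HN N (leqnn _).
  have v0 : nsq ip v = 0 by rewrite -xv1 -x0.
  have hN : nsq ip (h N) <= e1.
    have := h1; rewrite (nsqB SL) // v0 (ripC SL) // /rip (nsq0_ip SL) //=; lra.
  have := fh N; rewrite (nsqB SL) // f1.
  have := cauchy_schwarz SL Lf (Lh N); rewrite f1 mul1r => h2.
  have h3 : rip ip f (h N) <= (1 - q) / 4.
    rewrite leNgt; apply/negP => h4.
    have : ((1 - q) / 4) ^+ 2 < rip ip f (h N) ^+ 2.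
      rewrite ltr_pXn2r ?nnegrE //; first by rewrite divr_ge0 // subr_ge0 ltW.
      by apply: le_trans (ltW h4); rewrite divr_ge0 // subr_ge0 ltW.
    by rewrite -/e1; lra.
  have := nsq_ge0 SL (Lh N); lra.
exists (rc (Num.sqrt (nsq ip x))^-1 *: x); split; first exact: perpZ.
  by rewrite (nsqZr SL) // exprVn sqr_sqrtr ?(ltW x0) // mulVf // gt_eqF.
by rewrite scalerA mulrC -scalerA; exact: graph_scale.
Qed.

End Bottom.

(** * Successive minimization below a threshold *)

Section Family.
Variable s : R.

(** The latest eigenpair is at the head, and its value is the minimum of the Rayleigh quotient
    orthogonally to the tail; hence the values are nondecreasing in the order in which they are
    found. *)
Inductive eigenfamily : seq (X * R) -> Prop :=
| eigenfamily_nil : eigenfamily [::]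
| eigenfamily_cons u a l : eigenfamily l -> graph u (rc a *: u) -> nsq ip u = 1 ->
    a < s -> (forall p, p \in l -> ip u p.1 = 0) ->
    (forall f, perp l f -> a * nsq ip f <= nsq Q f) -> eigenfamily ((u, a) :: l).

Lemma eigenfamily_eig l : eigenfamily l ->
  forall p, p \in l -> graph p.1 (rc p.2 *: p.1) /\ nsq ip p.1 = 1.
Proof.
elim => [//|u a l' hl IH hu u1 _ _ _ p]; rewrite in_cons => /orP[/eqP ->//|]; exact: IH.
Qed.

Lemma eigenfamily_lt l : eigenfamily l -> forall p, p \in l -> p.2 < s.
Proof.
elim => [//|u a l' hl IH _ _ ua _ _ p]; rewrite in_cons => /orP[/eqP ->//|]; exact: IH.
Qed.

Lemma eigenfamily_extend l f : eigenfamily l -> perp l f -> nsq Q f < s * nsq ip f ->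
  exists p, eigenfamily (p :: l).
Proof.
move=> hl pf fs; have le := eigenfamily_eig hl.
have Lperp g : perp l g -> L g by case=> /DL.
have normalize g : perp l g -> 0 < nsq ip g -> exists g', [/\ perp l g', nsq ip g' = 1 &
    nsq Q g' = nsq Q g / nsq ip g].
  move=> pg g0; exists (rc (Num.sqrt (nsq ip g))^-1 *: g).
  rewrite (nsqZr SL) ?(nsqZr SD) //; last 2 first.
  - by case: pg.
  - exact: Lperp.
  rewrite exprVn sqr_sqrtr ?(ltW g0) // mulVf ?gt_eqF // mulrC; split=> //.
  exact: perpZ.
pose A := [set x : R | exists g, [/\ perp l g, nsq ip g = 1 & x = nsq Q g]].
have A0 : lbound A 0 by move=> x [g [[Dg _] _ ->]]; exact: (nsq_ge0 SD).
have f0 : 0 < nsq ip f.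
  rewrite lt_neqAle (nsq_ge0 SL) ?andbT; last exact: Lperp.
  apply/negP => /eqP f0; move: fs; rewrite -f0 mulr0 ltNge (nsq_ge0 SD) //.
  by case: pf.
have hA : has_inf A.
  split; last by exists 0.
  by have [g [pg g1 _]] := normalize f pf f0; exists (nsq Q g), g.
pose a := inf A.
have low g : perp l g -> a * nsq ip g <= nsq Q g.
  move=> pg; have := nsq_ge0 SL (Lperp _ pg); rewrite le_eqVlt => /orP[/eqP <-|g0].
    by rewrite mulr0 (nsq_ge0 SD) //; case: pg.
  rewrite -ler_pdivlMr //; have [g' [pg' g1 <-]] := normalize g pg g0.
  by apply: ge_inf; [exists 0|exists g'].
have adh e : 0 < e -> exists g, [/\ perp l g, nsq ip g = 1 & nsq Q g < a + e].
  by move=> e0; have [x [g [pg g1 ->]] xa] := inf_adherent e0 hA; exists g.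
have [u [pu u1 gu]] := bottom_eigenvector le low adh.
exists (u, a); apply: eigenfamily_cons => //; last by case: pu.
by rewrite -(ltr_pM2r f0); apply: le_lt_trans fs; exact: low.
Qed.

(** If the construction never stopped, its eigenvalues would increase to a limit [a]. The limit
    cannot be regular, the psi_n being approximate eigenvectors; if it is isolated, the eigenvalues
    are eventually equal to it, and its multiplicity is infinite. *)
Lemma eigenfamily_maximal : exists2 l, eigenfamily l &
  forall f, perp l f -> s * nsq ip f <= nsq Q f.
Proof.
apply: contrapT => /forall2NP H.
have ext l : exists p, eigenfamily l -> eigenfamily (p :: l).
  case: (pselect (eigenfamily l)) => hl; last by exists (0, 0).
  have [//|/existsNP[f /not_implyP[pf /negP]]] := H l.
  by rewrite -ltNge => fs; have [p hp] := eigenfamily_extend hl pf fs; exists p.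
pose step l := projT1 (cid (ext l)).
have stepP l : eigenfamily l -> eigenfamily (step l :: l).
  by rewrite /step; case: cid.
pose fam := fix F n := if n is n'.+1 then step (F n') :: F n' else [::].
have famP n : eigenfamily (fam n).
  by elim: n => [|n IH]; [exact: eigenfamily_nil|exact: stepP].
pose psi n := (step (fam n)).1; pose mu n := (step (fam n)).2.
have psiE n : (psi n, mu n) = step (fam n) by rewrite /psi /mu -surjective_pairing.
have H1 n : [/\ graph (psi n) (rc (mu n) *: psi n), nsq ip (psi n) = 1, mu n < s,
    forall p, p \in fam n -> ip (psi n) p.1 = 0 &
    forall f, perp (fam n) f -> mu n * nsq ip f <= nsq Q f].
  have := famP n.+1; rewrite /= -psiE => hn; inversion hn; by subst.
have inF n m : (n < m)%N -> (psi n, mu n) \in fam m.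
  elim: m => // m IH; rewrite ltnS leq_eqVlt => /orP[/eqP ->|nm] /=.
    by rewrite -psiE in_cons eqxx.
  by rewrite in_cons IH // orbT.
have Lpsi n : L (psi n) by case: (H1 n) => -[/DL].
have QE n : nsq Q (psi n) = mu n.
  have [[Dn _ h] n1 _ _ _] := H1 n.
  by rewrite /nsq /rip h // (sip_ipZl SL) // (ip_nsq SL) // n1 realcM /= mulr1.
have pp n m : (n <= m)%N -> perp (fam n) (psi m).
  move=> nm; have [[Dm _ _] _ _ h _] := H1 m; split=> // p pn; apply: h.
  elim: m nm {Dm} => [|m IH]; first by rewrite leqn0 => /eqP <-.
  rewrite leq_eqVlt => /orP[/eqP <- //|]; rewrite ltnS => /IH hm.
  by rewrite /= in_cons hm orbT.
have mono : nondecreasing_seq mu.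
  apply/nondecreasing_seqP => n; have [_ _ _ _ h] := H1 n.
  have := h _ (pp n n.+1 (leqnSn n)).
  by have [_ -> _ _ _] := H1 n.+1; rewrite mulr1 QE.
have bd : has_ubound (range mu) by exists s => _ [n _ <-]; have [_ _ /ltW] := H1 n.
have cv := nondecreasing_cvgn mono bd.
set a := sup _ in cv.
have mua n : mu n <= a by apply: sup_upper_bound; [split=> //; exists (mu 0), 0|exists n].
have near e : 0 < e -> exists N, forall n, (N <= n)%N -> `|mu n - a| < e.
  by move=> e0; move/cvgrPdist_lt : cv => /(_ e e0)[N _ HN]; exists N => n /HN; rewrite distrC.
(* For a regular [a] the resolvent bound keeps every [mu n] at a distance, and the claim is vacuous;
   for an isolated [a], a nearby [mu n] would be regular unless equal to [a], yet eigenvalues are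
   not regular. *)
have [e e0 He] : exists2 e : R, 0 < e & forall n, `|mu n - a| < e -> mu n = a.
  case: (pselect (regular a)) => [[_ [M HM]]|/isolated[e e0 He]].
    exists (Num.min 1 (`|M| + 1)^-1); first by rewrite lt_min ltr01 invr_gt0 ltr_wpDl.
    move=> n; rewrite lt_min => /andP[h1 h2]; exfalso.
    have [gn n1 _ _ _] := H1 n; have Ln := Lpsi n.
    have hn : graph (psi n) (rc (mu n - a) *: psi n + rc a *: psi n).
      by rewrite -scalerDl -realcD subrK.
    have := HM _ _ (LZ _ Ln) hn; rewrite (nsqZr SL) // n1 mulr1.
    rewrite -real_normK ?num_real // => h3.
    set x := `|mu n - a| in h1 h2 h3; have x0 : 0 <= x by exact: normr_ge0.
    have M0 : 0 < `|M| + 1 by rewrite ltr_wpDl.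
    have h4 : x * (`|M| + 1) < 1 by rewrite -ltr_pdivlMr // div1r.
    have h5 : M * x ^+ 2 <= `|M| * x by rewrite (le_trans (ler_wpM2r _ (ler_norm M))) ?sqr_ge0 //
      ler_wpM2l // expr2 ler_piMl // ltW.
    nra.
  exists e => // n ne; apply: contrapT => /eqP na; have rn := He _ na ne.
  have [gn n1 _ _ _] := H1 n; case: rn => _ [M HM].
  have L0 : L 0 by rewrite -(scale0r (psi n)); exact: LZ.
  have := HM (psi n) 0 L0; rewrite add0r => /(_ gn).
  by rewrite n1 /nsq /rip (ip0l SL) // mulr0 ler10.
have [N HN] := near e e0.
have [n Hn] := finite_mult a.
apply: (Hn (fun i : 'I_n => psi (N + i)%N)).
  move=> i; have [gi _ _ _ _] := H1 (N + i)%N.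
  by rewrite -(He (N + i)%N) //; apply: HN; rewrite leq_addr.
have ort i j : (i < j)%N -> ip (psi j) (psi i) = 0.
  by move=> ij; have [_ _ _ h _] := H1 j; have := h _ (inF _ _ ij).
move=> i j; have [ij|ji|/val_inj ->] := ltngtP i j.
- rewrite (sip_ipC SL (Lpsi _) (Lpsi _)) ort ?ltn_add2l // cj0.
  by rewrite -val_eqE /= ltn_eqF.
- by rewrite ort ?ltn_add2l // -val_eqE /= gtn_eqF.
- by rewrite eqxx (ip_nsq SL) //; have [_ -> _ _ _] := H1 (N + j)%N.
Qed.

Theorem spectral_family : exists N (psi : 'I_N -> X) (mu : 'I_N -> R),
  [/\ orthonormal psi, forall i, graph (psi i) (rc (mu i) *: psi i),
      forall i, mu i < s &
      forall f, D f -> (forall i, ip f (psi i) = 0) -> s * nsq ip f <= nsq Q f].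
Proof.
have [l hl Hl] := eigenfamily_maximal.
pose d : X * R := (0, 0).
exists (size l), (fun i => (nth d l i).1), (fun i => (nth d l i).2).
have le i : (i < size l)%N -> graph (nth d l i).1 (rc (nth d l i).2 *: (nth d l i).1) /\
    nsq ip (nth d l i).1 = 1.
  by move=> il; apply: (eigenfamily_eig hl); exact: mem_nth.
have Ll i : (i < size l)%N -> L (nth d l i).1 by move=> /le[[/DL]].
split.
- have ort : forall i j, (i < j)%N -> (j < size l)%N -> ip (nth d l i).1 (nth d l j).1 = 0.
    elim: hl => [//|u a l' hl' IH gu u1 _ ul _] [|i] [|j] //= ij jl; last exact: IH.
    by apply: ul; exact: mem_nth.
  move=> i j; have [ij|ji|/val_inj ->] := ltngtP i j.
  + by rewrite ort // -val_eqE /= ltn_eqF.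
  + by rewrite (sip_ipC SL (Ll _ _) (Ll _ _)) // ort // cj0 -val_eqE /= gtn_eqF.
  + by rewrite eqxx (ip_nsq SL) ?(le j _).2 //; exact: Ll.
- by move=> i; case: (le i (ltn_ord i)).
- by move=> i; apply: (eigenfamily_lt hl); exact: mem_nth.
- move=> f Df hf; apply: Hl; split=> // p /(nthP d)[i il <-].
  exact: (hf (Ordinal il)).
Qed.

End Family.
End Spectral.

(** * Measure theory of the plane *)
Section PlaneMeasurability.
Variable R : realType.

Definition square (c : R * R) (r : R) : set (R * R) :=
  [set x | (c.1 - r < x.1 < c.1 + r) /\ (c.2 - r < x.2 < c.2 + r)].

Lemma ball_squareP (c : R * R) (r : R) : ball c r = square c r.
Proof.
apply/seteqP; split=> [x [h1 h2]|x [h1 h2]].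
  move: h1 h2; rewrite /ball /= /ball_ /square /= => h1 h2; split.
    by rewrite -ltr_distl distrC.
  by rewrite -ltr_distl distrC.
split; rewrite /ball /= /ball_ /= distrC ltr_distl //.
Qed.

Lemma measurable_square c r : measurable (square c r).
Proof.
have -> : square c r = `]c.1 - r, c.1 + r[%classic `*` `]c.2 - r, c.2 + r[%classic.
  apply/seteqP; split=> [x [h1 h2]|x [h1 h2]] /=; split;
  by rewrite ?in_itv //; move: h1 h2; rewrite /= !in_itv.
by apply: measurableX; exact: measurable_itv.
Qed.

(** Rational centres and radii make the family countable; the condition on doubled squares leaves
    room for the closed squares inside [U]. *)
Lemma open_squares (U : set (R * R)) : open U ->
  exists (P : set nat) (c : nat -> R * R) (r : nat -> R),
    [/\ forall n, P n -> 0 < r n, forall n, P n -> square (c n) (2 * r n) `<=` U &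
        U = \bigcup_(n in P) square (c n) (r n)].
Proof.
move=> oU.
pose dec n : rat * rat * rat := odflt (0, 0, 0) (unpickle n).
pose c n : R * R := (ratr (dec n).1.1, ratr (dec n).1.2).
pose r n : R := ratr (dec n).2.
exists [set n | 0 < r n /\ square (c n) (2 * r n) `<=` U], c, r; split.
- by move=> n [].
- by move=> n [].
apply/seteqP; split=> [x Ux|x [n [rn sub] xn]]; last first.
  apply: sub; move: xn => [/andP[h1 h2] /andP[h3 h4]]; split; apply/andP; split; lra.
have [e /= e0 He] : nbhs_ball x U.
  by apply/nbhs_ballP; move: oU; rewrite openE => /(_ x Ux).
rewrite ball_squareP in He.
(* A point of the doubled square is within 2 q3 of the centre, and the centre within q3 of [x]. *)
have [q3] := @rat_in_itvoo R 0 (e / 3) (divr_gt0 e0 (ltr0Sn _ 2)).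
rewrite in_itv /= => /andP[q30 q3e].
have h (y : R) : y - ratr q3 < y + ratr q3 by lra.
have [q1] := rat_in_itvoo (h x.1); have [q2] := rat_in_itvoo (h x.2).
rewrite !in_itv /= => /andP[q2a q2b] /andP[q1a q1b].
have dE : dec (pickle (q1, q2, q3)) = (q1, q2, q3) by rewrite /dec pickleK.
exists (pickle (q1, q2, q3)); last by rewrite /c /r dE; split; apply/andP; split=> /=; lra.
rewrite /= /c /r dE /=; split=> // y [/andP[/= h1 h2] /andP[/= h3 h4]].
by apply: He; split; apply/andP; split => /=; lra.
Qed.

Lemma open2_measurable (U : set (R * R)) : open U -> measurable U.
Proof.
move=> /open_squares[P [c [r [_ _ ->]]]].
by apply: bigcup_measurable => n _; exact: measurable_square.
Qed.

Lemma continuous2_measurable (D : set (R * R)) (f : R * R -> R) :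
  measurable D -> continuous f -> measurable_fun D f.
Proof.
move=> mD cf; apply: (@measurable_funS _ _ _ _ setT) => //.
apply: (measurability _ (RGenOInfty.measurableE R)) => _ [_ [a ->] <-].
rewrite setTI; apply: open2_measurable.
by apply: open_comp => [x _|]; [exact: cf|exact: interval_open].
Qed.

Lemma compact2_measurable (K : set (R * R)) : compact K -> measurable K.
Proof.
move=> cK; rewrite -(setCK K); apply: measurableC; apply: open2_measurable.
by rewrite openC; apply: compact_closed => //; exact: norm_hausdorff.
Qed.

End PlaneMeasurability.

(** * Square integrable functions and their completeness *)

Section SquareIntegrable.
Context {d : measure_display} (T : measurableType d) (R : realType).
Variables (mu : {measure set T -> \bar R}) (D : set T).
Hypothesis mD : measurable D.
Implicit Types f g : T -> R.

Definition sqint f := measurable_fun D f /\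
  (\int[mu]_(x in D) (f x ^+ 2)%:E < +oo)%E.

Lemma measurable_sqr f : measurable_fun D f -> measurable_fun D (fun x => (f x ^+ 2)%:E).
Proof. by move=> mf; apply/measurable_EFinP; exact: measurable_funX. Qed.

Lemma integrable_nonneg f : measurable_fun D f -> (forall x, D x -> 0 <= f x) ->
  (\int[mu]_(x in D) (f x)%:E < +oo)%E -> mu.-integrable D (EFin \o f).
Proof.
move=> mf f0 h; apply/integrableP; split; first exact/measurable_EFinP.
apply: le_lt_trans h; apply: ge0_le_integral => //.
- by apply: measurableT_comp => //; exact/measurable_EFinP.
- exact/measurable_EFinP.
- by move=> x Dx; rewrite /= lee_fin ger0_norm // f0.
Qed.

Lemma sqint_integrable f : sqint f -> mu.-integrable D (EFin \o (fun x => f x ^+ 2)).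
Proof.
move=> [mf h]; apply: integrable_nonneg => //; first exact: measurable_funX.
by move=> x _; exact: sqr_ge0.
Qed.

Lemma integrable_sqint f : measurable_fun D f ->
  mu.-integrable D (EFin \o (fun x => f x ^+ 2)) -> sqint f.
Proof.
move=> mf /integrableP[_ h]; split=> //; apply: le_lt_trans h.
apply: ge0_le_integral => //.
- by move=> x _; rewrite lee_fin sqr_ge0.
- exact: measurable_sqr.
- by apply: measurableT_comp => //; exact: measurable_sqr.
- by move=> x _; rewrite /= lee_fin ler_norm.
Qed.

Lemma integrable_le f g : measurable_fun D f -> (forall x, D x -> `|f x| <= g x) ->
  mu.-integrable D (EFin \o g) -> mu.-integrable D (EFin \o f).
Proof.
move=> mf fg; apply: le_integrable => //; first exact/measurable_EFinP.
by move=> x Dx; rewrite /= lee_fin; apply: le_trans (fg _ Dx) _; exact: ler_norm.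
Qed.

Lemma sqint_mul f g : sqint f -> sqint g ->
  mu.-integrable D (EFin \o (fun x => f x * g x)).
Proof.
move=> hf hg; have [mf _] := hf; have [mg _] := hg.
apply: (@integrable_le _ (fun x => f x ^+ 2 + g x ^+ 2)).
- exact: measurable_funM.
- move=> x _; rewrite normrM -(real_normK (num_real (f x))) -(real_normK (num_real (g x))).
  have := sqr_ge0 (`|f x| - `|g x|); have := sqr_ge0 (`|f x| + `|g x|).
  by rewrite sqrrD sqrrB; lra.
- rewrite (_ : EFin \o _ = (EFin \o (fun x => f x ^+ 2)%R) \+ (EFin \o (fun x => g x ^+ 2)%R))%E.
    by apply: integrableD => //; exact: sqint_integrable.
  by apply/funext => x.
Qed.

Lemma sqintD f g : sqint f -> sqint g -> sqint (fun x => f x + g x).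
Proof.
move=> hf hg; have [mf _] := hf; have [mg _] := hg.
apply: integrable_sqint; first exact: measurable_funD.
apply: (@integrable_le _ (fun x => 2 * (f x ^+ 2) + 2 * (g x ^+ 2))).
- by apply: measurable_funX; exact: measurable_funD.
- move=> x _; rewrite ger0_norm ?sqr_ge0 //.
  by rewrite -subr_ge0 (_ : _ - _ = (f x - g x) ^+ 2) ?sqr_ge0 //; ring.
- rewrite (_ : EFin \o _ = (fun x => 2%:E * (EFin \o (fun x => f x ^+ 2)%R) x) \+
     (fun x => 2%:E * (EFin \o (fun x => g x ^+ 2)%R) x))%E.
    by apply: integrableD => //; apply: integrableZl => //; exact: sqint_integrable.
  by apply/funext => x.
Qed.

Lemma sqintZ (a : R) f : sqint f -> sqint (fun x => a * f x).
Proof.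
move=> hf; have [mf _] := hf.
apply: integrable_sqint; first exact: measurable_funM.
rewrite (_ : EFin \o _ = (fun x => (a ^+ 2)%:E * (EFin \o (fun x => f x ^+ 2)%R) x)%E).
  by apply: integrableZl => //; exact: sqint_integrable.
by apply/funext => x /=; rewrite exprMn.
Qed.

Lemma sqintN f : sqint f -> sqint (fun x => - f x).
Proof.
by move=> /(sqintZ (- 1)) h; rewrite (_ : (fun x => _) = (fun x => - 1 * f x)) //;
  apply/funext => x; rewrite mulN1r.
Qed.

Lemma sqintB f g : sqint f -> sqint g -> sqint (fun x => f x - g x).
Proof. by move=> hf /sqintN; exact: sqintD. Qed.

Lemma limn_einf_le_cst (u : (\bar R)^nat) l : (forall n, u n <= l)%E -> (limn_einf u <= l)%E.
Proof.
move=> ul; rewrite limn_einf_lim; apply: lime_le; first exact: is_cvg_einfs.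
apply: nearW => n; apply: le_trans (ul n); apply: ereal_inf_lbound.
by exists n => /=.
Qed.

(** A subsequence with rapidly decreasing increments converges almost everywhere, and Fatou's lemma
    turns its pointwise limit into a limit in mean square of the whole sequence. *)
Lemma riesz_fischer (f : nat -> T -> R) : (forall n, sqint (f n)) ->
  (forall e, 0 < e -> exists N, forall n m, (N <= n)%N -> (N <= m)%N ->
    (\int[mu]_(x in D) ((f n x - f m x) ^+ 2)%:E <= e%:E)%E) ->
  exists2 g, sqint g & forall e, 0 < e -> exists N, forall n, (N <= n)%N ->
    (\int[mu]_(x in D) ((f n x - g x) ^+ 2)%:E <= e%:E)%E.
Proof.
move=> hf cau.
(* The extra factor 4^-k allows the sum of 4^k times the squared increments to be integrable, so
   that the increments are O(2^-k) almost everywhere. *)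
pose e k : R := (1 / (2 ^ k.+1)%:R) / (4 ^ k)%:R.
have e0 k : 0 < e k by rewrite !divr_gt0 // ltr0n expn_gt0.
pose N k := projT1 (cid (cau (e k) (e0 k))).
have HN k : forall n m, (N k <= n)%N -> (N k <= m)%N ->
    (\int[mu]_(x in D) ((f n x - f m x) ^+ 2)%:E <= (e k)%:E)%E.
  by rewrite /N; case: cid.
pose M := fix M k := if k is k'.+1 then maxn (N k) (M k').+1 else N 0.
have MN k : (N k <= M k)%N by case: k => //= k; exact: leq_maxl.
have MS k : (M k < M k.+1)%N by rewrite /= leq_max leqnn orbT.
have Mm : {homo M : i j / (i <= j)%N} by apply: homo_leq => [//|i j k|i]; [exact: leq_trans|exact: ltnW].
have kM k : (k <= M k)%N by elim: k => // k IH; exact: leq_ltn_trans IH (MS k).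
pose dd k x := (f (M k.+1) x - f (M k) x) ^+ 2.
have mf n : measurable_fun D (f n) by case: (hf n).
have mdd k : measurable_fun D (dd k) by apply: measurable_funX; exact: measurable_funB.
pose gg k x := ((4 ^ k)%:R * dd k x)%:E.
have mgg k : measurable_fun D (gg k) by apply/measurable_EFinP; exact: measurable_funM.
have gg0 k x : D x -> (0 <= gg k x)%E by move=> _; rewrite lee_fin mulr_ge0 // sqr_ge0.
have igg k : (\int[mu]_(x in D) gg k x <= (1 / (2 ^ k.+1)%:R)%:E)%E.
  rewrite /gg; under eq_integral do rewrite EFinM.
  rewrite ge0_integralZl_EFin //; last 2 first.
  - by move=> x _; rewrite lee_fin sqr_ge0.
  - exact/measurable_EFinP.
  apply: (@le_trans _ _ ((4 ^ k)%:R%:E * (e k)%:E)%E).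
    by apply: lee_wpmul2l => //; apply: HN; apply: leq_trans (MN k) _ => //; exact/ltnW.
  by rewrite -EFinM lee_fin /e mulrCA mulfV ?mulr1 // pnatr_eq0 -lt0n expn_gt0.
pose G x := (\sum_(0 <= k <oo) gg k x)%E.
have G0 x : D x -> (0 <= G x)%E by move=> Dx; apply: nneseries_ge0 => k _ _; exact: gg0.
have mG : measurable_fun D G.
  by apply: ge0_emeasurable_sum => [k x Dx _|k _]; [exact: gg0|exact: mgg].
have iG : mu.-integrable D G.
  apply/integrableP; split=> //.
  rewrite (eq_integral G); last by move=> x; rewrite inE => Dx; rewrite gee0_abs // G0.
  rewrite /G (integral_nneseries _ mD mgg gg0).
  apply: (@le_lt_trans _ _ (\sum_(0 <= k <oo) (1 / (2 ^ k.+1)%:R)%:E)%E).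
    by apply: lee_nneseries => k *; [apply: integral_ge0 => x; exact: gg0|exact: igg].
  by apply: le_lt_trans (epsilon_trick0 xpredT ler01) _; rewrite ltry.
have aeG := integrable_ae mD iG.
have conv x : D x -> G x \is a fin_num -> cvgn (fun k => f (M k) x).
  move=> Dx Gx.
  pose C := fine (G x).
  have tele : cvgn (series (telescope (fun k => f (M k) x))).
    apply: normed_cvg.
    apply: (@series_le_cvg _ _ (geometric (1 + C) (1 / 2))).
    - by move=> n; exact: normr_ge0.
    - move=> n /=; rewrite mulr_ge0 ?exprn_ge0 // addr_ge0 // fine_ge0 // G0 //.
    - move=> n /=.
      have hC : (4 ^ n)%:R * dd n x <= C.
        rewrite -lee_fin fineK // -[X in (X <= _)%E]/(gg n x).
        apply: le_trans (nneseries_lim_ge n.+1 _) => [|k _ _]; last exact: gg0.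
        rewrite big_nat_recr //= leeDr //; apply: sume_ge0 => k _; exact: gg0.
      rewrite expr_div_n expr1n div1r ler_pdivlMr ?exprn_gt0 //.
      set t := telescope _ _.
      have : (`|t| * 2 ^+ n) ^+ 2 <= C.
        rewrite exprMn real_normK ?num_real // -exprM mulnC exprM mulrC.
        by rewrite -!natrX.
      have := sqr_ge0 (`|t| * 2 ^+ n); have := sqr_ge0 (`|t| * 2 ^+ n - 1).
      by rewrite sqrrB1; lra.
    - by apply: is_cvg_geometric_series; rewrite ger0_norm //; lra.
  have -> : (fun k => f (M k) x) =
      (fun k => f (M 0) x + series (telescope (fun k => f (M k) x)) k).
    by apply/funext => k; rewrite -(eq_sum_telescope (fun k => f (M k) x)).
  by apply: is_cvgD => //; exact: is_cvg_cst.
(* The upper limit is measurable on all of [D], also where the subsequence diverges. *)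
pose g x := fine (limn_esup (fun k => (f (M k) x)%:E)).
have mg : measurable_fun D g.
  apply: measurableT_comp; first exact: fine_measurable.
  by apply: measurable_fun_limn_esup => k; exact/measurable_EFinP.
have limg x : D x -> G x \is a fin_num -> f (M k) x @[k --> \oo] --> g x.
  move=> Dx Gx; have cv := conv x Dx Gx.
  have cvE : ((f (M k) x)%:E) @[k --> \oo] --> (limn (fun k => f (M k) x))%:E.
    by apply: cvg_EFin; [exact: nearW|exact: cv].
  by rewrite /g (cvg_limn_einf_sup cvE).2 /=.
have bound (m : nat) (E : R) (K : nat) : (forall k, (K <= k)%N ->
     \int[mu]_(x in D) ((f m x - f (M k) x) ^+ 2)%:E <= E%:E)%E ->
   (\int[mu]_(x in D) ((f m x - g x) ^+ 2)%:E <= E%:E)%E.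
  move=> HE.
  pose h k x := ((f m x - f (M (k + K)) x) ^+ 2)%:E.
  have mh k : measurable_fun D (h k).
    by apply/measurable_EFinP; apply: measurable_funX; exact: measurable_funB.
  have h0 k x : D x -> (0 <= h k x)%E by move=> _; rewrite lee_fin sqr_ge0.
  have mE : measurable_fun D (fun x => limn_einf (h ^~ x)).
    rewrite (_ : (fun x => _) = (fun x => - limn_esup (fun k => - h k x))%E) //.
    apply: measurableT_comp => //; apply: measurable_fun_limn_esup => k.
    exact: measurableT_comp.
  apply: le_trans (_ : \int[mu]_(x in D) limn_einf (h ^~ x) <= _)%E.
    apply: ae_ge0_le_integral => //.
    - by move=> x _; rewrite lee_fin sqr_ge0.
    - by apply/measurable_EFinP; apply: measurable_funX; exact: measurable_funB.
    - move=> x Dx; rewrite limn_einf_lim; apply: lime_ge; first exact: is_cvg_einfs.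
      by apply: nearW => n; apply: le_ereal_inf_tmp => _ [k _ <-]; exact: h0.
    apply: filterS aeG => x Hx Dx.
    have cvx := limg x Dx (Hx Dx).
    suff cvh : h ^~ x @ \oo --> ((f m x - g x) ^+ 2)%:E by rewrite (cvg_limn_einf_sup cvh).1.
    rewrite /h; apply: cvg_EFin; first exact: nearW.
    apply: (@cvg_comp _ _ _ (fun k => f (M (k + K)%N) x) (fun y => (f m x - y) ^+ 2) _ (nbhs (g x))).
      by rewrite (cvg_shiftn K (fun k => f (M k) x)).
    apply: (@continuous_comp _ _ _ (fun y => f m x - y) (fun y => y ^+ 2)).
      by apply: continuousB; [exact: cst_continuous|].
    exact: exprn_continuous.
  apply: le_trans (fatou mu mD mh h0) _; apply: limn_einf_le_cst => k.
  by apply: HE; rewrite leq_addl.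
have main E : 0 < E -> exists N0, forall n, (N0 <= n)%N ->
    (\int[mu]_(x in D) ((f n x - g x) ^+ 2)%:E <= E%:E)%E.
  move=> E0; have [N0 HN0] := cau E E0; exists N0 => n Nn.
  apply: (bound n E N0) => k Nk; apply: HN0 => //; exact: leq_trans Nk (kM k).
exists g => //.
have [N0 HN0] := main 1 ltr01.
have hd : sqint (fun x => f N0 x - g x).
  split; first exact: measurable_funB.
  by apply: le_lt_trans (HN0 N0 (leqnn _)) _; rewrite ltry.
have -> : g = (fun x => f N0 x - (f N0 x - g x)) by apply/funext => x; rewrite opprB addrC subrK.
exact: sqintB.
Qed.

End SquareIntegrable.

(** * Rigid motions preserve the area *)

Section MeasurePreserving.
Variable R : realType.
Notation leb := (@lebesgue_measure R).
Notation R' := (measurableTypeR R).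
Notation T2 := (R' * R')%type.

Lemma measurable_shift (a : R) : measurable_fun [set: R'] (fun x : R' => x + a : R').
Proof. exact: measurable_funD. Qed.

Lemma measurable_preimage_shift (a : R) (A : set R') : measurable A ->
  measurable ((fun x : R' => x + a : R') @^-1` A).
Proof. by move=> mA; rewrite -[X in _ X]setTI; exact: measurable_shift. Qed.

Lemma lebesgue_measure_shift (a : R) (A : set R') : measurable A ->
  leb ((fun x : R' => x + a : R') @^-1` A) = leb A.
Proof.
move=> mA; pose nu := (pushforward leb (fun x : R' => x + a : R') : measure R' R).
pose nu' := nu (measurable_shift a).
apply/esym; rewrite -[RHS]/(nu' A); apply: lebesgue_measure_unique => //.
move=> X [[x y] _ <-] /=; rewrite /nu' /nu /pushforward /=.
have -> : (fun z : R => z + a) @^-1` `]x, y] = `]x - a, y - a]%classic.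
  by apply/seteqP; split=> z; rewrite /= !in_itv /= ltrBlDr lerBrDr.
rewrite !lebesgue_measure_itv /= !lte_fin ltrD2r; case: ifP => // _.
by rewrite -!EFinB; congr (_%:E); ring.
Qed.

Definition preserving (f : R * R -> R * R) := measurable_fun [set: T2] (f : T2 -> T2) /\
  forall A : set T2, measurable A -> leb2 R (f @^-1` A) = leb2 R A.

Lemma preserving_rect (f : T2 -> T2) : measurable_fun [set: T2] f ->
  (forall X Y : set R', measurable X -> measurable Y -> leb2 R (f @^-1` (X `*` Y)) = leb X * leb Y)%E ->
  preserving f.
Proof.
move=> mf H; split=> // A mA.
pose nu := (pushforward (leb2 R) f : measure T2 R); pose nu' := nu mf.
by apply/esym; rewrite -[RHS]/(nu' A); apply: (@product_measure_unique _ _ _ _ _ leb leb nu').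
Qed.

Lemma preserving_comp f g : preserving f -> preserving g -> preserving (f \o g).
Proof.
move=> [mf hf] [mg hg]; split; first exact: measurableT_comp.
move=> A mA; rewrite comp_preimage hg ?hf //.
by rewrite -[X in measurable X]setTI; exact: mf.
Qed.

Lemma preserving_translate (a : R * R) : preserving (fun x => (x.1 + a.1, x.2 + a.2)).
Proof.
apply: preserving_rect.
  by apply/measurable_fun_pairP; split; apply: measurable_funD.
move=> X Y mX mY.
have -> : (fun x : R * R => (x.1 + a.1, x.2 + a.2)) @^-1` (X `*` Y) =
   ((fun x => x + a.1) @^-1` X) `*` ((fun x => x + a.2) @^-1` Y) by [].
rewrite product_measure1E; try exact: measurable_preimage_shift.
by congr (_ * _)%E; exact: lebesgue_measure_shift.
Qed.

(** By Tonelli, since the shear is a translation on each horizontal line. *)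
Lemma preserving_shear1 (c : R) : preserving (fun x => (x.1 + c * x.2, x.2)).
Proof.
have mf : measurable_fun [set: T2] (fun x : T2 => (x.1 + c * x.2, x.2) : T2).
  apply/measurable_fun_pairP; split; last exact: measurable_snd.
  by apply: measurable_funD => //; apply: measurable_funM.
apply: preserving_rect => // X Y mX mY.
set S := _ @^-1` _.
have mS : measurable S by rewrite -[S]setTI; apply: mf => //; exact: measurableX.
transitivity (\int[leb]_y (leb X * (\1_Y y)%:E))%E.
  rewrite -[S]setIT -integral_indic // fubini_tonelli2 //.
    apply: eq_integral => y _; rewrite /fubini_G.
    rewrite (_ : (fun x => _) = (fun x => (\1_((fun x => x + c * y) @^-1` X) x * \1_Y y)%:E)); last first.
      apply/funext => x; rewrite !indicE -natrM mulnb; congr ((nat_of_bool _)%:R%:E).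
      by apply/idP/andP; rewrite !in_setE.
    under eq_integral do rewrite EFinM.
    rewrite ge0_integralZr //.
    - rewrite integral_indic ?setIT; last exact: measurable_preimage_shift.
      by congr (_ * _)%E; exact: lebesgue_measure_shift.
    - exact: measurableT.
    - by apply/measurable_EFinP; apply: measurable_indic; exact: measurable_preimage_shift.
  by apply/measurable_EFinP; apply: measurable_indic.
rewrite ge0_integralZl //; first by rewrite integral_indic ?setIT.
by apply/measurable_EFinP; apply: measurable_indic.
Qed.

Definition swap (x : R * R) := (x.2, x.1).

Lemma preserving_swap : preserving swap.
Proof.
apply: preserving_rect.
  by apply/measurable_fun_pairP; split; [exact: measurable_snd|exact: measurable_fst].
move=> X Y mX mY; rewrite (_ : swap @^-1` _ = Y `*` X); last first.
  by apply/seteqP; split=> x [].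
by rewrite product_measure1E // muleC.
Qed.

Lemma preserving_shear2 (c : R) : preserving (fun x => (x.1, x.2 + c * x.1)).
Proof.
by apply: (preserving_comp preserving_swap (preserving_comp (preserving_shear1 c) preserving_swap)).
Qed.

(* A rotation by an angle other than 0 and pi is a product of three shears. *)
Lemma preserving_rot (c s : R) : c ^+ 2 + s ^+ 2 = 1 ->
  preserving (fun x => (c * x.1 - s * x.2, s * x.1 + c * x.2)).
Proof.
have H (c' s' : R) : s' != 0 -> c' ^+ 2 + s' ^+ 2 = 1 ->
    preserving (fun x => (c' * x.1 - s' * x.2, s' * x.1 + c' * x.2)).
  (* Minus the tangent of half the angle. *)
  move=> s0 e; pose al := (c' - 1) / s'.
  have := preserving_comp (preserving_shear1 al)
    (preserving_comp (preserving_shear2 s') (preserving_shear1 al)).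
  congr preserving; apply/funext => x; rewrite /comp /=.
  have e1 : al * s' = c' - 1 by rewrite /al divfK.
  have e2 : al * (1 + c') = - s'.
    have : s' * (al * (1 + c') + s') = 0.
      have -> : s' * (al * (1 + c') + s') = (al * s') * (1 + c') + s' ^+ 2 by ring.
      rewrite e1; transitivity (c' ^+ 2 + s' ^+ 2 - 1); first by ring.
      by rewrite e subrr.
    by move/eqP; rewrite mulf_eq0 (negbTE s0) addr_eq0 => /eqP.
  congr pair.
    have -> : x.1 + al * x.2 + al * (x.2 + s' * (x.1 + al * x.2)) =
      x.1 * (1 + al * s') + x.2 * (al * (1 + (1 + al * s'))) by ring.
    by rewrite e1 addrCA subrr addr0 e2; ring.
  have -> : x.2 + s' * (x.1 + al * x.2) = s' * x.1 + (1 + al * s') * x.2 by ring.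
  by rewrite e1 addrCA subrr addr0.
move=> e; case: (eqVneq s 0) => [s0|]; last by move=> /H; apply.
have : (c - 1) * (c + 1) = 0 by move: e; rewrite s0 expr0n addr0 => e; rewrite -subr_sqr expr1n e subrr.
move/eqP; rewrite mulf_eq0 subr_eq0 addr_eq0 => /orP[] /eqP ->; rewrite s0.
  rewrite (_ : (fun x => _) = id); last first.
    by apply/funext => -[x y] /=; congr pair; ring.
  by split; [exact: measurable_id|move=> A _].
(* The half-turn is the square of the quarter-turn, which is a product of shears. *)
have h1 : (0 : R) ^+ 2 + 1 ^+ 2 = 1 by rewrite expr0n expr1n add0r.
have h := H 0 1 (oner_neq0 _) h1; have := preserving_comp h h.
by congr preserving; apply/funext => x; rewrite /comp /=; congr pair; ring.
Qed.

Lemma preserving_rigid t a : preserving (@rigid R t a).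
Proof. exact: (preserving_comp (preserving_translate a) (preserving_rot (cos2Dsin2 t))). Qed.

Lemma preserving_integral f (A : set T2) (h : T2 -> \bar R) :
  preserving f -> measurable A -> measurable_fun [set: T2] h -> (forall x, (0 <= h x)%E) ->
  (\int[leb2 R]_(x in f @^-1` A) h (f x) = \int[leb2 R]_(x in A) h x)%E.
Proof.
move=> [mf hf] mA mh h0.
pose nu := (pushforward (leb2 R) (f : T2 -> T2) : measure T2 R); pose nu' := nu mf.
transitivity (\int[nu']_(x in A) h x)%E.
  by rewrite (@ge0_integral_pushforward _ _ T2 T2 R f mf) //; exact: (measurable_funS (E := setT)).
by apply: eq_measure_integral => B mB _; rewrite -[LHS]/(leb2 R (f @^-1` B)) hf.
Qed.

End MeasurePreserving.

(** * The integral of a derivative over the line and over the plane *)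

Section LineDerivative.
Variable R : realType.
Notation leb := (@lebesgue_measure R).

Lemma integral_itv_derive (f f' : R -> R) (a b : R) : a < b ->
  (forall x, is_derive x (1 : R) f (f' x)) -> continuous f' ->
  (\int[leb]_(x in `[a, b]) (f' x)%:E = (f b - f a)%:E)%E.
Proof.
move=> ab df cf'; rewrite EFinB; apply: continuous_FTC2 => //.
- by apply: continuous_subspaceT.
- have cf : continuous f.
    by move=> x; apply: differentiable_continuous; apply/derivable1_diffP; case: (df x).
  split; [by move=> x _; case: (df x)| |].
  + by apply: cvg_at_right_filter; exact: cf.
  + by apply: cvg_at_left_filter; exact: cf.
- by move=> x _; rewrite derive1E; exact: derive_val.
Qed.

Lemma integral_line_derive0 (f f' : R -> R) :
  (forall x, is_derive x (1 : R) f (f' x)) -> continuous f' ->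
  leb.-integrable setT (EFin \o f') ->
  (fun n : nat => f n%:R - f (- n%:R)) @ \oo --> (0 : R) ->
  (\int[leb]_x (f' x)%:E = 0)%E.
Proof.
move=> df cf' intf lim0.
pose fn (n : nat) (x : R) : \bar R := (f' x * \1_(`[- n%:R, n%:R]%classic) x)%:E.
have mf' : measurable_fun setT f' by exact: continuous_measurable_fun.
have mi (n : nat) : measurable_fun setT (\1_(`[- n%:R, n%:R]%classic) : R -> R).
  by apply: measurable_indic; exact: measurable_itv.
have [] := @dominated_convergence _ _ _ leb setT measurableT fn (EFin \o f') (fun x => `|(EFin \o f') x|%E).
- by move=> n; apply/measurable_EFinP; exact: measurable_funM.
- exact/measurable_EFinP.
- apply: aeW => x _; apply: cvg_EFin; first exact: nearW.
  apply: (cvg_near_cst (f' x)); exists `|Num.ceil `|x| |%N => // n /= Hn.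
  rewrite /= indicE mem_set ?mulr1 //= in_itv /= -ler_norml.
  apply: le_trans (ceil_ge _) _; apply: le_trans (ler_norm _) _.
  by rewrite -intr_norm -natr_absz ler_nat.
- exact: integrable_abse.
- apply: aeW => x n _; rewrite /fn /= lee_fin normrM ler_piMr //.
  by rewrite indicE; case: (_ \in _); rewrite ?normr1 ?normr0.
move=> _ _ cv.
have cv0 : (fun n => \int[leb]_x fn n x)%E @ \oo --> (0 : R)%:E.
  apply: (@cvg_trans _ ((fun n : nat => (f n%:R - f (- n%:R))%:E) @ \oo)); last first.
    by apply: cvg_EFin; [exact: nearW|exact: lim0].
  apply: near_eq_cvg; exists 1%N => // n /= n1.
  rewrite -(@integral_itv_derive f f' (- n%:R) n%:R) //; last first.
    have : (0 : R) < n%:R by rewrite ltr0n. lra.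
  rewrite [LHS]integral_mkcond; apply: eq_integral => x _.
  rewrite /fn patchE indicE; case: (_ \in _); by rewrite ?mulr1 ?mulr0.
by have := cvg_unique _ cv cv0; apply; exact: ereal_hausdorff.
Qed.

Lemma integral_plane_derive0_1 (F F' : R * R -> R) :
  (forall x y, is_derive x (1 : R) (fun t => F (t, y)) (F' (x, y))) -> continuous F' ->
  (leb2 R).-integrable setT (EFin \o F') ->
  (forall y, (fun n : nat => F (n%:R, y) - F (- n%:R, y)) @ \oo --> (0 : R)) ->
  (\int[leb2 R]_x (F' x)%:E = 0)%E.
Proof.
move=> dF cF' intF lim0.
have := integral21_prod_meas1 intF; rewrite /= => <-.
rewrite (ae_eq_integral (cst 0%E)) ?integral0 //.
  exact: (measurable_fubini_G intF).
apply: filterS (ae_integrable2 intF) => y inty _ /=.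
apply: (@integral_line_derive0 (fun x => F (x, y)) (fun x => F' (x, y))) => // x.
apply: (@continuous_comp _ _ _ (fun x : R => (x, y)) F'); last exact: cF'.
exact: (cvg_pair cvg_id (cvg_cst _)).
Qed.

Lemma integral_plane_derive0_2 (F F' : R * R -> R) :
  (forall x y, is_derive y (1 : R) (fun t => F (x, t)) (F' (x, y))) -> continuous F' ->
  (leb2 R).-integrable setT (EFin \o F') ->
  (forall x, (fun n : nat => F (x, n%:R) - F (x, - n%:R)) @ \oo --> (0 : R)) ->
  (\int[leb2 R]_x (F' x)%:E = 0)%E.
Proof.
move=> dF cF' intF lim0.
have := integral12_prod_meas1 intF; rewrite /= => <-.
rewrite (ae_eq_integral (cst 0%E)) ?integral0 //.
  exact: (measurable_fubini_F intF).
apply: filterS (ae_integrable1 intF) => x intx _ /=.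
apply: (@integral_line_derive0 (fun y => F (x, y)) (fun y => F' (x, y))) => // y.
apply: (@continuous_comp _ _ _ (fun y : R => (x, y)) F'); last exact: cF'.
exact: (cvg_pair (cvg_cst _) cvg_id).
Qed.

End LineDerivative.

(** * Test functions and weak derivatives *)
Section BumpFunctions.
Variable R : realType.

Lemma is_derive_line (V : normedModType R) (f : V -> R) (x e : V) (d : R) :
  is_derive x e f d <-> is_derive (0 : R) (1 : R) (fun t => f (t *: e + x)) d.
Proof.
have E : (fun h : R => h^-1 *: ((f \o shift x) (h *: e) - f x)) =
    (fun h : R => h^-1 *: (((fun t => f (t *: e + x)) \o shift (0 : R)) (h *: (1 : R)) -
       (fun t => f (t *: e + x)) 0)).
  by apply/funext => h; rewrite /shift /= addr0 scale0r add0r [h *: 1]mulr1.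
split=> -[h1 h2]; (split; [move: h1; rewrite /derivable E|move: h2; rewrite /derive E]) => //.
Qed.

(** The powers of 1/t make the classical flat function into a family whose span is stable under
    differentiation. *)
Definition flat (k : nat) (t : R) : R :=
  if 0 < t then t^-1 ^+ k * expR (- t^-1) else 0.

(** Compares exp (1/t) with its term of order k + 2; a quadratic bound is what makes the derivative
    at 0 vanish. *)
Lemma flat_le (k : nat) (t : R) : 0 <= flat k t <= (k.+2)`!%:R * t ^+ 2.
Proof.
rewrite /flat; case: ifPn => t0; last by rewrite lexx mulr_ge0 // sqr_ge0.
have x0 : 0 < t^-1 by rewrite invr_gt0.
rewrite mulr_ge0 ?expR_ge0 ?exprn_ge0 ?(ltW x0) //=.
have h := @expR_ge1Dxn R t^-1 k.+1 (ltW x0).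
rewrite expRN ler_pdivrMr ?expR_gt0 //.
have f0 : (0 : R) < (k.+2)`!%:R by rewrite ltr0n fact_gt0.
have h2 : t^-1 ^+ k.+2 <= (k.+2)`!%:R * expR t^-1.
  rewrite -ler_pdivrMl // mulrC; apply: le_trans h; lra.
rewrite mulrAC -ler_pdivrMr ?exprn_gt0 //; apply: le_trans h2.
by rewrite -[k.+2 in leRHS]addn2 exprD (exprVn t 2).
Qed.

Lemma is_derive_flat (k : nat) (t : R) :
  is_derive t (1 : R) (flat k) (flat k.+2 t - k%:R * flat k.+1 t).
Proof.
have [t0|t0|->] := ltgtP t 0.
- rewrite /flat !ltNge (ltW t0) /= mulr0 subr0.
  apply: (@near_eq_is_derive _ _ _ (cst 0)).
  by near=> y; rewrite ltNge (_ : y <= 0) //; apply: ltW; near: y; exact: lt_nbhsl.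
- have D : is_derive t (1 : R) (fun y : R => y^-1 ^+ k * expR (- y^-1))
      ((k%:R * t^-1 ^+ k.-1 * expR (- t^-1) - t^-1 ^+ k * expR (- t^-1)) * (- t ^- 2)).
    apply: (@is_derive1_comp _ (fun u => u ^+ k * expR (- u)) (fun y => y^-1)); last first.
      by apply: is_derive_eq; [apply: is_deriveV; rewrite gt_eqF|rewrite /GRing.scale /= mulr1].
    have De : is_derive t^-1 (1 : R) (fun u => expR (- u)) (- expR (- t^-1)).
      by apply: is_derive_eq; rewrite /GRing.scale /= ?mulrN1 ?mulN1r.
    have Dx : is_derive t^-1 (1 : R) (fun u : R => u ^+ k) (k%:R * t^-1 ^+ k.-1).
      have := @is_deriveX _ _ (@id R) k t^-1 1 1 (is_derive_id _ _).
      by rewrite exprfctE /GRing.scale /= mulr1.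
    have h := @is_deriveM _ _ (fun u : R => u ^+ k) (fun u => expR (- u)) _ _ _ _ Dx De.
    by apply: (is_derive_eq h); rewrite /GRing.scale /=; ring.
  apply: (@is_derive_eq _ _ _ _ _ _ _
    ((k%:R * t^-1 ^+ k.-1 * expR (- t^-1) - t^-1 ^+ k * expR (- t^-1)) * (- t ^- 2))).
    apply: near_eq_is_derive D; near=> y; rewrite /flat (_ : 0 < y) //.
    by near: y; exact: lt_nbhsr.
  rewrite /flat t0 -exprVn; case: k {D} => [|k] /=; rewrite ?exprS; ring.
- have Z j : flat j 0 = 0 by rewrite /flat ltxx.
  rewrite !Z mulr0 subr0.
  suff cv : (fun h : R => h^-1 *: ((flat k \o shift 0) (h *: (1 : R)) - flat k 0)) @ (0 : R)^' --> (0 : R).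
    by apply: DeriveDef; [apply/cvg_ex; exists 0|apply/cvg_lim].
  apply/cvgrPdist_le => e e0.
  have C0 : (0 : R) < (k.+2)`!%:R by rewrite ltr0n fact_gt0.
  near=> h.
  have h0 : h != 0 by near: h; exact: nbhs_dnbhs_neq.
  rewrite sub0r normrN /= Z subr0 addr0 [h *: 1]mulr1 normrM normfV.
  have /andP[f0 f1] := flat_le k h.
  rewrite (ger0_norm f0) mulrC ler_pdivrMr ?normr_gt0 //.
  apply: le_trans f1 _; rewrite -(real_normK (num_real h)) expr2 mulrA ler_wpM2r //.
  rewrite mulrC -ler_pdivlMr //; near: h.
  apply: dnbhs0_le; exact: divr_gt0.
Unshelve. all: by end_near.
Qed.

Definition plane_affine (a b c : R) (x : R * R) : R := a * x.1 + b * x.2 + c.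

Lemma continuous_affine a b c : continuous (plane_affine a b c).
Proof.
move=> x; apply: cvgD; last exact: cvg_cst.
by apply: cvgD; apply: cvgM; try exact: cvg_cst; [exact: cvg_fst|exact: cvg_snd].
Qed.

(** An algebra stable under all directional derivatives, so [smooth] follows from the mere
    continuity and derivability of its members. *)
Inductive bump : (R * R -> R) -> Prop :=
| bump_flat k a b c : bump (fun x => flat k (plane_affine a b c x))
| bump_add f g : bump f -> bump g -> bump (fun x => f x + g x)
| bump_mul f g : bump f -> bump g -> bump (fun x => f x * g x)
| bump_scale (t : R) f : bump f -> bump (fun x => t * f x).

Lemma continuous_flat k : continuous (flat k).
Proof.
move=> t; apply: differentiable_continuous; apply/derivable1_diffP.
by case: (is_derive_flat k t).
Qed.

Lemma bump_continuous f : bump f -> continuous f.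
Proof.
elim=> [k a b c|g h _ cg _ ch|g h _ cg _ ch|t g _ cg] x.
- by apply: (@continuous_comp _ _ _ (plane_affine a b c) (flat k));
    [exact: continuous_affine|exact: continuous_flat].
- by apply: cvgD; [exact: cg|exact: ch].
- by apply: cvgM; [exact: cg|exact: ch].
- by apply: cvgM; [exact: cvg_cst|exact: cg].
Qed.

Lemma bump_derive (e : R * R) f : bump f ->
  exists2 f', bump f' & forall x, is_derive x e f (f' x).
Proof.
elim=> [k a b c|g h _ [g' bg' dg] _ [h' bh' dh]|g h bg [g' bg' dg] bh [h' bh' dh]|t g _ [g' bg' dg]].
- exists (fun x => (a * e.1 + b * e.2) *
     (flat k.+2 (plane_affine a b c x) + (- k%:R) * flat k.+1 (plane_affine a b c x))).
    by apply: bump_scale; apply: bump_add; [exact: bump_flat|apply: bump_scale; exact: bump_flat].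
  move=> x; apply/is_derive_line.
  rewrite (_ : (fun t => _) = flat k \o (fun t : R => (a * e.1 + b * e.2) * t + plane_affine a b c x)); last first.
    apply/funext => t; rewrite /= /plane_affine /=; congr (flat k _).
    by rewrite /GRing.scale /=; ring.
  apply: is_derive_eq; first by apply: is_derive1_comp; exact: is_derive_flat.
  by rewrite mulr0 add0r addr0 [_%:A]mulr1 mulrC mulNr.
- exists (fun x => g' x + h' x); first exact: bump_add.
  by move=> x; exact: is_deriveD.
- exists (fun x => g' x * h x + g x * h' x).
    by apply: bump_add; apply: bump_mul.
  move=> x; apply: is_derive_eq.
  by rewrite /GRing.scale /= addrC (mulrC (h x)).
- exists (fun x => t * g' x); first exact: bump_scale.
  by move=> x; apply: is_derive_eq; rewrite ?scaler0 ?addr0.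
Qed.

Lemma bump_smooth f : bump f -> smooth f.
Proof.
move=> bf s.
have : bump (foldr (fun (e : R * R) f => fun x => 'D_e f x) f s).
  elim: s => //= e s IH; have [f' bf' df'] := bump_derive e IH.
  by rewrite (_ : (fun x => _) = f') //; apply/funext => x; exact: derive_val.
move=> b /=; split; first exact: bump_continuous.
by move=> x e; have [f' _ df'] := bump_derive e b; case: (df' x).
Qed.

Definition rect (a b c d : R) : set (R * R) := `]a, b[%classic `*` `]c, d[%classic.
Definition crect (a b c d : R) : set (R * R) := `[a, b]%classic `*` `[c, d]%classic.

(** The factor n + 1 sharpens the edges: the functions stay between 0 and 1 and tend to the
    indicator of the open rectangle. *)
Definition rect_bump (a b c d : R) (n : nat) (x : R * R) : R :=
  flat 0 (n.+1%:R * (x.1 - a)) * flat 0 (n.+1%:R * (b - x.1)) *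
  (flat 0 (n.+1%:R * (x.2 - c)) * flat 0 (n.+1%:R * (d - x.2))).

Lemma flat0E t : 0 < t -> flat 0 t = expR (- t^-1).
Proof. by move=> t0; rewrite /flat t0 expr0 mul1r. Qed.

Lemma flat0_le1 t : 0 <= flat 0 t <= 1.
Proof.
rewrite /flat; case: ifPn => t0; last by rewrite lexx ler01.
by rewrite expr0 mul1r expR_ge0 -expR0 ler_expR oppr_le0 invr_ge0 ltW.
Qed.

Lemma rect_bump_le1 a b c d n x : 0 <= rect_bump a b c d n x <= 1.
Proof.
rewrite /rect_bump; set p := flat _ _; set q := flat _ _; set r := flat _ _; set s := flat _ _.
have /andP[p0 p1] : 0 <= p <= 1 := flat0_le1 _.
have /andP[q0 q1] : 0 <= q <= 1 := flat0_le1 _.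
have /andP[r0 r1] : 0 <= r <= 1 := flat0_le1 _.
have /andP[s0 s1] : 0 <= s <= 1 := flat0_le1 _.
by rewrite !mulr_ge0 //= !mulr_ile1 ?mulr_ge0.
Qed.

Lemma rect_bump_out a b c d n x : ~ rect a b c d x -> rect_bump a b c d n x = 0.
Proof.
move=> nx; apply/eqP/negPn/negP => h; apply: nx.
have pos t : flat 0 (n.+1%:R * t) != 0 -> 0 < t.
  by rewrite /flat pmulr_rgt0 //; case: ifP => //; rewrite eqxx.
move: h; rewrite /rect_bump !mulf_eq0 !negb_or => /andP[/andP[/pos h1 /pos h2] /andP[/pos h3 /pos h4]].
by split; rewrite /= in_itv /=; apply/andP; split; lra.
Qed.

Lemma rect_bump_test Om a b c d n : crect a b c d `<=` Om ->
  test_function Om (rect_bump a b c d n).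
Proof.
move=> sub; split.
  apply: bump_smooth; rewrite /rect_bump.
  have B (f : R * R -> R) p q r : f = plane_affine p q r -> bump (fun x => flat 0 (f x)).
    by move=> ->; exact: bump_flat.
  apply: bump_mul; apply: bump_mul.
  - by apply: (B _ n.+1%:R 0 (- (n.+1%:R * a))); apply/funext => x; rewrite /plane_affine; ring.
  - by apply: (B _ (- n.+1%:R) 0 (n.+1%:R * b)); apply/funext => x; rewrite /plane_affine; ring.
  - by apply: (B _ 0 n.+1%:R (- (n.+1%:R * c))); apply/funext => x; rewrite /plane_affine; ring.
  - by apply: (B _ 0 (- n.+1%:R) (n.+1%:R * d)); apply/funext => x; rewrite /plane_affine; ring.
exists (crect a b c d).
  by split=> //; apply: compact_setX; exact: segment_compact.
move=> x nx; apply: rect_bump_out => -[h1 h2]; apply: nx; split.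
  by move: h1; rewrite /= !in_itv /= => /andP[/ltW -> /ltW ->].
by move: h2; rewrite /= !in_itv /= => /andP[/ltW -> /ltW ->].
Qed.

Lemma rect_bump_cvg a b c d x : rect a b c d x ->
  (fun n => rect_bump a b c d n x) @ \oo --> (1 : R).
Proof.
move=> [h1 h2]; move: h1 h2; rewrite /= !in_itv /= => /andP[h1 h2] /andP[h3 h4].
have F t : 0 < t -> (fun n : nat => flat 0 (n.+1%:R * t)) @ \oo --> (1 : R).
  move=> t0.
  rewrite (_ : (fun n : nat => _) = (fun n : nat => expR (- (t^-1 * n.+1%:R^-1)))); last first.
    by apply/funext => n; rewrite flat0E ?mulr_gt0 // invfM mulrC.
  suff : (fun n : nat => expR (- (t^-1 * n.+1%:R^-1))) @ \oo --> expR (- (t^-1 * 0)).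
    by rewrite mulr0 oppr0 expR0.
  apply: (@cvg_comp _ _ _ (fun n : nat => - (t^-1 * n.+1%:R^-1)) expR _ (nbhs (- (t^-1 * 0)))); last exact: continuous_expR.
  by apply: cvgN; apply: cvgM; [exact: cvg_cst|exact: cvg_harmonic].
have P1 : 0 < x.1 - a by rewrite subr_gt0. have P2 : 0 < b - x.1 by rewrite subr_gt0.
have P3 : 0 < x.2 - c by rewrite subr_gt0. have P4 : 0 < d - x.2 by rewrite subr_gt0.
by have := cvgM (cvgM (F _ P1) (F _ P2)) (cvgM (F _ P3) (F _ P4)); rewrite !mulr1; apply.
Qed.

End BumpFunctions.

(** * Functions orthogonal to all test functions *)

Section WeakUniqueness.
Variable R : realType.
Notation leb := (@lebesgue_measure R).
Notation R' := (measurableTypeR R).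
Notation T2 := (R' * R')%type.

Lemma measurable_rect (a b c d : R) : measurable (rect a b c d : set T2).
Proof. by apply: measurableX; exact: measurable_itv. Qed.

Lemma measurable_crect (a b c d : R) : measurable (crect a b c d : set T2).
Proof. by apply: measurableX; exact: measurable_itv. Qed.

Lemma crect_finite (a b c d : R) : (leb2 R (crect a b c d) < +oo)%E.
Proof.
rewrite /crect product_measure1E; try exact: measurable_itv.
have fin x y : leb (`[x, y]%classic : set R) \is a fin_num.
  by rewrite lebesgue_measure_itv /=; case: ifP.
by rewrite ltey_eq; apply/orP; left; apply: fin_numM; exact: fin.
Qed.

(** Dynkin's argument for the signed measure with density [g]; the vanishing over the whole of [E]
    is what makes the class stable under complements. *)
Lemma dynkin_integral0 d (T : measurableType d) (f : T2 -> T) (E : set T2)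
    (g : T2 -> R) (G : set (set T)) :
  measurable_fun [set: T2] f -> measurable E -> (leb2 R).-integrable E (EFin \o g) ->
  @measurable d T = <<s G >> -> setI_closed G ->
  (\int[leb2 R]_(x in E) (g x)%:E = 0)%E ->
  (forall A, G A -> (\int[leb2 R]_(x in f @^-1` A `&` E) (g x)%:E = 0)%E) ->
  forall A, measurable A -> (\int[leb2 R]_(x in f @^-1` A `&` E) (g x)%:E = 0)%E.
Proof.
move=> mf mE ig mG GI E0 G0 A mA.
have mpre B : measurable B -> measurable (f @^-1` B `&` E).
  by move=> mB; apply: measurableI => //; rewrite -[X in _ X]setTI; exact: mf.
have ipre B : measurable B -> (leb2 R).-integrable (f @^-1` B `&` E) (EFin \o g).
  by move=> mB; apply: integrableS ig => //; exact: mpre.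
apply: (@dynkin_induction _ T G (fun B => \int[leb2 R]_(x in f @^-1` B `&` E) (g x)%:E = 0)%E) => //.
- by rewrite preimage_setT setTI.
- move=> B mB B0.
  have : (\int[leb2 R]_(x in (f @^-1` B `&` E) `|` (f @^-1` (~` B) `&` E)) (g x)%:E = 0)%E.
    by rewrite -setIUl preimage_setC setUv setTI.
  rewrite integral_setU.
  + by rewrite B0 add0e.
  + exact: mpre.
  + by apply: mpre; exact: measurableC.
  + rewrite -setIUl preimage_setC setUv setTI.
    by case/integrableP: ig.
  + apply/disj_set2P; rewrite preimage_setC.
    by rewrite setIACA setICr set0I.
- move=> F mF tF F0; rewrite preimage_bigcup setI_bigcupl integral_bigcup.
  + by apply: eseries0 => i _ _; exact: F0.
  + apply: trivIset_setIr; apply/trivIsetP => i j _ _ ij.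
    by move/trivIsetP : tF => /(_ i j I I ij) h; rewrite -preimage_setI h preimage_set0.
  + by move=> k; exact: mpre.
  + rewrite -setI_bigcupl -preimage_bigcup; apply: ipre.
    by apply: bigcupT_measurable.
- by rewrite -mG.
Qed.

Variables (Om : set (R * R)) (g : R * R -> R).
Hypothesis mg : measurable_fun (Om : set T2) (g : T2 -> R).
Hypothesis gloc : forall K, compact K -> K `<=` Om ->
  (\int[leb2 R]_(x in K) (g x ^+ 2)%:E < +oo)%E.
Hypothesis g_test : forall phi, test_function Om phi ->
  Rintegral (leb2 R) Om (fun x => g x * phi x) = 0.
Hypothesis Om_open : open Om.

Let mOm : measurable (Om : set T2).
Proof. exact: open2_measurable. Qed.

Lemma loc_integrable K : compact K -> K `<=` Om -> (leb2 R K < +oo)%E ->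
  (leb2 R).-integrable (K : set T2) (EFin \o g).
Proof.
move=> cK sub fK.
have mK : measurable (K : set T2) by exact: compact2_measurable.
have mgK : measurable_fun (K : set T2) (g : T2 -> R) by exact: (measurable_funS mOm).
apply: (@integrable_le _ T2 _ _ _ mK _ (fun x => 1 + g x ^+ 2)) => //.
  move=> x _; have := sqr_ge0 (`|g x| - 1); have := sqr_ge0 (`|g x|).
  by rewrite sqrrB1 real_normK ?num_real //; lra.
rewrite (_ : EFin \o _ = (cst 1%:E) \+ (EFin \o (fun x => g x ^+ 2)%R))%E; last by apply/funext.
apply: integrableD => //.
  by apply: (@integrable_nonneg _ T2 _ _ _ mK (cst 1)) => //; rewrite [X in (X < _)%E](integral_cst _ mK 1%E) mul1e.
apply: integrable_nonneg => //; first exact: measurable_funX.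
- by move=> x _; exact: sqr_ge0.
- exact: gloc.
Qed.

Lemma weak_rect0 a b c d : crect a b c d `<=` Om ->
  (\int[leb2 R]_(x in rect a b c d) (g x)%:E = 0)%E.
Proof.
move=> sub.
have cK : compact (crect a b c d) by apply: compact_setX; exact: segment_compact.
have sub' : rect a b c d `<=` crect a b c d.
  move=> x [h1 h2]; split.
    by move: h1; rewrite /= !in_itv /= => /andP[/ltW -> /ltW ->].
  by move: h2; rewrite /= !in_itv /= => /andP[/ltW -> /ltW ->].
have iK := loc_integrable cK sub (crect_finite a b c d).
have mI := measurable_rect a b c d; have mK := measurable_crect a b c d.
have iI : (leb2 R).-integrable (rect a b c d : set T2) (EFin \o g).
  exact: integrableS iK.
have mgI : measurable_fun (rect a b c d : set T2) (g : T2 -> R).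
  by apply/measurable_EFinP; case/integrableP: iI.
have mphi n D : measurable_fun (D : set T2) (rect_bump a b c d n : T2 -> R).
  apply: (@measurable_funS _ _ _ _ setT) => //; apply: continuous2_measurable => //.
  by move=> x; have [/(_ [::])[/(_ x)]] := rect_bump_test n sub.
pose f n (x : T2) := (g x * rect_bump a b c d n x)%:E.
have f0 n : (\int[leb2 R]_(x in rect a b c d) f n x = 0)%E.
  have le1 x : `|rect_bump a b c d n x| <= 1.
    by have /andP[h1 h2] := rect_bump_le1 a b c d n x; rewrite ger0_norm.
  have intO : (leb2 R).-integrable (Om : set T2) (f n).
    rewrite integrable_mkcond // (_ : _ \_ _ = (f n \_ (crect a b c d))); last first.
      apply/funext => x; rewrite !patchE; case: ifPn => xO; case: ifPn => xK //.
        rewrite /f rect_bump_out ?mulr0 // => /sub'; move: xK; by rewrite notin_setE.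
      by move: xK xO; rewrite inE notin_setE => /sub.
    rewrite -integrable_mkcond //.
    apply: (@integrable_le _ T2 _ _ _ mK _ (fun x => `|g x|)).
    - apply: measurable_funM; last exact: mphi.
      by apply/measurable_EFinP; case/integrableP: iK.
    - by move=> x _; rewrite normrM ler_piMr.
    - exact: (integrable_norm iK).
  have E : (\int[leb2 R]_(x in rect a b c d) f n x = \int[leb2 R]_(x in Om) f n x)%E.
    rewrite integral_mkcond [RHS]integral_mkcond; apply: eq_integral => x _.
    rewrite !patchE; case: ifPn => xI; case: ifPn => xO //.
      by move: xI xO; rewrite inE notin_setE => /sub'/sub.
    by rewrite /f rect_bump_out ?mulr0 //; move: xI; rewrite notin_setE.
  have := g_test (rect_bump_test n sub).
  rewrite E /Rintegral => h; rewrite -(fineK (integrable_fin_num mOm intO)).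
  by rewrite -[X in (X)%:E = _]/(fine (\int[leb2 R]_(x in Om) f n x)) h.
have [] := @dominated_convergence _ _ _ (leb2 R) (rect a b c d) mI f (EFin \o g) (fun x => `|(EFin \o g) x|%E).
- by move=> n; apply/measurable_EFinP; apply: measurable_funM.
- exact/measurable_EFinP.
- apply: aeW => x xI; apply: cvg_EFin; first exact: nearW.
  rewrite -[X in _ --> X]mulr1; apply: cvgM; [exact: cvg_cst|exact: rect_bump_cvg].
- exact: integrable_abse.
- apply: aeW => x n _; rewrite /f /= lee_fin normrM ler_piMr //.
  by have /andP[h1 h2] := rect_bump_le1 a b c d n x; rewrite ger0_norm.
move=> _ _ cv; apply: (cvg_unique _ cv); first exact: ereal_hausdorff.
rewrite (_ : [sequence _]_n = cst 0%E); first exact: cvg_cst.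
by apply/funext => n; exact: f0.
Qed.

(** A product of two rays meets the rectangle in a rectangle, where [weak_rect0] applies. The Dynkin
    argument is run in the first coordinate, then in the second, then on the measurable
    rectangles. *)
Lemma weak_rect_ae a b c d : crect a b c d `<=` Om ->
  ae_eq (leb2 R) (rect a b c d : set T2) (EFin \o g) (cst 0%E).
Proof.
move=> sub.
have sub' : rect a b c d `<=` crect a b c d.
  move=> x [h1 h2]; split.
    by move: h1; rewrite /= !in_itv /= => /andP[/ltW -> /ltW ->].
  by move: h2; rewrite /= !in_itv /= => /andP[/ltW -> /ltW ->].
have cK : compact (crect a b c d) by apply: compact_setX; exact: segment_compact.
have iK := loc_integrable cK sub (crect_finite a b c d).
have mI := measurable_rect a b c d; have mK := measurable_crect a b c d.
have iI : (leb2 R).-integrable (rect a b c d : set T2) (EFin \o g) by exact: integrableS iK.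
pose Ray (x : R) : set R' := `]x, +oo[%classic.
have mRay x : measurable (Ray x) by exact: measurable_itv.
have ray x y : (Ray x `*` Ray y) `&` rect a b c d =
   rect (Num.max x a) b (Num.max y c) d.
  apply/seteqP; split=> z; rewrite /Ray /rect /= !in_itv /= !andbT !gt_max.
    by move=> [[-> ->] [/andP[-> ->] /andP[-> ->]]].
  by move=> [/andP[/andP[-> ->] ->] /andP[/andP[-> ->] ->]].
have ray0 x y : (\int[leb2 R]_(z in (Ray x `*` Ray y) `&` rect a b c d) (g z)%:E = 0)%E.
  rewrite ray; apply: weak_rect0 => z [h1 h2]; apply: sub; split.
    move: h1; rewrite /= !in_itv /= ge_max => /andP[/andP[_ ->] ->] //.
  by move: h2; rewrite /= !in_itv /= ge_max => /andP[/andP[_ ->] ->].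
have GI : setI_closed (@RGenOInfty.G R).
  move=> _ _ [x ->] [y ->]; exists (Num.max x y).
  apply/seteqP; split=> z; rewrite /= !in_itv /= !andbT gt_max.
    by move=> [-> ->].
  by move=> /andP[-> ->].
have st1 y (A : set R') : measurable A ->
    (\int[leb2 R]_(z in (A `*` Ray y) `&` rect a b c d) (g z)%:E = 0)%E.
  move=> mA; have E (B : set R') : (B `*` Ray y) `&` rect a b c d =
     fst @^-1` B `&` (([set: R'] `*` Ray y) `&` rect a b c d).
    by apply/seteqP; split=> z; [move=> [[h1 h2] h3]|move=> [h1 [[_ h2] h3]]].
  have mE : measurable (([set: R'] `*` Ray y) `&` rect a b c d : set T2).
    by apply: measurableI => //; apply: measurableX.
  rewrite E; apply: (@dynkin_integral0 _ R' fst _ g (@RGenOInfty.G R)) => //.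
  - by apply: integrableS iI => // z [].
  - exact: RGenOInfty.measurableE.
  - rewrite (_ : _ `&` _ = (Ray a `*` Ray y) `&` rect a b c d) ?ray0 //.
    apply/seteqP; split=> z [[h1 h2] h3]; split=> //; split=> //.
    by case: h3 => + _; rewrite /Ray /= !in_itv /= => /andP[->].
  - by move=> _ [x ->]; rewrite -E ray0.
have st2 (A B : set R') : measurable A -> measurable B ->
    (\int[leb2 R]_(z in (A `*` B) `&` rect a b c d) (g z)%:E = 0)%E.
  move=> mA mB; have E (C : set R') : (A `*` C) `&` rect a b c d =
     snd @^-1` C `&` ((A `*` [set: R']) `&` rect a b c d).
    by apply/seteqP; split=> z; [move=> [[h1 h2] h3]|move=> [h1 [[h2 _] h3]]].
  have mE : measurable ((A `*` [set: R']) `&` rect a b c d : set T2).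
    by apply: measurableI => //; apply: measurableX.
  rewrite E; apply: (@dynkin_integral0 _ R' snd _ g (@RGenOInfty.G R)) => //.
  - by apply: integrableS iI => // z [].
  - exact: RGenOInfty.measurableE.
  - rewrite (_ : _ `&` _ = (A `*` Ray c) `&` rect a b c d) ?st1 //.
    apply/seteqP; split=> z [[h1 h2] h3]; split=> //; split=> //.
    by case: h3 => _; rewrite /Ray /= !in_itv /= => /andP[->].
  - by move=> _ [x ->]; rewrite -E st1.
have st3 (A : set T2) : measurable A -> A `<=` rect a b c d ->
    (\int[leb2 R]_(z in A) (g z)%:E = 0)%E.
  move=> mA sA.
  rewrite (_ : A = id @^-1` A `&` rect a b c d); last by rewrite preimage_id; apply/esym/setIidPl.
  apply: (@dynkin_integral0 _ T2 id _ g [set A `*` B | A in @measurable _ R' & B in @measurable _ R']) => //.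
  - exact: measurable_prod_measurableType.
  - move=> _ _ [X mX [Y mY <-]] [X' mX' [Y' mY' <-]].
    exists (X `&` X'); first exact: measurableI.
    by exists (Y `&` Y'); [exact: measurableI|rewrite setXI].
  - rewrite (_ : rect a b c d = ([set: R'] `*` [set: R']) `&` rect a b c d) ?st2 //.
    by apply/seteqP; split=> z [].
  - by move=> _ [X mX [Y mY <-]]; exact: st2.
apply: integral_ae_eq => // E sE mE; rewrite integral0; exact: st3.
Qed.

(* The du Bois-Reymond lemma. *)
Lemma weak_zero_ae : {ae leb2 R, forall x, Om x -> g x = 0}.
Proof.
have [P [c [r [r0 sub E]]]] := open_squares Om_open.
have sq n : square (c n) (r n) = rect ((c n).1 - r n) ((c n).1 + r n) ((c n).2 - r n) ((c n).2 + r n).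
  by apply/seteqP; split=> x; rewrite /square /rect /= !in_itv.
have H n : (leb2 R).-negligible [set x | P n /\ square (c n) (r n) x /\ g x <> 0].
  case: (pselect (P n)) => Pn; last by apply: negligibleS (negligible_set0 _) => x [].
  have /weak_rect_ae : crect ((c n).1 - r n) ((c n).1 + r n) ((c n).2 - r n) ((c n).2 + r n) `<=` Om.
    move=> x [h1 h2]; apply: (sub n Pn); have rn := r0 n Pn.
    move: h1 h2; rewrite /= !in_itv /= => /andP[h1 h2] /andP[h3 h4].
    by split; apply/andP; split; lra.
  rewrite -sq; apply: negligibleS => x [_ [sx gx]] /= h.
  by apply: gx; case: (h sx).
apply: negligibleS (negligible_bigcup H) => x /= /not_implyP[]; rewrite {1}E => -[n Pn sx] gx.
by exists n.
Qed.

End WeakUniqueness.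

(** * The semi-inner product of L_2(Om) *)

Section PlaneL2.
Variable R : realType.
Notation R' := (measurableTypeR R).
Notation T2 := (R' * R')%type.
Variable Om : set (R * R).
Hypothesis mOm : measurable (Om : set T2).
Local Notation mu := (leb2 R).
Implicit Types (f g h : R * R -> R) (u v w : R * R -> R[i]).

Definition l2 (f : T2 -> R) := @sqint _ T2 R mu (Om : set T2) f.
Definition bil f g : R := Rintegral mu Om (fun x => f x * g x).

Lemma bilC f g : bil f g = bil g f.
Proof. by congr (Rintegral _ _ _); apply/funext => x; rewrite mulrC. Qed.

Lemma l2_int f g : l2 f -> l2 g -> mu.-integrable (Om : set T2) (EFin \o (fun x => f x * g x)).
Proof. exact: sqint_mul. Qed.

Lemma bilDl f g h : l2 f -> l2 g -> l2 h -> bil (fun x => f x + g x) h = bil f h + bil g h.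
Proof.
move=> lf lg lh; rewrite /bil -RintegralD //; try exact: l2_int.
by congr (Rintegral _ _ _); apply/funext => x; rewrite mulrDl.
Qed.

Lemma bilZl (a : R) f g : l2 f -> l2 g -> bil (fun x => a * f x) g = a * bil f g.
Proof.
move=> lf lg; rewrite /bil -RintegralZl //; try exact: l2_int.
by congr (Rintegral _ _ _); apply/funext => x; rewrite mulrA.
Qed.

Lemma bil_ge0 f : 0 <= bil f f.
Proof. by apply: Rintegral_ge0 => x _; rewrite -expr2 sqr_ge0. Qed.

Lemma bil_sqr f : l2 f -> (\int[mu]_(x in Om) (f x ^+ 2)%:E)%E = (bil f f)%:E.
Proof.
move=> lf; rewrite /bil /Rintegral fineK //.
exact: (integrable_fin_num mOm (l2_int lf lf)).
Qed.

Definition re u : R * R -> R := fun x => complex.Re (u x).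
Definition im u : R * R -> R := fun x => complex.Im (u x).

Lemma sqnorm_split u : cmeasurable Om u ->
  sqnorm Om u = (\int[mu]_(x in Om) (re u x ^+ 2)%:E + \int[mu]_(x in Om) (im u x ^+ 2)%:E)%E.
Proof.
move=> [mr mi]; rewrite /sqnorm; under eq_integral do rewrite EFinD.
rewrite ge0_integralD //.
- by move=> x _; rewrite lee_fin sqr_ge0.
- by apply/measurable_EFinP; apply: measurable_funX.
- by move=> x _; rewrite lee_fin sqr_ge0.
- by apply/measurable_EFinP; apply: measurable_funX.
Qed.

Lemma inL2P u : inL2 Om u <-> l2 (re u) /\ l2 (im u).
Proof.
split=> [[mu_ h]|[[mr hr] [mi hi]]].
  have [mr mi] := mu_; move: h; rewrite sqnorm_split //.
  set a := (\int[mu]_(x in Om) _)%E; set b := (\int[mu]_(x in Om) _)%E => h.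
  have a0 : (0 <= a)%E by apply: integral_ge0 => x _; rewrite lee_fin sqr_ge0.
  have b0 : (0 <= b)%E by apply: integral_ge0 => x _; rewrite lee_fin sqr_ge0.
  split; split=> //; apply: le_lt_trans h; [exact: leeDl|exact: leeDr].
by split; [split|rewrite sqnorm_split //; exact: lte_add_pinfty].
Qed.

Lemma inner_parts u v : inL2 Om u -> inL2 Om v -> inner Om u v =
  (bil (re u) (re v) + bil (im u) (im v)) +i* (bil (im u) (re v) - bil (re u) (im v)).
Proof.
move=> /inL2P[ru iu] /inL2P[rv iv]; rewrite /inner /cintegral; congr (_ +i* _).
  rewrite /bil -RintegralD //; try exact: l2_int.
  by congr (Rintegral _ _ _); apply/funext => x; rewrite ReM ReJ ImJ /re /im; ring.
rewrite /bil -RintegralB //; try exact: l2_int.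
by congr (Rintegral _ _ _); apply/funext => x; rewrite ImM ReJ ImJ /re /im; ring.
Qed.

Lemma reD u v : re (fun x => u x + v x) = (fun x => re u x + re v x).
Proof. by apply/funext => x; rewrite /re ReD. Qed.

Lemma imD u v : im (fun x => u x + v x) = (fun x => im u x + im v x).
Proof. by apply/funext => x; rewrite /im ImD. Qed.

Lemma reZ (a : R[i]) u : re (fun x => a * u x) =
  (fun x => complex.Re a * re u x + (- complex.Im a) * im u x).
Proof. by apply/funext => x; rewrite /re ReM mulNr. Qed.

Lemma imZ (a : R[i]) u : im (fun x => a * u x) =
  (fun x => complex.Re a * im u x + complex.Im a * re u x).
Proof. by apply/funext => x; rewrite /im ImM. Qed.

Lemma inL2D u v : inL2 Om u -> inL2 Om v -> inL2 Om (fun x => u x + v x).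
Proof.
by move=> /inL2P[ru iu] /inL2P[rv iv]; apply/inL2P; rewrite reD imD; split; apply: sqintD.
Qed.

Lemma inL2Z (a : R[i]) u : inL2 Om u -> inL2 Om (fun x => a * u x).
Proof.
by move=> /inL2P[ru iu]; apply/inL2P; rewrite reZ imZ; split; apply: sqintD => //; exact: sqintZ.
Qed.

Notation X := (R * R -> R[i]^o : lmodType R[i]).

Lemma inner_sip : sip (inL2 Om : X -> Prop) (inner Om).
Proof.
split.
- exact: inL2D.
- exact: inL2Z.
- move=> u v w hu hv hw; rewrite !inner_parts //; last exact: inL2D.
  rewrite (reD u v) (imD u v); move: hu hv hw => /inL2P[? ?] /inL2P[? ?] /inL2P[? ?].
  by rewrite !bilDl //; apply: complex_eqP; rewrite ?ReD ?ImD /=; ring.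
- move=> a u w hu hw; rewrite !inner_parts //; last exact: inL2Z.
  rewrite (reZ a u) (imZ a u); move: hu hw => /inL2P[? ?] /inL2P[? ?].
  rewrite !bilDl ?bilZl //; try exact: sqintZ.
  by apply: complex_eqP; rewrite ?ReM ?ImM /=; ring.
- move=> u v hu hv; rewrite !inner_parts //; apply: complex_eqP; rewrite ?ReJ ?ImJ /=.
    by rewrite (bilC (re v)) (bilC (im v)).
  by rewrite opprB (bilC (re v)) (bilC (im v)).
- by move=> u hu; rewrite inner_parts //= addr_ge0 // bil_ge0.
Qed.

Lemma sqnorm_nsq u : inL2 Om u -> sqnorm Om u = (nsq (inner Om : X -> X -> R[i]) u)%:E.
Proof.
move=> hu; rewrite sqnorm_split; last by case: hu.
by rewrite /nsq /rip inner_parts // /= EFinD; move: hu => /inL2P[? ?]; rewrite !bil_sqr.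
Qed.

Lemma ae_mono (P Q : R * R -> Prop) : (forall x, P x -> Q x) ->
  {ae mu, forall x, P x} -> {ae mu, forall x, Q x}.
Proof. by move=> PQ; apply: negligibleS => x nQ /PQ. Qed.

Definition ae_equal u v := {ae mu, forall x, Om x -> u x = v x}.

Lemma ae_sqnorm0 u : cmeasurable Om u ->
  sqnorm Om u = 0%E <-> {ae mu, forall x, Om x -> u x = 0}.
Proof.
move=> [mr mi].
have m2 : measurable_fun (Om : set T2) (fun x => (complex.Re (u x) ^+ 2 + complex.Im (u x) ^+ 2)%:E).
  by apply/measurable_EFinP; apply: measurable_funD; apply: measurable_funX.
have E : sqnorm Om u = (\int[mu]_(x in Om) `|(complex.Re (u x) ^+ 2 + complex.Im (u x) ^+ 2)%:E|)%E.
  apply: eq_integral => x _; rewrite gee0_abs // lee_fin.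
  exact: sqn_ge0.
rewrite E; split=> [/(ae_eq_integral_abs mu mOm m2)|h].
  by apply: ae_mono => x h Omx; apply: sqn0_eq0; move: (h Omx) => [].
apply/(ae_eq_integral_abs mu mOm m2).
by apply: ae_mono h => x h Omx /=; rewrite h //= expr0n addr0.
Qed.

Lemma inL2_ae u v : cmeasurable Om v -> ae_equal u v -> inL2 Om u -> inL2 Om v.
Proof.
move=> mv uv [[mr mi] h]; split=> //; apply: le_lt_trans h.
rewrite /sqnorm (@ge0_ae_eq_integral _ T2 R mu (Om : set T2) _ (fun x => (complex.Re (u x) ^+ 2 + complex.Im (u x) ^+ 2)%:E)) //.
- by apply/measurable_EFinP; apply: measurable_funD; apply: measurable_funX; case: mv.
- by apply/measurable_EFinP; apply: measurable_funD; apply: measurable_funX.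
- by move=> x _; rewrite lee_fin; exact: sqn_ge0.
- by move=> x _; rewrite lee_fin; exact: sqn_ge0.
- by apply: ae_mono uv => x h Omx; rewrite h.
Qed.

Lemma cmeasurable_sub u v : cmeasurable Om u -> cmeasurable Om v ->
  cmeasurable Om (fun x => u x - v x).
Proof.
move=> [a b] [c d]; split.
  by rewrite (_ : (fun x => _) = (fun x => complex.Re (u x) - complex.Re (v x)));
    [exact: measurable_funB|apply/funext => x; rewrite ReD ReN].
by rewrite (_ : (fun x => _) = (fun x => complex.Im (u x) - complex.Im (v x)));
  [exact: measurable_funB|apply/funext => x; rewrite ImD ImN].
Qed.

Lemma ae_nsq0 u v : inL2 Om u -> inL2 Om v ->
  nsq (inner Om : X -> X -> R[i]) (u - v : X) = 0 <-> ae_equal u v.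
Proof.
move=> hu hv.
have huv : inL2 Om (u - v : X) by apply: (sip_sub inner_sip).
have muv : cmeasurable Om (fun x => u x - v x) by apply: cmeasurable_sub; [case: hu|case: hv].
have := ae_sqnorm0 muv; rewrite (sqnorm_nsq huv) => -[h1 h2]; split=> [h|h].
  by move: h1; rewrite h => /(_ erefl); apply: ae_mono => x h3 Omx; apply/subr0_eq; exact: h3.
have : (nsq (inner Om : X -> X -> R[i]) (u - v : X))%:E = 0%E :> \bar R.
  by apply: h2; apply: ae_mono h => x h Omx; rewrite h // subrr.
by case.
Qed.

Lemma ae_inner u u' v : inL2 Om u -> inL2 Om u' -> inL2 Om v -> ae_equal u u' ->
  inner Om u v = inner Om u' v.
Proof.
move=> hu hu' hv /(ae_nsq0 hu hu') h.
apply/eqP; rewrite -subr_eq0 -(ipBl inner_sip) //; apply/eqP.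
by apply: (nsq0_ip inner_sip) => //; exact: (sip_sub inner_sip).
Qed.

Lemma inner_complete (u : nat -> X) : (forall n, inL2 Om (u n)) ->
  (forall e, 0 < e -> exists N, forall n m, (N <= n)%N -> (N <= m)%N ->
     nsq (inner Om : X -> X -> R[i]) (u n - u m) <= e) ->
  exists2 v : X, inL2 Om v & forall e, 0 < e -> exists N, forall n, (N <= n)%N ->
     nsq (inner Om : X -> X -> R[i]) (u n - v) <= e.
Proof.
move=> hu cau.
have E (v w : X) : inL2 Om v -> inL2 Om w ->
   (\int[mu]_(x in Om) ((re v x - re w x) ^+ 2)%:E + \int[mu]_(x in Om) ((im v x - im w x) ^+ 2)%:E =
     (nsq (inner Om : X -> X -> R[i]) (v - w))%:E)%E.
  move=> hv hw; rewrite -sqnorm_nsq; last exact: (sip_sub inner_sip).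
  rewrite sqnorm_split; last by case: (sip_sub inner_sip hv hw).
  by congr (_ + _)%E; apply: eq_integral => x _; rewrite /re /im /= ?ReD ?ImD ?ReN ?ImN.
have pos (f : T2 -> R) : (0 <= \int[mu]_(x in Om) (f x ^+ 2)%:E)%E.
  by apply: integral_ge0 => x _; rewrite lee_fin sqr_ge0.
have cr e : 0 < e -> exists N, forall n m, (N <= n)%N -> (N <= m)%N ->
    (\int[mu]_(x in Om) ((re (u n) x - re (u m) x) ^+ 2)%:E <= e%:E)%E.
  move=> e0; have [N HN] := cau e e0; exists N => n m Nn Nm.
  by have := HN n m Nn Nm; rewrite -lee_fin -E //; apply: le_trans; exact: leeDl.
have ci e : 0 < e -> exists N, forall n m, (N <= n)%N -> (N <= m)%N ->
    (\int[mu]_(x in Om) ((im (u n) x - im (u m) x) ^+ 2)%:E <= e%:E)%E.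
  move=> e0; have [N HN] := cau e e0; exists N => n m Nn Nm.
  by have := HN n m Nn Nm; rewrite -lee_fin -E //; apply: le_trans; exact: leeDr.
have hr n : l2 (re (u n)) by case: ((inL2P (u n)).1 (hu n)).
have hi n : l2 (im (u n)) by case: ((inL2P (u n)).1 (hu n)).
have [f hf Hf] := riesz_fischer mOm hr cr.
have [g hg Hg] := riesz_fischer mOm hi ci.
exists (fun x => f x +i* g x); first exact/inL2P.
move=> e e0; have e20 : 0 < e / 2 by rewrite divr_gt0.
have [N1 H1] := Hf _ e20; have [N2 H2] := Hg _ e20; exists (maxn N1 N2) => n.
rewrite geq_max => /andP[n1 n2]; rewrite -lee_fin -E //; last exact/inL2P.
have -> : e = e / 2 + e / 2 by lra.
by rewrite EFinD; apply: leeD; [exact: H1|exact: H2].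
Qed.

End PlaneL2.

(** * Compactly supported functions on the plane *)

Section CompactSupport.
Variable R : realType.
Notation leb := (@lebesgue_measure R).
Notation R' := (measurableTypeR R).
Notation T2 := (R' * R')%type.

Lemma compact_bounded2 (K : set (R * R)) : compact K ->
  exists2 M : R, 0 < M & K `<=` crect (- M) M (- M) M.
Proof.
move=> /compact_bounded[M [_ HM]]; exists (Num.max M 0 + 1).
  by rewrite ltr_wpDl // le_max lexx orbT.
have MC : M < Num.max M 0 + 1.
    by apply: (@le_lt_trans _ _ (Num.max M 0)); rewrite ?le_max ?lexx // ltrDl.
move=> x Kx; have /= := HM _ MC x Kx; rewrite prod_normE /= ge_max => /andP[h1 h2].
by split; rewrite /= in_itv /= -ler_norml.
Qed.

Lemma compact_finite2 (K : set (R * R)) : compact K -> (leb2 R K < +oo)%E.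
Proof.
move=> cK; have [M _ sub] := compact_bounded2 cK.
apply: le_lt_trans (crect_finite (- M) M (- M) M); apply: le_measure => //; rewrite inE.
- exact: compact2_measurable.
- exact: measurable_crect.
Qed.

Lemma compact_support_bounded (K : set (R * R)) (f : R * R -> R) : compact K -> continuous f ->
  (forall x, ~ K x -> f x = 0) -> exists2 M : R, 0 < M & forall x, `|f x| <= M.
Proof.
move=> cK cf f0.
have /compact_bounded[M [_ HM]] : compact (f @` K).
  by apply: continuous_compact => //; apply: continuous_subspaceT.
exists (Num.max M 0 + 1); first by rewrite ltr_wpDl // le_max lexx orbT.
move=> x; case: (pselect (K x)) => [Kx|/f0 ->]; last first.
  by rewrite normr0 addr_ge0 // le_max lexx orbT.
have MC : M < Num.max M 0 + 1.
  by apply: (@le_lt_trans _ _ (Num.max M 0)); rewrite ?le_max ?lexx // ltrDl.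
by apply: (HM _ MC); exists x.
Qed.

Lemma integral_restrict_support (D E : set (R * R)) (f : R * R -> \bar R) : D `<=` E ->
  (forall x, ~ D x -> f x = 0%E) ->
  (\int[leb2 R]_(x in D) f x = \int[leb2 R]_(x in E) f x)%E.
Proof.
move=> DE f0; rewrite integral_mkcond [RHS]integral_mkcond; apply: eq_integral => x _.
rewrite !patchE; case: ifPn => xD; case: ifPn => xE //.
  by move: xD xE; rewrite inE notin_setE => /DE.
by rewrite f0 //; move: xD; rewrite notin_setE.
Qed.

Lemma integrable_restrict_support (D E : set T2) (f : T2 -> \bar R) : measurable D -> measurable E ->
  D `<=` E -> (forall x, ~ D x -> f x = 0%E) ->
  (leb2 R).-integrable D f -> (leb2 R).-integrable E f.
Proof.
move=> mD mE DE f0; rewrite integrable_mkcond // [X in _ -> X]integrable_mkcond //.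
rewrite (_ : f \_ D = f \_ E) //; apply/funext => x.
rewrite !patchE; case: ifPn => xD; case: ifPn => xE //.
  by move: xD xE; rewrite inE notin_setE => /DE.
by rewrite f0 //; move: xD; rewrite notin_setE.
Qed.

Lemma compact_support_integrable (K : set (R * R)) (f : R * R -> R) : compact K -> continuous f ->
  (forall x, ~ K x -> f x = 0) -> (leb2 R).-integrable [set: T2] (EFin \o f).
Proof.
move=> cK cf f0; have mK : measurable (K : set T2) by exact: compact2_measurable.
have [M M0 HM] := compact_support_bounded cK cf f0.
apply: (@integrable_restrict_support K) => //; first by move=> x /f0 /= ->.
apply: (@integrable_le _ T2 _ _ _ mK _ (cst M)).
- exact: continuous2_measurable.
- by move=> x _; exact: HM.
apply: (@integrable_nonneg _ T2 _ _ _ mK (cst M)) => //; first by move=> x _; exact: ltW.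
rewrite [X in (X < _)%E](integral_cst _ mK M%:E); apply: lte_mul_pinfty => //.
  by rewrite lee_fin ltW.
exact: compact_finite2.
Qed.

Lemma is_derive_slice1 (f : R * R -> R) (x y d : R) :
  is_derive (x, y) (1, 0) f d -> is_derive x (1 : R) (fun t => f (t, y)) d.
Proof.
move=> /is_derive_line h; apply/is_derive_line.
rewrite (_ : (fun t => _) = (fun t : R => f (t *: (1, 0) + (x, y)))) //.
apply/funext => t; congr f; congr pair.
by rewrite /= [t *: (0 : R)]mulr0 add0r.
Qed.

Lemma is_derive_slice2 (f : R * R -> R) (x y d : R) :
  is_derive (x, y) (0, 1) f d -> is_derive y (1 : R) (fun t => f (x, t)) d.
Proof.
move=> /is_derive_line h; apply/is_derive_line.
rewrite (_ : (fun t => _) = (fun t : R => f (t *: (0, 1) + (x, y)))) //.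
apply/funext => t; congr f; congr pair.
by rewrite /= [t *: (0 : R)]mulr0 add0r.
Qed.

Lemma plane_derive0 (e : R * R) (F F' : R * R -> R) (K : set (R * R)) :
  e = (1, 0) \/ e = (0, 1) ->
  (forall x, is_derive x e F (F' x)) -> continuous F' -> compact K ->
  (forall x, ~ K x -> F x = 0 /\ F' x = 0) -> (\int[leb2 R]_x (F' x)%:E = 0)%E.
Proof.
move=> he dF cF' cK F0; have [M M0 sub] := compact_bounded2 cK.
have iF' : (leb2 R).-integrable [set: T2] (EFin \o F').
  by apply: compact_support_integrable cK cF' _ => x /F0[].
have big n : (`|Num.ceil M|%N < n)%N -> M < n%:R.
  move=> Mn; apply: le_lt_trans (ceil_ge _) _; apply: le_lt_trans (ler_norm _) _.
  by rewrite -intr_norm -natr_absz ltr_nat.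
have out x y : M < `|x| \/ M < `|y| -> F (x, y) = 0.
  move=> h; apply: (F0 (x, y) _).1 => /sub[]; rewrite /= !in_itv /= -!ler_norml => h1 h2.
  by case: h; rewrite ltNge ?h1 ?h2.
case: he dF => -> dF.
- apply: integral_plane_derive0_1 => //; first by move=> x y; exact: is_derive_slice1.
  move=> y; apply: (cvg_near_cst 0); exists `|Num.ceil M|.+1%N => // n /big Mn.
  have n0 : (0 : R) <= n%:R by [].
  by rewrite !out ?subrr //; left; rewrite ?normrN ger0_norm.
- apply: integral_plane_derive0_2 => //; first by move=> x y; exact: is_derive_slice2.
  move=> x; apply: (cvg_near_cst 0); exists `|Num.ceil M|.+1%N => // n /big Mn.
  have n0 : (0 : R) <= n%:R by [].
  by rewrite !out ?subrr //; right; rewrite ?normrN ger0_norm.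
Qed.

End CompactSupport.

(** * Linearity and uniqueness of weak derivatives *)

Section WeakDerivative.
Variable R : realType.
Notation R' := (measurableTypeR R).
Notation T2 := (R' * R')%type.
Local Notation mu := (leb2 R).
Variable Om : set (R * R).
Hypothesis Om_open : open Om.
Implicit Types (u v g h : R * R -> R[i]) (e : R * R).

Let mOm : measurable (Om : set T2).
Proof. exact: open2_measurable. Qed.

Definition loc2 (f : R * R -> R) := measurable_fun (Om : set T2) (f : T2 -> R) /\
  forall K, compact K -> K `<=` Om -> (\int[mu]_(x in K) (f x ^+ 2)%:E < +oo)%E.

Lemma inL2locP u : inL2loc Om u <-> loc2 (re u) /\ loc2 (im u).
Proof.
split=> [[[mr mi] h]|[[mr hr] [mi hi]]].
  suff H K : compact K -> K `<=` Om -> inL2 K u.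
    split; split=> // K cK sub.
      by have /(inL2P (compact2_measurable cK))[[]] := H K cK sub.
    by have /(inL2P (compact2_measurable cK))[_ []] := H K cK sub.
  move=> cK sub; split; last exact: h.
  by split; apply: (@measurable_funS _ _ T2 _ (Om : set T2)).
split; first by split.
move=> K cK sub; have mK := compact2_measurable cK.
have hK : cmeasurable K u by split; apply: (@measurable_funS _ _ T2 _ (Om : set T2)).
by rewrite sqnorm_split //; apply: lte_add_pinfty; [exact: hr|exact: hi].
Qed.

Lemma loc2_sqint f : loc2 f <-> measurable_fun (Om : set T2) (f : T2 -> R) /\
  forall K, compact K -> K `<=` Om -> @sqint _ T2 R mu (K : set T2) f.
Proof.
split=> -[mf h]; split=> // K cK sub; last by case: (h K cK sub).
by split; [exact: (@measurable_funS _ _ T2 _ (Om : set T2))|exact: h].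
Qed.

Lemma loc2D (f g : R * R -> R) : loc2 f -> loc2 g -> loc2 (fun x => f x + g x).
Proof.
move=> /loc2_sqint[mf hf] /loc2_sqint[mg hg]; apply/loc2_sqint; split; first exact: measurable_funD.
move=> K cK sub; apply: sqintD; [exact: compact2_measurable|exact: hf|exact: hg].
Qed.

Lemma loc2Z (a : R) (f : R * R -> R) : loc2 f -> loc2 (fun x => a * f x).
Proof.
move=> /loc2_sqint[mf hf]; apply/loc2_sqint; split; first exact: measurable_funM.
by move=> K cK sub; apply: sqintZ; [exact: compact2_measurable|exact: hf].
Qed.

Lemma inL2locD u v : inL2loc Om u -> inL2loc Om v -> inL2loc Om (fun x => u x + v x).
Proof.
by move=> /inL2locP[? ?] /inL2locP[? ?]; apply/inL2locP; rewrite reD imD; split; apply: loc2D.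
Qed.

Lemma inL2locZ (a : R[i]) u : inL2loc Om u -> inL2loc Om (fun x => a * u x).
Proof.
by move=> /inL2locP[? ?]; apply/inL2locP; rewrite reZ imZ; split; apply: loc2D; exact: loc2Z.
Qed.

Lemma loc2_continuous (f : R * R -> R) : continuous f -> loc2 f.
Proof.
move=> cf; split; first exact: continuous2_measurable.
move=> K cK sub; have mK : measurable (K : set T2) by exact: compact2_measurable.
have /compact_bounded[M [_ HM]] : compact (f @` K).
  by apply: continuous_compact => //; apply: continuous_subspaceT.
pose C := Num.max M 0 + 1.
have C0 : 0 < C by rewrite ltr_wpDl // le_max lexx orbT.
have fC x : K x -> `|f x| <= C.
  move=> Kx; have MC : M < C.
    by apply: (@le_lt_trans _ _ (Num.max M 0)); rewrite ?le_max ?lexx // ltrDl.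
  by apply: (HM _ MC); exists x.
apply: (@le_lt_trans _ _ (\int[mu]_(x in K) (C ^+ 2)%:E)%E).
  apply: ge0_le_integral => //.
  - by move=> x _; rewrite lee_fin sqr_ge0.
  - by apply/measurable_EFinP; apply: measurable_funX; exact: continuous2_measurable.
  - by move=> x Kx; rewrite lee_fin -(real_normK (num_real (f x))) ler_pXn2r ?nnegrE ?fC // ltW.
rewrite [X in (X < _)%E](integral_cst _ mK (C ^+ 2)%:E); apply: lte_mul_pinfty => //.
  by rewrite lee_fin sqr_ge0.
exact: compact_finite2.
Qed.

(** What a test function and its derivatives have in common, and all that is needed to pair them
    with locally square integrable functions. *)
Definition csupp (psi : R * R -> R) :=
  continuous psi /\ exists2 K, compact K /\ K `<=` Om & forall x, ~ K x -> psi x = 0.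

Lemma loc2_csupp_integrable f psi : loc2 f -> csupp psi ->
  mu.-integrable (Om : set T2) (EFin \o (fun x => f x * psi x)).
Proof.
move=> [mf hf] [cpsi [K [cK sub] psi0]].
have mK : measurable (K : set T2) by exact: compact2_measurable.
have mfK : measurable_fun (K : set T2) (f : T2 -> R) by exact: (@measurable_funS _ _ T2 _ (Om : set T2)).
have [M M0 HM] := compact_support_bounded cK cpsi psi0.
apply: (@integrable_restrict_support _ K) => //; first by move=> x /psi0 /= ->; rewrite mulr0.
apply: sqint_mul => //; first by split=> //; exact: hf.
split; first exact: continuous2_measurable.
exact: (loc2_continuous cpsi).2.
Qed.

Lemma test_csupp phi : test_function Om phi -> csupp phi.
Proof. by move=> [sm [K hK phi0]]; split; [exact: (sm [::]).1|exists K]. Qed.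

Lemma test_derive_csupp e phi : test_function Om phi ->
  csupp ('D_e phi) /\ forall x, is_derive x e phi ('D_e phi x).
Proof.
move=> [sm [K [cK sub] phi0]]; split; last first.
  by move=> x; apply: DeriveDef => //; exact: (sm [::]).2.
split; first exact: (sm [:: e]).1.
exists K => // x nK.
have oK : open (~` K) by rewrite openC; apply: compact_closed => //; exact: norm_hausdorff.
rewrite (@near_eq_derive _ _ _ phi (cst 0)); first exact: derive_cst.
have : nbhs x (~` K) by apply: open_nbhs_nbhs.
by apply: filterS => y; exact: phi0.
Qed.

Definition pairing u psi : R[i] := cintegral Om (fun x => u x * rc (psi x)).

Lemma pairing_parts u psi : pairing u psi =
  (Rintegral mu Om (fun x => re u x * psi x)) +i* (Rintegral mu Om (fun x => im u x * psi x)).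
Proof.
rewrite /pairing /cintegral; congr (_ +i* _); congr (Rintegral _ _ _); apply/funext => x.
  by rewrite ReM /= mulr0 subr0.
by rewrite ImM /= mulr0 add0r.
Qed.

Lemma pairingD u v psi : inL2loc Om u -> inL2loc Om v -> csupp psi ->
  pairing (fun x => u x + v x) psi = pairing u psi + pairing v psi.
Proof.
move=> /inL2locP[? ?] /inL2locP[? ?] hp; rewrite !pairing_parts reD imD.
apply: complex_eqP; rewrite ?ReD ?ImD /= -RintegralD //; try exact: loc2_csupp_integrable;
by congr (Rintegral _ _ _); apply/funext => x; rewrite mulrDl.
Qed.

Lemma pairingZ (a : R[i]) u psi : inL2loc Om u -> csupp psi ->
  pairing (fun x => a * u x) psi = a * pairing u psi.
Proof.
move=> /inL2locP[h1 h2] hp; rewrite !pairing_parts reZ imZ.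
have := loc2_csupp_integrable h1 hp; have := loc2_csupp_integrable h2 hp => i2 i1.
have L (p q : R) (f g : R * R -> R) : loc2 f -> loc2 g ->
   Rintegral mu Om (fun x => (p * f x + q * g x) * psi x) =
   p * Rintegral mu Om (fun x => f x * psi x) + q * Rintegral mu Om (fun x => g x * psi x).
  move=> lf lg; rewrite -!RintegralZl //; try exact: loc2_csupp_integrable.
  rewrite -RintegralD //.
  - by congr (Rintegral _ _ _); apply/funext => x; ring.
  - have := loc2_csupp_integrable (loc2Z p lf) hp.
    by congr (_.-integrable _ _); apply/funext => x /=; rewrite mulrA.
  - have := loc2_csupp_integrable (loc2Z q lg) hp.
    by congr (_.-integrable _ _); apply/funext => x /=; rewrite mulrA.
by apply: complex_eqP; rewrite ?ReM ?ImM /= L // mulNr.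
Qed.

Lemma is_weak_derivE e u g : is_weak_deriv Om e u g <->
  inL2loc Om g /\ forall phi, test_function Om phi -> pairing u ('D_e phi) = - pairing g phi.
Proof. by []. Qed.

Lemma is_weak_derivD e u v g h : inL2loc Om u -> inL2loc Om v ->
  is_weak_deriv Om e u g -> is_weak_deriv Om e v h ->
  is_weak_deriv Om e (fun x => u x + v x) (fun x => g x + h x).
Proof.
move=> lu lv /is_weak_derivE[lg Hg] /is_weak_derivE[lh Hh]; apply/is_weak_derivE.
split; first exact: inL2locD.
move=> phi tphi; have [c1 _] := test_derive_csupp e tphi; have c2 := test_csupp tphi.
by rewrite !pairingD // Hg // Hh // opprD.
Qed.

Lemma is_weak_derivZ e (a : R[i]) u g : inL2loc Om u ->
  is_weak_deriv Om e u g -> is_weak_deriv Om e (fun x => a * u x) (fun x => a * g x).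
Proof.
move=> lu /is_weak_derivE[lg Hg]; apply/is_weak_derivE.
split; first exact: inL2locZ.
move=> phi tphi; have [c1 _] := test_derive_csupp e tphi; have c2 := test_csupp tphi.
by rewrite !pairingZ // Hg // mulrN.
Qed.

Lemma weak_deriv_uniq e u g h : is_weak_deriv Om e u g -> is_weak_deriv Om e u h ->
  ae_equal Om g h.
Proof.
move=> /is_weak_derivE[lg Hg] /is_weak_derivE[lh Hh].
have E phi : test_function Om phi -> pairing (fun x => g x + (-1) * h x) phi = 0.
  move=> tphi; have c2 := test_csupp tphi.
  have := Hg phi tphi; rewrite Hh // => /oppr_inj eq.
  by rewrite pairingD ?pairingZ ?eq ?mulN1r ?subrr //; exact: inL2locZ.
have : inL2loc Om (fun x => g x + (-1) * h x) by apply: inL2locD => //; exact: inL2locZ.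
move=> /inL2locP[[mr hr] [mi hi]].
have A : {ae mu, forall x, Om x -> re (fun x => g x + (-1) * h x) x = 0}.
  apply: (weak_zero_ae mr hr _ Om_open) => phi tphi.
  by have := E phi tphi; rewrite pairing_parts => /(congr1 (@complex.Re R)).
have B : {ae mu, forall x, Om x -> im (fun x => g x + (-1) * h x) x = 0}.
  apply: (weak_zero_ae mi hi _ Om_open) => phi tphi.
  by have := E phi tphi; rewrite pairing_parts => /(congr1 (@complex.Im R)).
have AB := negligibleU A B.
apply: negligibleS AB => x /= /not_implyP[Omx gh].
apply: contrapT => /not_orP[/contrapT a /contrapT b]; apply: gh.
have := complex_eqP (z := g x + (-1) * h x) (w := 0) (a Omx) (b Omx).
by rewrite mulN1r => /subr0_eq.
Qed.

Lemma weak_derivP e u : (exists g, is_weak_deriv Om e u g) ->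
  is_weak_deriv Om e u (weak_deriv Om e u).
Proof. by move=> h; apply: (@xgetPex _ _ [set g | is_weak_deriv Om e u g]). Qed.

Lemma weak_deriv_ae e u g : is_weak_deriv Om e u g -> ae_equal Om (weak_deriv Om e u) g.
Proof. by move=> h; apply: (weak_deriv_uniq (weak_derivP _) h); exists g. Qed.

(** The product of [u] with a test function is differentiable on the whole plane with continuous
    derivative and compact support in Om, so the derivative integrates to 0 without any regularity
    of the boundary of Om. *)
Lemma classical_weak_deriv e u u' : e = (1, 0) \/ e = (0, 1) ->
  (forall x, is_derive x e (re u) (re u' x)) -> (forall x, is_derive x e (im u) (im u' x)) ->
  continuous (re u) -> continuous (im u) -> continuous (re u') -> continuous (im u') ->
  is_weak_deriv Om e u u'.
Proof.
move=> he dr di cr ci cr' ci'; apply/is_weak_derivE; split.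
  by apply/inL2locP; split; exact: loc2_continuous.
move=> phi tphi; rewrite !pairing_parts.
have [c1 dphi] := test_derive_csupp e tphi; have c2 := test_csupp tphi.
have H (f f' : R * R -> R) : (forall x, is_derive x e f (f' x)) -> continuous f -> continuous f' ->
    Rintegral mu Om (fun x => f x * 'D_e phi x) = - Rintegral mu Om (fun x => f' x * phi x).
  move=> df cf cf'.
  have i1 := loc2_csupp_integrable (loc2_continuous cf) c1.
  have i2 := loc2_csupp_integrable (loc2_continuous cf') c2.
  apply/eqP; rewrite -subr_eq0 opprK -RintegralD //; apply/eqP.
  have [_ [K [cK sub] phi0]] := tphi.
  have cphi : continuous phi by case: c2.
  have cD : continuous ('D_e phi) by case: c1.
  have D0 x : ~ K x -> 'D_e phi x = 0.
    move=> nK; have oK : open (~` K) by rewrite openC; apply: compact_closed => //; exact: norm_hausdorff.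
    rewrite (@near_eq_derive _ _ _ phi (cst 0)); first exact: derive_cst.
    have : nbhs x (~` K) by apply: open_nbhs_nbhs.
    by apply: filterS => y; exact: phi0.
  pose F' x := f x * 'D_e phi x + f' x * phi x.
  have dF x : is_derive x e (fun x => f x * phi x) (F' x).
    have h := @is_deriveM _ _ f phi x e _ _ (df x) (dphi x).
    by apply: (is_derive_eq h); rewrite /F' /GRing.scale /=; ring.
  have cF : continuous F'.
    by move=> x; apply: cvgD; apply: cvgM; [exact: cf|exact: cD|exact: cf'|exact: cphi].
  have F0 x : ~ K x -> f x * phi x = 0 /\ F' x = 0.
    by move=> nK; rewrite /F' D0 // phi0 // !mulr0 addr0.
  have := plane_derive0 he dF cF cK F0.
  rewrite /Rintegral -(@integral_restrict_support _ Om setT) => [->|//|x nO] //.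
  by rewrite (F0 _ _).2 // => /sub.
by rewrite (H _ _ dr cr cr') (H _ _ di ci ci').
Qed.

End WeakDerivative.

(** * The magnetic form *)
Section OrthonormalExpansion.
Variables (R : realType) (X : lmodType R[i]).
Variables (L D : X -> Prop) (ip Q : X -> X -> R[i]).
Hypotheses (SL : sip L ip) (SD : sip D Q) (DL : forall u, D u -> L u).

Lemma expansion (T : finType) (psi : T -> X) f : (forall i, L (psi i)) -> orthonormal ip psi -> L f ->
  let r := f - \sum_(i : T) ip f (psi i) *: psi i in
  [/\ L r, forall i, ip r (psi i) = 0 & nsq ip f = \sum_(i : T) sqn (ip f (psi i)) + nsq ip r].
Proof.
move=> Lpsi on Lf r; set p := \sum_(i : T) _ in r *.
have Lp : L p by apply: (sip_sum SL) => //; exists f.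
have Lr : L r by exact: (sip_sub SL).
have rp i : ip r (psi i) = 0.
  rewrite (ipBl SL) // (ip_suml SL) // (bigD1 i) //= on eqxx mulr1 big1 ?addr0 ?subrr //.
  by move=> j ji; rewrite on (negbTE ji) mulr0.
have pr : ip p r = 0.
  rewrite (ip_suml SL) // big1 // => i _.
  by rewrite (sip_ipC SL Lr (Lpsi i)) rp cj0 mulr0.
have pp : nsq ip p = \sum_(i : T) sqn (ip f (psi i)).
  rewrite /nsq /rip (ip_suml SL) //.
  transitivity (complex.Re (\sum_(i : T) rc (sqn (ip f (psi i))))).
    congr complex.Re; apply: eq_bigr => i _.
    have : ip f (psi i) = ip p (psi i) by have := rp i; rewrite (ipBl SL) // => /subr0_eq.
    by move=> e; rewrite (sip_ipC SL Lp (Lpsi i)) -e mulJ.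
  by elim/big_rec2 : _ => // i y x _ <-; rewrite ReD.
split=> //; rewrite -pp -[in LHS](subrK p f) addrC -/r (nsqD SL) //.
by rewrite /rip pr /= mulr0 addr0.
Qed.

Lemma bessel (T : finType) (psi : T -> X) f : (forall i, L (psi i)) -> orthonormal ip psi -> L f ->
  \sum_(i : T) sqn (ip f (psi i)) <= nsq ip f.
Proof.
move=> Lpsi on Lf; have [Lr _ ->] := expansion Lpsi on Lf.
by rewrite lerDl (nsq_ge0 SL).
Qed.

(** The projection of [f] on the eigenfunctions and the remainder are orthogonal for both forms, and
    the remainder has energy at least [s] per unit of mass. *)
Lemma spectral_lower (T : finType) (psi : T -> X) (mu : T -> R) (s : R) f :
  orthonormal ip psi -> (forall i, graph L D ip Q (psi i) (rc (mu i) *: psi i)) ->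
  (forall g, D g -> (forall i, ip g (psi i) = 0) -> s * nsq ip g <= nsq Q g) -> D f ->
  \sum_(i : T) mu i * sqn (ip f (psi i)) + s * (nsq ip f - \sum_(i : T) sqn (ip f (psi i)))
    <= nsq Q f.
Proof.
move=> on eig low Df.
have Dpsi i : D (psi i) by case: (eig i).
have Lpsi i : L (psi i) by exact: DL.
have [Lr rp ->] := expansion Lpsi on (DL Df).
set p := \sum_(i : T) ip f (psi i) *: psi i in Lr rp *; set r := f - p in Lr rp *.
have Dp : D p by apply: (sip_sum SD) => //; exists f.
have Dr : D r by exact: (sip_sub SD).
have Qpsi i v : D v -> Q (psi i) v = rc (mu i) * ip (psi i) v.
  by move=> Dv; have [_ _ ->] := eig i => //; rewrite (sip_ipZl SL) //; exact: DL.
have Qpr : Q p r = 0.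
  rewrite (ip_suml SD) // big1 // => i _.
  by rewrite Qpsi // (sip_ipC SL Lr (Lpsi i)) rp cj0 !mulr0.
have Qpp : nsq Q p = \sum_(i : T) mu i * sqn (ip f (psi i)).
  rewrite /nsq /rip (ip_suml SD) //.
  transitivity (complex.Re (\sum_(i : T) rc (mu i * sqn (ip f (psi i))))).
    congr complex.Re; apply: eq_bigr => i _; rewrite Qpsi //.
    have : ip f (psi i) = ip p (psi i).
      by have := rp i; rewrite (ipBl SL) //; [move=> /subr0_eq|exact: DL|exact: DL].
    move=> e; rewrite (sip_ipC SL (DL Dp) (Lpsi i)) -e mulrCA mulJ.
    by rewrite realcMM.
  by elim/big_rec2 : _ => // i y x _ <-; rewrite ReD.
rewrite -Qpp -[in leRHS](subrK p f) [in leRHS]addrC -/r (nsqD SD) //.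
by rewrite /rip Qpr /= mulr0 addr0 lerD2l addrC addKr; exact: low.
Qed.

End OrthonormalExpansion.

Section MagneticForm.
Variable R : realType.
Notation R' := (measurableTypeR R).
Notation T2 := (R' * R')%type.
Local Notation mu := (leb2 R).
Notation X := (R * R -> R[i]^o : lmodType R[i]).
Variables (Om : set (R * R)) (A : R * R -> R * R).
Hypothesis Om_open : open Om.
Hypothesis cA1 : continuous (fun x => (A x).1).
Hypothesis cA2 : continuous (fun x => (A x).2).
Implicit Types (u v g h : R * R -> R[i]) (e : R * R) (a : R * R -> R).

Let mOm : measurable (Om : set T2).
Proof. exact: open2_measurable. Qed.

(** [weak_deriv] picks a representative, so this is linear in [u] only almost everywhere; the laws
    of the magnetic form are proved by changing representatives inside [inner]. *)
Definition mom e a u : R * R -> R[i] :=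
  fun x => - 'i%C * weak_deriv Om e u x - rc (a x) * u x.

Definition weakly_derivable e u := inL2loc Om u /\ exists g, is_weak_deriv Om e u g.

Definition classical_mom a u' u : R * R -> R[i] := fun x => - 'i%C * u' x - rc (a x) * u x.

Lemma re_mom a u' u : re (classical_mom a u' u) = (fun x => im u' x - a x * re u x).
Proof. by apply/funext => x; rewrite /re /classical_mom ReD ReN !ReM /= /im; ring. Qed.

Lemma im_mom a u' u : im (classical_mom a u' u) = (fun x => - re u' x - a x * im u x).
Proof. by apply/funext => x; rewrite /im /classical_mom ImD ImN !ImM /= /re; ring. Qed.

Lemma cmeasurable_mom a u' u : continuous a -> cmeasurable Om u' -> cmeasurable Om u ->
  cmeasurable Om (classical_mom a u' u).
Proof.
move=> ca [mr' mi'] [mr mi].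
have ma : measurable_fun (Om : set T2) (a : T2 -> R) by exact: continuous2_measurable.
split.
  rewrite -[X in measurable_fun _ X]/(re (classical_mom a u' u)) re_mom.
  by apply: measurable_funB => //; exact: measurable_funM.
rewrite -[X in measurable_fun _ X]/(im (classical_mom a u' u)) im_mom.
apply: measurable_funB; last exact: measurable_funM.
exact: measurableT_comp.
Qed.

Lemma mom_ae e a u g : is_weak_deriv Om e u g -> ae_equal Om (mom e a u) (classical_mom a g u).
Proof.
move=> /(weak_deriv_ae Om_open); apply: ae_mono => x h Ox.
by rewrite /mom /classical_mom h.
Qed.

Lemma weakly_derivableP e u : weakly_derivable e u -> is_weak_deriv Om e u (weak_deriv Om e u).
Proof. by case=> _; exact: weak_derivP. Qed.

Lemma mom_cmeasurable e a u : continuous a -> weakly_derivable e u -> cmeasurable Om (mom e a u).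
Proof.
move=> ca hu; have [[mg _] _] := weakly_derivableP hu.
by apply: cmeasurable_mom => //; case: hu => -[].
Qed.

Lemma momD e a u v : weakly_derivable e u -> weakly_derivable e v ->
  ae_equal Om (mom e a (fun x => u x + v x)) (fun x => mom e a u x + mom e a v x).
Proof.
move=> hu hv; have [[lu _] [lv _]] := (hu, hv).
apply: ae_mono (mom_ae a (is_weak_derivD Om_open lu lv (weakly_derivableP hu) (weakly_derivableP hv))) => x h Ox.
by rewrite h // /classical_mom /mom !mulrDr opprD addrACA.
Qed.

Lemma momZ e a (c : R[i]) u : weakly_derivable e u ->
  ae_equal Om (mom e a (fun x => c * u x)) (fun x => c * mom e a u x).
Proof.
move=> hu; have [lu _] := hu.
apply: ae_mono (mom_ae a (is_weak_derivZ Om_open c lu (weakly_derivableP hu))) => x h Ox.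
by rewrite h // /classical_mom /mom mulrBr !(mulrCA c).
Qed.

Lemma weakly_derivableD e u v : weakly_derivable e u -> weakly_derivable e v -> weakly_derivable e (fun x => u x + v x).
Proof.
move=> hu hv; have [[lu _] [lv _]] := (hu, hv); split; first exact: inL2locD.
by eexists; exact: (is_weak_derivD Om_open lu lv (weakly_derivableP hu) (weakly_derivableP hv)).
Qed.

Lemma weakly_derivableZ e (c : R[i]) u : weakly_derivable e u -> weakly_derivable e (fun x => c * u x).
Proof.
move=> hu; have [lu _] := hu; split; first exact: inL2locZ.
by eexists; exact: (is_weak_derivZ Om_open c lu (weakly_derivableP hu)).
Qed.

Let a1 x := (A x).1.
Let a2 x := (A x).2.

Lemma form_domainP u : form_domain Om A u <->
  [/\ inL2 Om u, weakly_derivable (1, 0) u, weakly_derivable (0, 1) u, inL2 Om (mom (1, 0) a1 u) & inL2 Om (mom (0, 1) a2 u)].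
Proof. by split=> [[? [? ? ?] ? ?]|[? [? ?] [_ ?] ? ?]]; split. Qed.

Lemma magnetic_formE u v : magnetic_form Om A u v =
  inner Om (mom (1, 0) a1 u) (mom (1, 0) a1 v) + inner Om (mom (0, 1) a2 u) (mom (0, 1) a2 v).
Proof. by []. Qed.

Lemma ae_sym u v : ae_equal Om u v -> ae_equal Om v u.
Proof. by apply: ae_mono => x h /h. Qed.

Lemma magnetic_sip : sip (form_domain Om A : X -> Prop) (magnetic_form Om A).
Proof.
have S := inner_sip mOm.
have addL2 e a u v : continuous a -> weakly_derivable e u -> weakly_derivable e v -> inL2 Om (mom e a u) -> inL2 Om (mom e a v) ->
    inL2 Om (mom e a (fun x => u x + v x)).
  move=> ca hu hv lu lv; apply: (inL2_ae mOm) (ae_sym (momD a hu hv)) _.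
    by apply: mom_cmeasurable => //; exact: weakly_derivableD.
  exact: inL2D.
have scaleL2 e a (c : R[i]) u : continuous a -> weakly_derivable e u -> inL2 Om (mom e a u) ->
    inL2 Om (mom e a (fun x => c * u x)).
  move=> ca hu lu; apply: (inL2_ae mOm) (ae_sym (momZ a c hu)) _.
    by apply: mom_cmeasurable => //; exact: weakly_derivableZ.
  exact: inL2Z.
split.
- move=> u v /form_domainP[? ? ? ? ?] /form_domainP[? ? ? ? ?]; apply/form_domainP; split.
  + exact: inL2D.
  + exact: weakly_derivableD.
  + exact: weakly_derivableD.
  + exact: addL2.
  + exact: addL2.
- move=> c u /form_domainP[? ? ? ? ?]; apply/form_domainP; split.
  + exact: inL2Z.
  + exact: weakly_derivableZ.
  + exact: weakly_derivableZ.
  + exact: scaleL2.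
  + exact: scaleL2.
- move=> u v w /form_domainP[_ u1 u2 mu1 mu2] /form_domainP[_ v1 v2 mv1 mv2] /form_domainP[_ _ _ mw1 mw2].
  rewrite !magnetic_formE (ae_inner mOm _ _ mw1 (momD a1 u1 v1)); last 2 first.
  + exact: addL2.
  + exact: inL2D.
  rewrite (ae_inner mOm _ _ mw2 (momD a2 u2 v2)); last 2 first.
  + exact: addL2.
  + exact: inL2D.
  have e1 := sip_ipDl S mu1 mv1 mw1; have e2 := sip_ipDl S mu2 mv2 mw2.
  rewrite -[X in X + _ = _]/(inner Om (mom (1, 0) a1 u + mom (1, 0) a1 v : X) _) e1.
  rewrite -[X in _ + X = _]/(inner Om (mom (0, 1) a2 u + mom (0, 1) a2 v : X) _) e2.
  by rewrite addrACA.
- move=> c u w /form_domainP[_ u1 u2 mu1 mu2] /form_domainP[_ _ _ mw1 mw2].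
  rewrite !magnetic_formE (ae_inner mOm _ _ mw1 (momZ a1 c u1)); last 2 first.
  + exact: scaleL2.
  + exact: inL2Z.
  rewrite (ae_inner mOm _ _ mw2 (momZ a2 c u2)); last 2 first.
  + exact: scaleL2.
  + exact: inL2Z.
  have e1 := sip_ipZl S c mu1 mw1; have e2 := sip_ipZl S c mu2 mw2.
  rewrite -[X in X + _ = _]/(inner Om (c *: mom (1, 0) a1 u : X) _) e1.
  rewrite -[X in _ + X = _]/(inner Om (c *: mom (0, 1) a2 u : X) _) e2.
  by rewrite mulrDr.
- move=> u v /form_domainP[_ _ _ mu1 mu2] /form_domainP[_ _ _ mv1 mv2].
  by rewrite !magnetic_formE conjcD -(sip_ipC S mu1 mv1) -(sip_ipC S mu2 mv2).
- move=> u /form_domainP[_ _ _ mu1 mu2]; rewrite magnetic_formE ReD.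
  by rewrite addr_ge0 //; exact: (sip_ge0 S).
Qed.

Definition cderive (x e : R * R) u (d : R[i]) :=
  is_derive x e (re u) (complex.Re d) /\ is_derive x e (im u) (complex.Im d).

Definition ccontinuous u := continuous (re u) /\ continuous (im u).

Lemma classical_form_domain u u1 u2 :
  (forall x, cderive x (1, 0) u (u1 x)) -> (forall x, cderive x (0, 1) u (u2 x)) ->
  ccontinuous u -> ccontinuous u1 -> ccontinuous u2 ->
  inL2 Om u -> inL2 Om (classical_mom a1 u1 u) -> inL2 Om (classical_mom a2 u2 u) ->
  form_domain Om A u /\ nsq (magnetic_form Om A : X -> X -> R[i]) u =
     nsq (inner Om : X -> X -> R[i]) (classical_mom a1 u1 u) +
     nsq (inner Om : X -> X -> R[i]) (classical_mom a2 u2 u).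
Proof.
move=> d1 d2 [cr ci] [cr1 ci1] [cr2 ci2] lu l1 l2.
have w1 : is_weak_deriv Om (1, 0) u u1.
  by apply: classical_weak_deriv => //; [left|move=> x; case: (d1 x)|move=> x; case: (d1 x)].
have w2 : is_weak_deriv Om (0, 1) u u2.
  by apply: classical_weak_deriv => //; [right|move=> x; case: (d2 x)|move=> x; case: (d2 x)].
have lloc : inL2loc Om u by apply/(inL2locP Om_open); split; exact: loc2_continuous.
have hu1 : weakly_derivable (1, 0) u by split=> //; exists u1.
have hu2 : weakly_derivable (0, 1) u by split=> //; exists u2.
have e1 := mom_ae a1 w1; have e2 := mom_ae a2 w2.
have m1 : inL2 Om (mom (1, 0) a1 u).
  by apply: (inL2_ae mOm) (ae_sym e1) l1; exact: mom_cmeasurable.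
have m2 : inL2 Om (mom (0, 1) a2 u).
  by apply: (inL2_ae mOm) (ae_sym e2) l2; exact: mom_cmeasurable.
split; first by apply/form_domainP.
rewrite /nsq /rip magnetic_formE ReD; congr (_ + _).
  rewrite (ae_inner mOm m1 l1 m1 e1) (sip_ipC (inner_sip mOm) m1 l1) ReJ.
  by rewrite (ae_inner mOm m1 l1 l1 e1).
rewrite (ae_inner mOm m2 l2 m2 e2) (sip_ipC (inner_sip mOm) m2 l2) ReJ.
by rewrite (ae_inner mOm m2 l2 l2 e2).
Qed.

Local Notation Hm := (magnetic_neumann Om A).
Local Notation ipO := (inner Om : X -> X -> R[i]).
Local Notation qO := (magnetic_form Om A : X -> X -> R[i]).
Local Notation grO := (@graph R X (inL2 Om : X -> Prop) (form_domain Om A : X -> Prop) ipO qO).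

Lemma zero_inL2 : inL2 Om (fun=> 0).
Proof.
apply/(inL2P mOm); have z : @sqint _ T2 R mu (Om : set T2) (cst 0).
  split=> //; rewrite (eq_integral (cst 0%E)) ?integral0 //.
  by move=> x _; rewrite /= expr0n.
by split.
Qed.

Lemma regular_resolvent (z : R) :
  regular (inL2 Om : X -> Prop) (form_domain Om A : X -> Prop) ipO qO z <->
  resolvent_set Om Hm (rc z).
Proof.
have E (u f : X) (M : R) : inL2 Om f -> Hm u (fun x => f x + rc z * u x) ->
    (sqnorm Om u <= M%:E * sqnorm Om f)%E <-> nsq ipO u <= M * nsq ipO f.
  move=> lf [Du _ _]; have lu : inL2 Om u by case/form_domainP: Du.
  by rewrite !(sqnorm_nsq mOm) // -EFinM lee_fin.
split=> -[surj [M HM]]; (split; first exact: surj); exists M => u f lf hu.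
  by apply/E => //; exact: HM.
by apply/(E u f M lf hu); exact: HM.
Qed.

Lemma orthonormal_independent n (u : 'I_n -> X) : (forall i, inL2 Om (u i)) ->
  orthonormal ipO u -> independent Om (u : 'I_n -> R * R -> R[i]).
Proof.
move=> Lu on c h i; have S := inner_sip mOm.
pose w : X := \sum_(i < n) c i *: u i.
have Lw : inL2 Om w by apply: (sip_sum S) => //; exists (fun=> 0); exact: zero_inL2.
have w0 : nsq ipO (w - (fun=> 0)) = 0.
  apply/(ae_nsq0 mOm) => //; first exact: zero_inL2.
  apply: ae_mono h => x h Ox; rewrite -[RHS](h Ox) /w.
  by elim/big_ind2 : _ => // f1 g1 f2 g2 <- <-.
have w0' : nsq ipO w = 0.
  have E : (w - (fun=> 0) : X) = w by apply/funext => x; rewrite /= [LHS]subr0.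
  by rewrite E in w0.
have := nsq0_ip S Lw (Lu i) w0'; rewrite (ip_suml S) // (bigD1 i) //= on eqxx mulr1.
by rewrite big1 ?addr0 // => j ji; rewrite on (negbTE ji) mulr0.
Qed.

Hypothesis disc : discrete_spectrum Om Hm.

Lemma multiplicity_ge n (u : 'I_n -> X) (z : R) : orthonormal ipO u ->
  (forall i, grO (u i) (rc z *: u i)) -> ((n%:R)%:E <= multiplicity Om Hm (rc z))%E.
Proof.
move=> on eig; apply: ereal_sup_ubound; exists n; split=> //; exists u; split=> //.
by apply: orthonormal_independent => // i; case: (eig i) => /form_domainP[].
Qed.

Lemma magnetic_spectral_family (s : R) : exists N (psi : 'I_N -> X) (m : 'I_N -> R),
  [/\ orthonormal ipO psi, forall i, grO (psi i) (rc (m i) *: psi i),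
      forall i, m i < s &
      forall f, form_domain Om A f -> (forall i, ipO f (psi i) = 0) -> s * nsq ipO f <= nsq qO f].
Proof.
apply: (spectral_family (inner_sip mOm) magnetic_sip).
- by move=> u /form_domainP[].
- move=> z nz; have sz : spectrum Om Hm (rc z) by move=> /regular_resolvent.
  have [[e e0 He] _ _] := disc sz; exists e => // w wz we.
  apply: contrapT => nw; have sw : spectrum Om Hm (rc w) by move=> /regular_resolvent.
  have : rc w = rc z.
    by apply: He => //; rewrite -realcB /= expr0n addr0 sqrtr_sqr.
  by move=> /(congr1 (@complex.Re R)) /= wz'; rewrite wz' eqxx in wz.
(* At a point of the spectrum, any number above the finite multiplicity is a bound; at a regular
   point there is not even one normalized eigenfunction. *)
- move=> z; case: (pselect (spectrum Om Hm (rc z))) => [/disc[_ _ fin]|/contrapT[_ [M HM]]].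
    exists (`|Num.ceil (fine (multiplicity Om Hm (rc z)))|.+1)%N => u eig on.
    have := multiplicity_ge on eig.
    have m0 : (0 <= multiplicity Om Hm (rc z))%E.
      apply: ereal_sup_ubound; exists 0%N; split=> //.
      by exists (fun=> cst 0); split=> [[]//|c _ []].
    have mf : multiplicity Om Hm (rc z) \is a fin_num.
      by rewrite ge0_fin_numE.
    rewrite -(fineK mf) lee_fin leNgt => /negP; apply.
    apply: le_lt_trans (ceil_ge _) _; apply: le_lt_trans (ler_norm _) _.
    by rewrite -intr_norm -natr_absz ltr_nat.
  exists 1%N => u eig on; have [Du _ _] := eig ord0.
  have lu : inL2 Om (u ord0) by case/form_domainP: Du.
  have := HM (u ord0) (fun=> 0) zero_inL2.
  rewrite (_ : (fun x => 0 + rc z * u ord0 x) = rc z *: u ord0); last first.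
    by apply/funext => x; rewrite add0r.
  move=> /(_ (eig ord0)); rewrite (sqnorm_nsq mOm lu) (sqnorm_nsq mOm zero_inL2).
  have -> : nsq ipO (fun=> 0) = 0.
    have := nsqZ (inner_sip mOm) 0 lu; rewrite /sqn /= expr0n /= addr0 mul0r => <-.
    by congr (nsq _ _); apply/funext => x; rewrite scale0r.
  by rewrite mule0 /nsq /rip on /= lee_fin ler10.
- exact: inner_complete.
Qed.

Lemma neg_pow_ge0 (g s : R) : 0 <= neg_pow g s.
Proof. by rewrite /neg_pow; case: ifP => _ //; exact: powR_ge0. Qed.

(** The trace runs over distinct values weighted by their multiplicities, so the family is grouped
    by eigenvalue; the orthonormal members of a group are independent and bound its multiplicity
    from below. *)
Lemma tr_neg_pow_ge N (psi : 'I_N -> X) (m : 'I_N -> R) (g l : R) :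
  orthonormal ipO psi -> (forall i, grO (psi i) (rc (m i) *: psi i)) ->
  ((\sum_(i < N) neg_pow g (m i - l))%:E <= tr_neg_pow Om Hm g l)%E.
Proof.
move=> on eig; pose S := undup [seq m i | i <- enum 'I_N].
have uS : uniq S by exact: undup_uniq.
have mS i : m i \in S by rewrite mem_undup; apply/mapP; exists i => //; rewrite mem_enum.
pose F x := neg_pow g (x - l).
have -> : \sum_(i < N) neg_pow g (m i - l) = \sum_(x <- S) F x * #|[pred i | m i == x]|%:R.
  transitivity (\sum_(i < N) \sum_(x <- S | x == m i) F x).
    apply: eq_bigr => i _; rewrite big_mkcond (bigD1_seq (m i)) //= eqxx.
    by rewrite big1 ?addr0 // => x /negbTE ->.
  rewrite (exchange_big_dep xpredT) //=; apply: eq_bigr => x _.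
  rewrite -sum1_card natr_sum mulr_sumr; apply: eq_big => [i|i _]; last by rewrite mulr1.
  by rewrite inE eq_sym.
apply: esum_ge; exists [set` S]; first by split; [exact: finite_seq|].
rewrite -fsbig_seq // -sumEFin; apply: lee_sum => x _.
rewrite EFinM; apply: lee_wpmul2l; first by rewrite lee_fin neg_pow_ge0.
pose e := [pred i | m i == x].
apply: (@multiplicity_ge _ (fun j : 'I_#|e| => psi (enum_val j))).
  by move=> i j; rewrite on (inj_eq enum_val_inj).
by move=> j; have := enum_valP j; rewrite inE => /eqP <-.
Qed.

End MagneticForm.

(** * Landau functions *)
Section LandauAlgebra.
Variable R : realType.
Implicit Types (z : R[i]) (k m n p : nat) (x e : R * R).

(** The matrix elements of the ladder operators. Since [rt 0] is 0, every term with the predecessor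
    of index 0 disappears. *)
Definition rt n : R[i] := rc (Num.sqrt n%:R).

Lemma rt0 : rt 0 = 0.
Proof. by rewrite /rt sqrtr0. Qed.

Lemma rt1 : rt 1 = 1.
Proof. by rewrite /rt sqrtr1. Qed.

Lemma cj_rt n : cj (rt n) = rt n.
Proof. exact: cj_rc. Qed.

Lemma rc_nat n : rc n%:R = n%:R :> R[i].
Proof. by elim: n => // n IH; rewrite -natr1 realcD IH -natr1. Qed.

Lemma sqr_rt n : rt n * rt n = n%:R.
Proof.
by rewrite /rt -realcMM -expr2 sqr_sqrtr ?ler0n // rc_nat.
Qed.

Lemma sqn_rt n : sqn (rt n) = n%:R.
Proof. by rewrite /sqn /= expr0n addr0 sqr_sqrtr ?ler0n. Qed.

Lemma rtS_neq0 n : rt n.+1 != 0.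
Proof.
apply/eqP => h; have := sqn_rt n.+1; rewrite h /sqn /= expr0n addr0 => /eqP.
by rewrite eq_sym pnatr_eq0.
Qed.

Lemma rtV n : rt n.+1 * (rt n.+1)^-1 = 1.
Proof. by rewrite divff ?rtS_neq0. Qed.

Definition gaussian (w : R[i]) : R := expR (- (sqn w / 2)).

(* In the coordinate w = sqrt (B / 2) (x1 + i x2), [landau 0 m] is w^m exp (- |w|^2 / 2)
   up to normalization, and the recursion applies the creation operator; for m = 0
   the junk index [m.-1] has coefficient 0. *)
Fixpoint landau k m (w : R[i]) : R[i] :=
  if k is l.+1 then (rt k)^-1 * (cj w * landau l m w - rt m * landau l m.-1 w)
  else \prod_(i < m) ((rt i.+1)^-1 * w) * rc (gaussian w).

Lemma landau_cj k m (w : R[i]) : cj w * landau k m w = rt k.+1 * landau k.+1 m w + rt m * landau k m.-1 w.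
Proof. by rewrite [landau k.+1 m w]/= mulrA rtV; ring. Qed.

(** Adjoint to [landau_cj]: where the conjugate of w raises the level or lowers the angular index, w
    lowers the level or raises the angular index. By induction on the level, commuting w with the
    recursion. *)
Lemma landau_mul k m (w : R[i]) : w * landau k m w = rt k * landau k.-1 m w + rt m.+1 * landau k m.+1 w.
Proof.
elim: k m => [|k IH] m.
  by rewrite rt0 mul0r add0r /= big_ord_recr /= -[LHS]mul1r -(rtV m); ring.
have W (j : nat) (a b : R[i]) : rt j.+1 * a = rt j.+1 * b -> a = b by apply: mulfI; exact: rtS_neq0.
apply: (W k); rewrite mulrCA -[landau k.+1 m w]/((rt k.+1)^-1 * (cj w * landau k m w - rt m * landau k m.-1 w)) [rt _ * (_ * (_ - _))]mulrA rtV mul1r.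
have -> : rt k.+1 * (rt k.+1 * landau k m w + rt m.+1 * landau k.+1 m.+1 w) =
   rt k.+1 * rt k.+1 * landau k m w + rt m.+1 * (rt k.+1 * landau k.+1 m.+1 w) by ring.
have -> : rt k.+1 * landau k.+1 m.+1 w = cj w * landau k m.+1 w - rt m.+1 * landau k m w.
  by rewrite landau_cj addrK.
rewrite mulrBr [w * (cj w * _)]mulrCA IH [w * (rt m * _)]mulrCA.
have -> : rt m * (w * landau k m.-1 w) = rt m * (rt k * landau k.-1 m.-1 w) + m%:R * landau k m w.
  case: m => [|m]; first by rewrite rt0 !mul0r add0r.
  by rewrite IH mulrDr [in X in _ = _ + X]/= -(sqr_rt m.+1); congr (_ + _); ring.
have -> : cj w * (rt k * landau k.-1 m w + rt m.+1 * landau k m.+1 w) =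
    k%:R * landau k m w + rt k * (rt m * landau k.-1 m.-1 w) + rt m.+1 * (cj w * landau k m.+1 w).
  rewrite mulrDr; congr (_ + _); last by ring.
  case: (k) => [|j]; first by rewrite rt0 !mul0r !mulr0 add0r.
  by rewrite -[j.+1.-1]/j mulrCA landau_cj -(sqr_rt j.+1); ring.
by rewrite mulrBr !mulrA !sqr_rt -!natr1; ring.
Qed.

Definition up k m (w : R[i]) := rt k.+1 * landau k.+1 m w.
Definition down k m (w : R[i]) := rt k * landau k.-1 m w.

Lemma is_derive_comp_real (F : R -> R) (f : R * R -> R) x e (dF d : R) :
  is_derive (f x) (1 : R) F dF -> is_derive x e f d ->
  is_derive x e (fun y => F (f y)) (dF * d).
Proof.
move=> hF /is_derive_line h; apply/is_derive_line.
have h1 : is_derive (f (0 *: e + x)) (1 : R) F dF by rewrite scale0r add0r.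
by have h2 := is_derive1_comp h1 h; exact: (is_derive_eq h2).
Qed.

Lemma cderive_eq x e u d d' : cderive x e u d -> d = d' -> cderive x e u d'.
Proof. by move=> h <-. Qed.

Lemma cderiveD x e u v du dv : cderive x e u du -> cderive x e v dv ->
  cderive x e (fun y => u y + v y) (du + dv).
Proof. move=> [ur ui] [vr vi]; split; [rewrite ReD|rewrite ImD].
  rewrite (_ : re _ = re u + re v); first exact: is_deriveD.
  by apply/funext => y; rewrite /re ReD.
rewrite (_ : im _ = im u + im v); first exact: is_deriveD.
by apply/funext => y; rewrite /im ImD. Qed.

Lemma cderiveM x e u v du dv : cderive x e u du -> cderive x e v dv ->
  cderive x e (fun y => u y * v y) (du * v x + u x * dv).
Proof.
move=> [ur ui] [vr vi].
have [eR eI] : re (fun y => u y * v y) = re u * re v - im u * im v /\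
  im (fun y => u y * v y) = re u * im v + im u * re v.
  by split; apply/funext => y; rewrite /re /im ?ReM ?ImM.
split.
  rewrite eR; have h := is_deriveB (is_deriveM ur vr) (is_deriveM ui vi).
  apply: (is_derive_eq h); rewrite /re /im ReD !ReM /GRing.scale /=; ring.
rewrite eI; have h := is_deriveD (is_deriveM ur vi) (is_deriveM ui vr).
apply: (is_derive_eq h); rewrite /re /im ImD !ImM /GRing.scale /=; ring.
Qed.

Lemma cderive_cst x e c : cderive x e (fun=> c) 0.
Proof. by split; exact: is_derive_cst. Qed.

Lemma cderiveZ x e (c : R[i]) u du : cderive x e u du -> cderive x e (fun y => c * u y) (c * du).
Proof.
move=> h; apply: cderive_eq (cderiveM (cderive_cst x e c) h) _.
by rewrite mul0r add0r.
Qed.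

Lemma cderiveN x e u du : cderive x e u du -> cderive x e (fun y => - u y) (- du).
Proof. by move=> h; have := cderiveZ (-1) h; rewrite mulN1r; under eq_fun do rewrite mulN1r. Qed.

Lemma cderiveB x e u v du dv : cderive x e u du -> cderive x e v dv ->
  cderive x e (fun y => u y - v y) (du - dv).
Proof. by move=> hu /cderiveN; exact: cderiveD. Qed.

Lemma cderiveJ x e u du : cderive x e u du -> cderive x e (fun y => cj (u y)) (cj du).
Proof.
move=> [ur ui]; split.
  by rewrite ReJ (_ : re _ = re u) //; apply/funext => y; rewrite /re ReJ.
rewrite ImJ (_ : im _ = - im u); first exact: is_deriveN.
by apply/funext => y; rewrite /im ImJ.
Qed.

Lemma cderive_sum (T : finType) x e (u : T -> R * R -> R[i]) (du : T -> R[i]) :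
  (forall i, cderive x e (u i) (du i)) -> cderive x e (fun y => \sum_(i : T) u i y) (\sum_(i : T) du i).
Proof.
move=> h; have -> : (fun y => \sum_(i : T) u i y) = \sum_(i : T) (u i : R * R -> R[i]^o).
  by apply/funext => y; rewrite fct_sumE.
elim/big_ind2 : _ => //; first exact: cderive_cst.
by move=> d1 u1 d2 u2 h1 h2; exact: cderiveD.
Qed.

Lemma cderive_real x e (f : R * R -> R) d : is_derive x e f d ->
  cderive x e (fun y => rc (f y)) (rc d).
Proof. by move=> h; split=> //; exact: is_derive_cst. Qed.

Lemma cderive_gaussian x e (w : R * R -> R[i]) w' : cderive x e w w' ->
  cderive x e (fun y => rc (gaussian (w y))) (- (2^-1 * (cj (w x) * w' + w x * cj w')) * rc (gaussian (w x))).
Proof.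
move=> [hr hi].
pose g := fun y => - ((re w y * re w y + im w y * im w y) * 2^-1).
have E : (fun y => rc (gaussian (w y))) = (fun y => rc (expR (g y))).
  by apply/funext => y; rewrite /gaussian /g /sqn !expr2.
have hg : is_derive x e g (- ((re w x * complex.Re w' + im w x * complex.Im w'))).
  have h := is_deriveN (is_deriveM (is_deriveD (is_deriveM hr hr) (is_deriveM hi hi)) (is_derive_cst (2^-1 : R) x e)).
  by apply: (is_derive_eq h); rewrite /= /GRing.scale /=; field.
rewrite E; apply: cderive_eq (cderive_real (is_derive_comp_real (is_derive_expR (g x)) hg)) _.
have -> : gaussian (w x) = expR (g x) by rewrite /gaussian /g /sqn !expr2.
rewrite realcMM mulrC; congr (_ * _); rewrite realcN; congr (- _).
have -> : cj (w x) * w' + w x * cj w' = rc (2 * (re w x * complex.Re w' + im w x * complex.Im w')).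
  by apply: complex_eqP; rewrite ?ReD ?ImD ?ReM ?ImM ?ReJ ?ImJ /re /im /=; ring.
have -> : (2^-1 : R[i]) = rc 2^-1.
  by apply: (@mulfI _ 2); rewrite ?pnatr_eq0 // mulfV ?pnatr_eq0 // -(rc_nat 2) -realcMM mulfV ?pnatr_eq0.
by rewrite -realcMM mulrA mulVf ?pnatr_eq0 // mul1r.
Qed.

(* [f], [fp], [fm] play the roles of a function of [w] and of its images under the two
   Landau level shifts: d f = (cj w / 2 f - fp) dw + (fm - w / 2 f) d(cj w). *)
Definition ladder (f fp fm : R[i] -> R[i]) := forall x e (w : R * R -> R[i]) w', cderive x e w w' ->
  cderive x e (fun y => f (w y)) ((2^-1 * cj (w x) * f (w x) - fp (w x)) * w' +
    (fm (w x) - 2^-1 * w x * f (w x)) * cj w').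

Lemma ladderZ c f fp fm : ladder f fp fm ->
  ladder (fun w => c * f w) (fun w => c * fp w) (fun w => c * fm w).
Proof. move=> hf x e w w' h; apply: cderive_eq (cderiveZ c (hf _ _ _ _ h)) _; ring. Qed.

Lemma ladder_sum (T : finType) (f fp fm : T -> R[i] -> R[i]) :
  (forall i, ladder (f i) (fp i) (fm i)) ->
  ladder (fun w => \sum_(i : T) f i w) (fun w => \sum_(i : T) fp i w) (fun w => \sum_(i : T) fm i w).
Proof.
move=> h x e w w' hw; apply: cderive_eq (cderive_sum (fun i => h i _ _ _ _ hw)) _.
rewrite !mulr_sumr -!sumrB !mulr_suml -big_split /=; apply: eq_bigr => i _; ring.
Qed.

(** At the lowest level by induction on m through the factor w; the next levels by differentiating
    the recursion, where [landau_cj] converts each product with the conjugate of w. *)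
Lemma ladder_landau k m : ladder (landau k m) (up k m) (down k m).
Proof.
elim: k m => [|k IH] m.
  elim: m => [|m IH].
    move=> x e w w' h; rewrite /up /down rt0 rt1 /= !big_ord0 rt0 rt1 invr1.
    have -> : (fun y => \prod_(i < 0) ((rt i.+1)^-1 * w y) * rc (gaussian (w y))) = fun y => rc (gaussian (w y)).
      by apply/funext => y; rewrite big_ord0 mul1r.
    by apply: cderive_eq (cderive_gaussian h) _; field.
  move=> x e w w' h.
  have -> : (fun y => landau 0 m.+1 (w y)) = fun y => ((rt m.+1)^-1 * w y) * landau 0 m (w y).
    by apply/funext => y; rewrite /= big_ord_recr /=; ring.
  apply: cderive_eq (cderiveM (cderiveZ (rt m.+1)^-1 h) (IH _ _ _ _ h)) _.
  rewrite /down rt0 !mul0r !sub0r /up rt1 !mul1r.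
  have e1 n : landau 1 n (w x) = cj (w x) * landau 0 n (w x) - rt n * landau 0 n.-1 (w x).
    by rewrite [LHS]/= rt1 invr1 mul1r.
  have e2 : landau 0 m.+1 (w x) = (rt m.+1)^-1 * w x * landau 0 m (w x).
    by rewrite /= big_ord_recr /=; ring.
  have e3 : (rt m.+1)^-1 * w x * (rt m * landau 0 m.-1 (w x)) =
     (rt m.+1)^-1 * m%:R * landau 0 m (w x).
    case: m {IH e1 e2} => [|m]; first by rewrite rt0; ring.
    rewrite [in RHS]/= big_ord_recr /= -(sqr_rt m.+1).
    transitivity ((rt m.+2)^-1 * w x * (\prod_(i < m) ((rt i.+1)^-1 * w x) * rc (gaussian (w x))) * rt m.+1); first by ring.
    by rewrite -[LHS]mul1r -(rtV m); ring.
  rewrite !e1 e2 /= !mulrBl !mulrDr.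
  have e4 : (rt m.+1)^-1 * landau 0 m (w x) + (rt m.+1)^-1 * m%:R * landau 0 m (w x) = rt m.+1 * landau 0 m (w x).
    transitivity ((rt m.+1)^-1 * (m%:R + 1) * landau 0 m (w x)); first by ring.
    by rewrite natr1 -(sqr_rt m.+1) [_^-1 * _]mulrC -[rt m.+1 * rt m.+1 / _]mulrA rtV mulr1.
  rewrite -[landau 0 m (w x)]/(\prod_(i < m) ((rt i.+1)^-1 * w x) * rc (gaussian (w x))) in e3 e4.
  have : (rt m.+1)^-1 * (\prod_(i < m) ((rt i.+1)^-1 * w x) * rc (gaussian (w x))) =
    rt m.+1 * (\prod_(i < m) ((rt i.+1)^-1 * w x) * rc (gaussian (w x))) -
    (rt m.+1)^-1 * w x * (rt m * landau 0 m.-1 (w x)) by rewrite e3 -e4; ring.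
  move=> e5.
  have -> : (rt m.+1)^-1 * w' * (\prod_(i < m) ((rt i.+1)^-1 * w x) * rc (gaussian (w x))) =
    ((rt m.+1)^-1 * (\prod_(i < m) ((rt i.+1)^-1 * w x) * rc (gaussian (w x)))) * w' by ring.
  by rewrite e5 -[\prod_(i < m.-1) _ * _]/(landau 0 m.-1 (w x)); ring.
move=> x e w w' h.
apply: cderive_eq (cderiveZ (rt k.+1)^-1 (cderiveB (cderiveM (cderiveJ h) (IH m _ _ _ _ h)) (cderiveZ (rt m) (IH m.-1 _ _ _ _ h)))) _.
rewrite /up /down [k.+1.-1]/=.
have cancel a b : rt k.+1 * a = rt k.+1 * b -> a = b by apply: mulfI; exact: rtS_neq0.
set W := w x; apply: (cancel); rewrite mulrA rtV mul1r.
have d1 : rt k.+2 * landau k.+2 m W = cj W * landau k.+1 m W - rt m * landau k.+1 m.-1 W by rewrite landau_cj addrK.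
have d2 : rt k.+1 * landau k.+1 m W = cj W * landau k m W - rt m * landau k m.-1 W by rewrite landau_cj addrK.
have d3 : rt k.+1 * rt k.+1 = k%:R + 1 by rewrite sqr_rt natr1.
have d4 : cj W * (rt k * landau k.-1 m W) = k%:R * landau k m W + rt m * (rt k * landau k.-1 m.-1 W).
  case: k {IH cancel d1 d2 d3} => [|k]; first by rewrite rt0; ring.
  by rewrite -[k.+1.-1]/k mulrCA landau_cj -(sqr_rt k.+1); ring.
have d5 : rt k.+1 * landau k.+1 m.-1 W = cj W * landau k m.-1 W - rt m.-1 * landau k m.-1.-1 W by rewrite landau_cj addrK.
transitivity ((2^-1 * cj W * (cj W * landau k m W - rt m * landau k m.-1 W)
     - (cj W * (rt k.+1 * landau k.+1 m W) - rt m * (rt k.+1 * landau k.+1 m.-1 W))) * w' +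
   (landau k m W + (cj W * (rt k * landau k.-1 m W) - rt m * (rt k * landau k.-1 m.-1 W)) -
     2^-1 * W * (cj W * landau k m W - rt m * landau k m.-1 W)) * cj w'); first ring.
rewrite d4 -d2.
transitivity ((2^-1 * cj W * (rt k.+1 * landau k.+1 m W) - rt k.+1 * (rt k.+2 * landau k.+2 m W)) * w' +
  (rt k.+1 * rt k.+1 * landau k m W - 2^-1 * W * (rt k.+1 * landau k.+1 m W)) * cj w').
  by rewrite d1 d3; ring.
ring.
Qed.

End LandauAlgebra.

(** * Rapidly decreasing functions of the complex coordinate *)

Section NiceFunctions.
Variable R : realType.
Notation R' := (measurableTypeR R).
Notation T2 := (R' * R')%type.
Local Notation mu := (leb2 R).
Notation X := (R * R -> R[i]^o : lmodType R[i]).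
Implicit Types (u v w : R * R -> R[i]) (f g : R[i] -> R[i]) (k m n p : nat) (x e : R * R).

Lemma ccontinuousD u v : ccontinuous u -> ccontinuous v -> ccontinuous (fun x => u x + v x).
Proof.
move=> [ur ui] [vr vi]; split.
  rewrite (_ : re _ = fun x => re u x + re v x); last by apply/funext => x; rewrite /re ReD.
  by move=> x; apply: continuousD; [exact: ur|exact: vr].
rewrite (_ : im _ = fun x => im u x + im v x); last by apply/funext => x; rewrite /im ImD.
by move=> x; apply: continuousD; [exact: ui|exact: vi].
Qed.

Lemma ccontinuousM u v : ccontinuous u -> ccontinuous v -> ccontinuous (fun x => u x * v x).
Proof.
move=> [ur ui] [vr vi]; split.
  rewrite (_ : re _ = fun x => re u x * re v x - im u x * im v x); last first.
    by apply/funext => x; rewrite /re /im ReM.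
  by move=> x; apply: cvgB; apply: cvgM; [exact: ur|exact: vr|exact: ui|exact: vi].
rewrite (_ : im _ = fun x => re u x * im v x + im u x * re v x); last first.
  by apply/funext => x; rewrite /re /im ImM.
by move=> x; apply: cvgD; apply: cvgM; [exact: ur|exact: vi|exact: ui|exact: vr].
Qed.

Lemma ccontinuousJ u : ccontinuous u -> ccontinuous (fun x => cj (u x)).
Proof.
move=> [ur ui]; split.
  by rewrite (_ : re _ = re u) //; apply/funext => x; rewrite /re ReJ.
rewrite (_ : im _ = fun x => - im u x); last by apply/funext => x; rewrite /im ImJ.
by move=> x; apply: continuousN; exact: ui.
Qed.

Lemma ccontinuous_cst c : ccontinuous (fun=> c : R[i]).
Proof. by split=> x; exact: cst_continuous. Qed.

Lemma ccontinuous_real (a : R * R -> R) : continuous a -> ccontinuous (fun x => rc (a x)).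
Proof. by move=> ca; split=> // x; exact: cst_continuous. Qed.

Lemma ccontinuous_gaussian u : ccontinuous u -> ccontinuous (fun x => rc (gaussian (u x))).
Proof.
move=> [ur ui]; apply: ccontinuous_real => x; rewrite /gaussian /sqn.
under eq_fun do rewrite !expr2.
apply: (@continuous_comp _ _ _ (fun x => - ((re u x * re u x + im u x * im u x) / 2)) expR).
  apply: continuousN; apply: continuousM; last exact: cst_continuous.
  by apply: cvgD; apply: cvgM; [exact: ur|exact: ur|exact: ui|exact: ui].
exact: continuous_expR.
Qed.

(* Continuity is stated along curves to avoid a topology on R[i]. *)
Definition nice f := (forall u, ccontinuous u -> ccontinuous (fun x => f (u x))) /\
  forall p, exists C : R, forall z, sqn z ^+ p * sqn (f z) <= C * gaussian z.

Lemma gaussian_gt0 (z : R[i]) : 0 < gaussian z.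
Proof. exact: expR_gt0. Qed.

Lemma gaussian_le1 (z : R[i]) : gaussian z <= 1.
Proof. by rewrite -expR0 ler_expR oppr_le0 divr_ge0 ?sqn_ge0. Qed.

Lemma niceD f g : nice f -> nice g -> nice (fun z => f z + g z).
Proof.
move=> [cf bf] [cg bg]; split=> [u cu|p]; first by apply: ccontinuousD; [exact: cf|exact: cg].
have [C hC] := bf p; have [D hD] := bg p; exists (2 * C + 2 * D) => z.
have := ler_wpM2l (exprn_ge0 p (sqn_ge0 z)) (sqnD_le (f z) (g z)).
have := hC z; have := hD z; lra.
Qed.

Lemma niceM f g : nice f -> nice g -> nice (fun z => f z * g z).
Proof.
move=> [cf bf] [cg bg]; split=> [u cu|p]; first by apply: ccontinuousM; [exact: cf|exact: cg].
have [C hC] := bf p; have [D hD] := bg 0; exists (C * D) => z; rewrite sqnM mulrA.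
have C0 : 0 <= C by rewrite -(pmulr_lge0 _ (gaussian_gt0 z)); apply: le_trans (hC z); rewrite mulr_ge0 ?exprn_ge0 ?sqn_ge0.
have gD : sqn (g z) <= D.
  have := hD z; rewrite expr0 mul1r => h; apply: le_trans h _.
  have D0 : 0 <= D by rewrite -(pmulr_lge0 _ (gaussian_gt0 z)); apply: le_trans (hD z); rewrite mulr_ge0 ?exprn_ge0 ?sqn_ge0.
  by rewrite ler_piMr // gaussian_le1.
rewrite [leRHS]mulrAC; apply: ler_pM => //; last exact: sqn_ge0.
by rewrite mulr_ge0 ?exprn_ge0 ?sqn_ge0.
Qed.

Lemma niceZ c f : nice f -> nice (fun z => c * f z).
Proof.
move=> [cf bf]; split=> [u cu|p].
  by apply: ccontinuousM; [exact: ccontinuous_cst|exact: cf].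
have [C hC] := bf p; exists (sqn c * C) => z; rewrite sqnM mulrCA -mulrA.
by apply: ler_wpM2l => //; exact: sqn_ge0.
Qed.

Lemma nice_var f : nice f -> nice (fun z => z * f z).
Proof.
move=> [cf bf]; split=> [u cu|p]; first by apply: ccontinuousM => //; exact: cf.
by have [C hC] := bf p.+1; exists C => z; rewrite sqnM mulrA -exprSr.
Qed.

Lemma nice_cvar f : nice f -> nice (fun z => cj z * f z).
Proof.
move=> [cf bf]; split=> [u cu|p]; first by apply: ccontinuousM; [exact: ccontinuousJ|exact: cf].
by have [C hC] := bf p.+1; exists C => z; rewrite sqnM sqnJ mulrA -exprSr.
Qed.

Lemma niceJ f : nice f -> nice (fun z => cj (f z)).
Proof.
move=> [cf bf]; split=> [u cu|p]; first by apply: ccontinuousJ; exact: cf.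
by have [C hC] := bf p; exists C => z; rewrite sqnJ.
Qed.

Lemma nice0 : nice (fun=> 0).
Proof.
split=> [u cu|p]; first exact: ccontinuous_cst.
by exists 0 => z; rewrite mul0r (_ : sqn 0 = 0) ?mulr0 // /sqn /= expr0n /= addr0.
Qed.

Lemma nice_sum (T : finType) (f : T -> R[i] -> R[i]) :
  (forall i, nice (f i)) -> nice (fun z => \sum_(i : T) f i z).
Proof.
move=> h; have -> : (fun z => \sum_(i : T) f i z) = \sum_(i : T) (f i : R[i] -> R[i]^o).
  by apply/funext => y; rewrite fct_sumE.
elim/big_ind : _ => //; first exact: nice0.
by move=> f1 f2 h1 h2; exact: niceD.
Qed.

(** The squared modulus contains two Gaussian factors: one remains as the bound, the other absorbs
    the power by y^p <= p! exp y at y = |z|^2 / 2. *)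
Lemma nice_gaussian : nice (fun z => rc (gaussian z)).
Proof.
split=> [u cu|p]; first exact: ccontinuous_gaussian.
exists (2 ^+ p * p`!%:R) => z; rewrite /sqn /= expr0n addr0 expr2 mulrA -/(sqn z).
apply: ler_wpM2r; first exact/ltW/gaussian_gt0.
have y0 : 0 <= sqn z / 2 by rewrite divr_ge0 ?sqn_ge0.
rewrite /gaussian expRN ler_pdivrMr ?expR_gt0 //.
case: p => [|p].
  by rewrite expr0 mul1r fact0 mul1r; apply: le_trans (expR_ge1Dx _); rewrite lerDl.
have := expR_ge1Dxn p y0; rewrite -mulrA -ler_pdivrMl ?exprn_gt0 //.
have f0 : (0 : R) < p.+1`!%:R by rewrite ltr0n fact_gt0.
rewrite -ler_pdivrMl // mulrC expr_div_n => h; apply: le_trans h.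
by rewrite [_^-1 * sqn z ^+ _]mulrC lerDr.
Qed.

Lemma nice_landau k m : nice (landau k m).
Proof.
elim: k m => [|k IH] m.
  elim: m => [|m IH].
    rewrite (_ : landau 0 0 = fun z : R[i] => rc (gaussian z)); first exact: nice_gaussian.
    by apply/funext => z; rewrite /= big_ord0 mul1r.
  have h := niceZ (rt R m.+1)^-1 (nice_var IH).
  rewrite (_ : landau 0 m.+1 = fun z : R[i] => (rt R m.+1)^-1 * (z * landau 0 m z)) //.
  by apply/funext => z; rewrite /= big_ord_recr /=; ring.
have h := niceZ (rt R k.+1)^-1 (niceD (nice_cvar (IH m)) (niceZ (- rt R m) (IH m.-1))).
rewrite (_ : landau k.+1 m = fun z => (rt R k.+1)^-1 * (cj z * landau k m z + - rt R m * landau k m.-1 z)) //.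
by apply/funext => z; rewrite mulNr.
Qed.

Lemma nice_up k m : nice (up k m).
Proof. by apply: niceZ; exact: nice_landau. Qed.

Lemma nice_down k m : nice (down k m).
Proof. by apply: niceZ; exact: nice_landau. Qed.

Lemma sqr_bound (t C : R) : t ^+ 2 <= C -> `|t| <= 1 + C.
Proof.
rewrite -real_normK ?num_real // => h; apply: le_trans (_ : 1 + `|t| ^+ 2 <= _); last by rewrite lerD2l.
have := sqr_ge0 (`|t| - 2^-1); nra.
Qed.

Definition cintegrable u := mu.-integrable [set: T2] (EFin \o re u) /\ mu.-integrable [set: T2] (EFin \o im u).

Lemma cintD u v : cintegrable u -> cintegrable v ->
  cintegral setT (fun x => u x + v x) = cintegral setT u + cintegral setT v.
Proof.
move=> [ur ui] [vr vi]; apply: complex_eqP; rewrite /cintegral /=.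
  rewrite -(@RintegralD _ T2 R mu setT (re u) (re v)) //.
  by congr (Rintegral _ _ _); apply/funext => x; rewrite ReD.
rewrite -(@RintegralD _ T2 R mu setT (im u) (im v)) //.
by congr (Rintegral _ _ _); apply/funext => x; rewrite ImD.
Qed.

Lemma integrable_cZ (c : R) (f : T2 -> R) : mu.-integrable [set: T2] (EFin \o f) ->
  mu.-integrable [set: T2] (EFin \o (fun x => c * f x)).
Proof. by move=> h; have := integrableZl measurableT c h. Qed.

Lemma cintZ (c : R[i]) u : cintegrable u ->
  cintegral setT (fun x => c * u x) = c * cintegral setT u.
Proof.
move=> [ur ui]; apply: complex_eqP; rewrite ?ReM ?ImM /cintegral /=.
  rewrite -!(@RintegralZl _ T2 R mu setT) // -(@RintegralB _ T2 R mu setT) //; try exact: integrable_cZ.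
  by congr (Rintegral _ _ _); apply/funext => x; rewrite ReM.
rewrite -!(@RintegralZl _ T2 R mu setT) // -(@RintegralD _ T2 R mu setT) //; try exact: integrable_cZ.
by congr (Rintegral _ _ _); apply/funext => x; rewrite ImM.
Qed.

Lemma cintegrableD u v : cintegrable u -> cintegrable v -> cintegrable (fun x => u x + v x).
Proof.
move=> [ur ui] [vr vi]; split.
  rewrite (_ : _ \o _ = ((EFin \o re u) \+ (EFin \o re v))%E); first exact: integrableD.
  by apply/funext => x; rewrite /= /re ReD.
rewrite (_ : _ \o _ = ((EFin \o im u) \+ (EFin \o im v))%E); first exact: integrableD.
by apply/funext => x; rewrite /= /im ImD.
Qed.

Lemma cintegrableZ (c : R[i]) u : cintegrable u -> cintegrable (fun x => c * u x).
Proof.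
move=> [ur ui]; split.
  rewrite (_ : _ \o _ = ((EFin \o (fun x => (complex.Re c * re u x)%R)) \- (EFin \o (fun x => (complex.Im c * im u x)%R)))%E).
    by apply: integrableB => //; exact: integrable_cZ.
  by apply/funext => x; rewrite /= /re ReM.
rewrite (_ : _ \o _ = ((EFin \o (fun x => (complex.Re c * im u x)%R)) \+ (EFin \o (fun x => (complex.Im c * re u x)%R)))%E).
  by apply: integrableD => //; exact: integrable_cZ.
by apply/funext => x; rewrite /= /im ImM.
Qed.

Lemma inL2_cintegrable u v : inL2 setT u -> inL2 setT v -> cintegrable (fun x => u x * cj (v x)).
Proof.
move=> /(inL2P measurableT)[ur ui] /(inL2P measurableT)[vr vi]; split.
  rewrite (_ : _ \o _ = ((EFin \o (fun x => (re u x * re v x)%R)) \+ (EFin \o (fun x => (im u x * im v x)%R)))%E).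
    by apply: integrableD => //; exact: sqint_mul.
  by apply/funext => x; rewrite /= /re ReM ReJ ImJ mulrN opprK.
rewrite (_ : _ \o _ = ((EFin \o (fun x => (im u x * re v x)%R)) \- (EFin \o (fun x => (re u x * im v x)%R)))%E).
  by apply: integrableB => //; exact: sqint_mul.
by apply/funext => x; rewrite /= /im ImM ReJ ImJ mulrN addrC.
Qed.

Lemma decay_cvg (a : R ^nat) (C : R) : (forall n, `|a n| * (1 + n%:R ^+ 2) <= C) -> a @ \oo --> 0.
Proof.
move=> h; have C0 : 0 <= C by apply: le_trans (h 0); rewrite mulr_ge0 // addr_ge0 // sqr_ge0.
have b n : `|a n| <= 2 * C * harmonic n.
  have p0 : (0 : R) < 1 + n%:R ^+ 2 by rewrite ltr_pwDl // sqr_ge0.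
  rewrite /harmonic /= ler_pdivlMr ?ltr0Sn //; have := h n; have := normr_ge0 (a n).
  have : (n.+1%:R : R) <= 2 * (1 + n%:R ^+ 2).
    by rewrite -natr1; have := sqr_ge0 (n%:R - 2^-1 : R); nra.
  nra.
apply/norm_cvg0P; apply: (@squeeze_cvgr _ _ _ _ (cst 0) (fun n => 2 * C * harmonic n)).
- by apply: nearW => n; rewrite /= normr_ge0 b.
- exact: cvg_cst.
- by rewrite -[X in _ --> X](mulr0 (2 * C)); apply: cvgMr; exact: cvg_harmonic.
Qed.

(** Quadratic decay takes the place of compact support in removing the boundary terms at
    infinity. *)
Lemma plane_decay0 e (F F' : R * R -> R) (C : R) : e = (1, 0) \/ e = (0, 1) ->
  (forall x, is_derive x e F (F' x)) -> continuous F' ->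
  mu.-integrable [set: T2] (EFin \o F') ->
  (forall x, `|F x| * (1 + (x.1 ^+ 2 + x.2 ^+ 2)) <= C) -> (\int[mu]_x (F' x)%:E = 0)%E.
Proof.
move=> he dF cF' iF' bF.
have C0 : 0 <= C by apply: le_trans (bF (0, 0)); rewrite mulr_ge0 // addr_ge0 // addr_ge0 // sqr_ge0.
have le_bF x n : n%:R ^+ 2 <= x.1 ^+ 2 + x.2 ^+ 2 -> `|F x| * (1 + n%:R ^+ 2) <= C.
  by move=> h; apply: le_trans (bF x); apply: ler_wpM2l => //; rewrite lerD2l.
have cv (a b : R ^nat) : (forall n, `|a n| * (1 + n%:R ^+ 2) <= C) ->
    (forall n, `|b n| * (1 + n%:R ^+ 2) <= C) -> (fun n => a n - b n) @ \oo --> 0.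
  move=> ha hb; apply: (@decay_cvg _ (C + C)) => n.
  apply: le_trans (lerD (ha n) (hb n)); rewrite -mulrDl ler_wpM2r ?addr_ge0 ?sqr_ge0 //.
  exact: ler_normB.
case: he => he; subst e.
  apply: (@integral_plane_derive0_1 R F F') => //.
    by move=> x y; exact: is_derive_slice1.
  move=> y; apply: cv => n; apply: le_bF; rewrite /= ?sqrrN lerDl sqr_ge0 //.
apply: (@integral_plane_derive0_2 R F F') => //.
  by move=> x y; exact: is_derive_slice2.
by move=> y; apply: cv => n; apply: le_bF; rewrite /= ?sqrrN lerDr sqr_ge0.
Qed.

Definition aff (om al : R[i]) x : R[i] := om * (x.1 +i* x.2) + al.

Lemma ccontinuous_aff om al : ccontinuous (aff om al).
Proof.
apply: ccontinuousD; last exact: ccontinuous_cst.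
apply: ccontinuousM; first exact: ccontinuous_cst.
by split=> x; [exact: cvg_fst|exact: cvg_snd].
Qed.

Lemma cderive_aff1 om al x : cderive x (1, 0) (aff om al) om.
Proof.
have h : cderive x (1, 0) (fun x => x.1 +i* x.2) (1 : R[i]).
  split; apply/is_derive_line.
    rewrite (_ : (fun t : R => _) = fun t => t * 1 + x.1) //.
    by apply: is_derive_eq; rewrite /GRing.scale /=; ring.
  rewrite (_ : (fun t : R => _) = fun t => t * 0 + x.2) //.
  by apply: is_derive_eq; rewrite /GRing.scale /=; ring.
by apply: cderive_eq (cderiveD (cderiveZ om h) (cderive_cst x (1, 0) al)) _; rewrite addr0 mulr1.
Qed.

Lemma cderive_aff2 om al x : cderive x (0, 1) (aff om al) (om * 'i).
Proof.
have h : cderive x (0, 1) (fun x => x.1 +i* x.2) ('i%C : R[i]).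
  split; apply/is_derive_line.
    rewrite (_ : (fun t : R => _) = fun t => t * 0 + x.1) //.
    by apply: is_derive_eq; rewrite /GRing.scale /=; ring.
  rewrite (_ : (fun t : R => _) = fun t => t * 1 + x.2) //.
  by apply: is_derive_eq; rewrite /GRing.scale /=; ring.
by apply: cderive_eq (cderiveD (cderiveZ om h) (cderive_cst x (0, 1) al)) _; rewrite addr0.
Qed.

End NiceFunctions.

(** * Orthonormality of the Landau functions *)

Section LandauBasis.
Variable R : realType.
Notation R' := (measurableTypeR R).
Notation T2 := (R' * R')%type.
Local Notation mu := (leb2 R).
Notation X := (R * R -> R[i]^o : lmodType R[i]).
Implicit Types (u v w : R * R -> R[i]) (f g : R[i] -> R[i]) (k m n p l : nat) (x e : R * R).

(** The product of two centred normal densities of variance 1 / (2 b). *)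
Lemma gauss_plane (b : R) : 0 < b ->
  (\int[mu]_x (b / pi * expR (- (b * (x.1 ^+ 2 + x.2 ^+ 2))))%:E = 1)%E.
Proof.
move=> b0; pose s : R := (Num.sqrt (2 * b))^-1.
have s0 : s != 0 by rewrite invr_neq0 // gt_eqF // sqrtr_gt0 mulr_gt0.
have s2 : s ^+ 2 = (2 * b)^-1 by rewrite exprVn sqr_sqrtr // mulr_ge0 // ltW.
pose P := normal_pdf (0 : R) s.
have PE t : P t = Num.sqrt (b / pi) * expR (- (b * t ^+ 2)).
  rewrite /P normal_pdfE // /normal_peak /normal_fun s2 subr0; congr (_ * expR _).
    rewrite -sqrtrV; last by rewrite mulrn_wge0 // mulr_ge0 ?pi_ge0 // invr_ge0 mulr_ge0 // ltW.
    have -> : (2 * b)^-1 * pi *+ 2 = pi / b by rewrite -(mulr_natl ((2 * b)^-1 * pi)); field; rewrite gt_eqF.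
    by rewrite invf_div.
  by rewrite -mulr_natl; field; rewrite gt_eqF.
have iP : (\int[lebesgue_measure]_t (P t)%:E = 1)%E by exact: integral_normal_pdf.
have mP : measurable_fun [set: R'] (P : R' -> R) by exact: measurable_normal_pdf.
have P0 t : 0 <= P t by exact: normal_pdf_ge0.
transitivity (\int[mu]_x (P x.1 * P x.2)%:E)%E.
  apply: eq_integral => x _; rewrite !PE mulrACA -expr2 sqr_sqrtr; last first.
    by rewrite divr_ge0 ?pi_ge0 ?ltW.
  by rewrite -expRD mulrDr opprD.
have m2 : measurable_fun [set: T2] (fun x : T2 => (P x.1 * P x.2)%:E).
  apply/measurable_EFinP; apply: measurable_funM.
    exact: (measurableT_comp mP measurable_fst).
  exact: (measurableT_comp mP measurable_snd).
rewrite (@fubini_tonelli1 _ _ R' R' R lebesgue_measure lebesgue_measure (fun x => (P x.1 * P x.2)%:E)) //; last first.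
  by move=> x; rewrite lee_fin mulr_ge0.
rewrite -[RHS]iP; apply: eq_integral => t _; rewrite /fubini_F /=.
under eq_integral do rewrite EFinM.
rewrite ge0_integralZl_EFin //; first by rewrite iP mule1.
- by move=> y _; rewrite lee_fin.
- exact/measurable_EFinP.
Qed.

Lemma gauss_plane_integrable (b : R) : 0 < b ->
  mu.-integrable [set: T2] (EFin \o (fun x => expR (- (b * (x.1 ^+ 2 + x.2 ^+ 2))))).
Proof.
move=> b0; have c : continuous (fun x : R * R => expR (- (b * (x.1 ^+ 2 + x.2 ^+ 2)))).
  under eq_fun do rewrite !expr2.
  move=> x; apply: (@continuous_comp _ _ _ (fun x : R * R => - (b * (x.1 * x.1 + x.2 * x.2))) expR); last exact: continuous_expR.
  apply: cvgN; apply: cvgM; first exact: cvg_cst.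
  by apply: cvgD; apply: cvgM; [exact: cvg_fst|exact: cvg_fst|exact: cvg_snd|exact: cvg_snd].
have m0 : measurable_fun [set: T2] (fun x : T2 => expR (- (b * (x.1 ^+ 2 + x.2 ^+ 2)))).
  exact: (@continuous2_measurable R setT).
have h : mu.-integrable [set: T2] (EFin \o (fun x : T2 => b / pi * expR (- (b * (x.1 ^+ 2 + x.2 ^+ 2))))).
  apply: integrable_nonneg => //.
  - by apply: measurable_funM.
  - by move=> x _; rewrite mulr_ge0 ?expR_ge0 // divr_ge0 ?pi_ge0 ?ltW.
  - by rewrite gauss_plane // ltry.
have := integrable_cZ (pi / b) h; congr (_.-integrable _ _); apply/funext => x /=.
by rewrite mulrA -invf_div mulVf ?mul1r // mulf_neq0 ?invr_neq0 ?gt_eqF ?pi_gt0.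
Qed.

Variable B : R.
Hypothesis B_gt0 : 0 < B.

(** The scale for which |w|^2 = B |x|^2 / 2; the constant [c0] that follows gives the lowest Landau
    function unit norm. *)
Let s : R := Num.sqrt (B / 2).
Let c0 : R := Num.sqrt (B / (2 * pi)).

Lemma s_sqr : s ^+ 2 = B / 2.
Proof. by rewrite sqr_sqrtr // divr_ge0 // ltW. Qed.

Lemma s_gt0 : 0 < s.
Proof. by rewrite sqrtr_gt0 divr_gt0. Qed.

Lemma c0_sqr : c0 ^+ 2 = B / (2 * pi).
Proof. by rewrite sqr_sqrtr // divr_ge0 ?mulr_ge0 ?pi_ge0 // ltW. Qed.

Definition lcoord := aff (rc s) 0.
Definition on_plane f x : R[i] := rc c0 * f (lcoord x).

Lemma sqn_lcoord x : sqn (lcoord x) = B / 2 * (x.1 ^+ 2 + x.2 ^+ 2).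
Proof. by rewrite /lcoord /aff addr0 sqnM /sqn /= expr0n addr0 s_sqr. Qed.

Lemma sqn_rc (t : R) : sqn (rc t) = t ^+ 2.
Proof. by rewrite /sqn /= expr0n addr0. Qed.

Lemma realcV (t : R) : rc t^-1 = (rc t)^-1.
Proof.
have [->|t0] := eqVneq t 0; first by rewrite !invr0 (_ : rc 0 = 0) // invr0.
have rt0 : rc t != 0 by apply/eqP => /(congr1 (@complex.Re R)) /= /eqP; rewrite (negbTE t0).
by apply: (mulfI rt0); rewrite -realcMM !mulfV.
Qed.

Lemma ccontinuous_on_plane f : nice f -> ccontinuous (on_plane f).
Proof.
move=> [cf _]; apply: ccontinuousM; first exact: ccontinuous_cst.
by apply: cf; exact: ccontinuous_aff.
Qed.

Lemma sqr_re_sqn (z : R[i]) : complex.Re z ^+ 2 <= sqn z.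
Proof. by rewrite lerDl sqr_ge0. Qed.

Lemma sqr_im_sqn (z : R[i]) : complex.Im z ^+ 2 <= sqn z.
Proof. by rewrite lerDr sqr_ge0. Qed.

Lemma gaussian_lcoord_integrable :
  mu.-integrable [set: T2] (EFin \o (fun x => gaussian (lcoord x))).
Proof.
have b4 : 0 < B / 4 by rewrite divr_gt0.
have := gauss_plane_integrable b4; congr (_.-integrable _ _); apply/funext => x /=.
by rewrite /gaussian sqn_lcoord; congr (expR _)%:E; field.
Qed.

Lemma on_plane_inL2 f : nice f -> inL2 setT (on_plane f).
Proof.
move=> nf; have [cr ci] := ccontinuous_on_plane nf; have [_ bf] := nf; have [C hC] := bf 0.
have iC := integrable_cZ (c0 ^+ 2 * C) gaussian_lcoord_integrable.
have le x : sqn (on_plane f x) <= c0 ^+ 2 * C * gaussian (lcoord x).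
  rewrite /on_plane sqnM sqn_rc -mulrA; apply: ler_wpM2l; first exact: sqr_ge0.
  by have := hC (lcoord x); rewrite expr0 mul1r.
have key (h : R * R -> R) : continuous h -> (forall x, h x ^+ 2 <= sqn (on_plane f x)) -> l2 setT h.
  move=> ch hle; apply: integrable_sqint => //; first exact: (@continuous2_measurable R setT).
  apply: integrable_le iC => //.
    apply: measurable_funX; exact: (@continuous2_measurable R setT).
  by move=> x _; rewrite ger0_norm ?sqr_ge0 //; apply: le_trans (hle x) (le x).
apply/(inL2P measurableT); split; apply: key => // x.
  exact: sqr_re_sqn.
exact: sqr_im_sqn.
Qed.

Lemma on_planeD f g : on_plane (fun z => f z + g z) = (on_plane f : X) + on_plane g.
Proof. by apply/funext => x; rewrite /on_plane mulrDr. Qed.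

Lemma on_planeZ (c : R[i]) f : on_plane (fun z => c * f z) = c *: (on_plane f : X).
Proof. by apply/funext => x; rewrite /on_plane mulrCA. Qed.

Lemma on_plane_sum (T : finType) (f : T -> R[i] -> R[i]) :
  on_plane (fun z => \sum_(i : T) f i z) = \sum_(i : T) (on_plane (f i) : X).
Proof. by apply/funext => x; rewrite /on_plane mulr_sumr fct_sumE. Qed.

Local Notation ip := (inner setT : X -> X -> R[i]).
Let S : sip (inL2 setT : X -> Prop) ip := inner_sip measurableT.

Lemma plane_cderive0 e u u' (C : R) : e = (1, 0) \/ e = (0, 1) ->
  (forall x, cderive x e u (u' x)) -> ccontinuous u' -> cintegrable u' ->
  (forall x, sqn (u x) * (1 + (x.1 ^+ 2 + x.2 ^+ 2)) ^+ 2 <= C) -> cintegral setT u' = 0.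
Proof.
move=> he du [cr ci] [ir ii] b; rewrite /cintegral /Rintegral.
have bd (h : R * R -> R) x : h x ^+ 2 <= sqn (u x) -> `|h x| * (1 + (x.1 ^+ 2 + x.2 ^+ 2)) <= 1 + C.
  move=> hx; have p0 : 0 <= 1 + (x.1 ^+ 2 + x.2 ^+ 2) by rewrite !addr_ge0 ?sqr_ge0.
  rewrite -[1 + (_ + _)]ger0_norm // -normrM; apply: sqr_bound; rewrite exprMn.
  by apply: le_trans (b x); apply: ler_wpM2r => //; rewrite sqr_ge0.
have h1 : (\int[mu]_x (re u' x)%:E = 0)%E.
  apply: (@plane_decay0 R e (re u) (re u') (1 + C)) => // x; first by case: (du x).
  by apply: bd; exact: sqr_re_sqn.
have h2 : (\int[mu]_x (im u' x)%:E = 0)%E.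
  apply: (@plane_decay0 R e (im u) (im u') (1 + C)) => // x; first by case: (du x).
  by apply: bd; exact: sqr_im_sqn.
by move: h1 h2; rewrite /re /im => -> ->.
Qed.

Lemma nice_decay f : nice f ->
  exists C : R, forall x, sqn (f (lcoord x)) * (1 + (x.1 ^+ 2 + x.2 ^+ 2)) ^+ 2 <= C.
Proof.
move=> [_ bf]; have [C hC] := bf 0; have [D hD] := bf 2.
have k z (p : nat) (E : R) : (sqn z ^+ p * sqn (f z) <= E * gaussian z) -> sqn z ^+ p * sqn (f z) <= E.
  move=> h; apply: le_trans (h) _.
  have : 0 <= E * gaussian z by apply: le_trans h; rewrite mulr_ge0 ?exprn_ge0 ?sqn_ge0.
  by rewrite (pmulr_lge0 _ (gaussian_gt0 z)) => E0; rewrite ler_piMr // gaussian_le1.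
exists (2 * C + 2 * (2 / B) ^+ 2 * D) => x; set z := lcoord x.
have h1 := k z _ _ (hC z); have h2 := k z _ _ (hD z).
rewrite expr0 mul1r in h1.
have -> : x.1 ^+ 2 + x.2 ^+ 2 = 2 / B * sqn z by rewrite sqn_lcoord; field; rewrite gt_eqF.
have t0 := sqn_ge0 (f z).
have := sqr_ge0 (1 - 2 / B * sqn z) => h3.
have h4 : (1 + 2 / B * sqn z) ^+ 2 <= 2 + 2 * (2 / B) ^+ 2 * sqn z ^+ 2.
  by have -> : 2 * (2 / B) ^+ 2 * sqn z ^+ 2 = 2 * (2 / B * sqn z) ^+ 2; [ring|nra].
apply: le_trans (ler_wpM2l t0 h4) _.
have h5 := ler_wpM2l (mulr_ge0 (ler0n R 2) (sqr_ge0 (2 / B))) h2.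
rewrite mulrDr; apply: lerD; first by rewrite mulrC; apply: ler_wpM2l.
by apply: le_trans h5; rewrite mulrC -!mulrA.
Qed.

(* Integration by parts of (d1 - i d2) (f * cj g). *)
Lemma ladder_adjoint f fp fm g gp gm : ladder f fp fm -> ladder g gp gm ->
  nice f -> nice fp -> nice fm -> nice g -> nice gp -> nice gm ->
  ip (on_plane fp) (on_plane g) = ip (on_plane f) (on_plane gm).
Proof.
move=> lf lg nf nfp nfm ng ngp ngm.
pose u x := on_plane f x * cj (on_plane g x).
pose P x := - (on_plane fp x * cj (on_plane g x)) + on_plane f x * cj (on_plane gm x).
pose Q x := on_plane fm x * cj (on_plane g x) + - (on_plane f x * cj (on_plane gp x)).
have iP a b : nice a -> nice b -> cintegrable (fun x => on_plane a x * cj (on_plane b x)).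
  by move=> na nb; apply: inL2_cintegrable; exact: on_plane_inL2.
have cP a b : nice a -> nice b -> ccontinuous (fun x => on_plane a x * cj (on_plane b x)).
  by move=> na nb; apply: ccontinuousM; [|apply: ccontinuousJ]; exact: ccontinuous_on_plane.
have NE a : (fun x => - a x) = (fun x => -1 * a x) :> (R * R -> R[i]).
  by apply/funext => x; rewrite mulN1r.
have iN a : cintegrable a -> cintegrable (fun x => - a x).
  by move=> ha; rewrite NE; exact: cintegrableZ.
have cN a : ccontinuous a -> ccontinuous (fun x => - a x).
  by move=> ha; rewrite NE; apply: ccontinuousM => //; exact: ccontinuous_cst.
have intN a : cintegrable a -> cintegral setT (fun x => - a x) = - cintegral setT a.
  by move=> ha; rewrite NE cintZ // mulN1r.
have iPP : cintegrable P by apply: cintegrableD; [apply: iN|]; exact: iP.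
have iQ : cintegrable Q by apply: cintegrableD; [|apply: iN]; exact: iP.
have cPP : ccontinuous P by apply: ccontinuousD; [apply: cN|]; exact: cP.
have cQ : ccontinuous Q by apply: ccontinuousD; [|apply: cN]; exact: cP.
have du e om x : cderive x e lcoord om -> cderive x e u (om * P x + cj om * Q x).
  move=> h; have hf := cderiveZ (rc c0) (lf _ _ _ _ h).
  have hg := cderiveJ (cderiveZ (rc c0) (lg _ _ _ _ h)).
  apply: cderive_eq (cderiveM hf hg) _; rewrite /P /Q /on_plane.
  move: (lcoord x) => z; rewrite !conjcM !conjcD !conjcM !conjcD !conjcN !conjcM !cj_rc.
  have -> : cj (2^-1 : R[i]) = 2^-1.
    by rewrite -(rc_nat R 2) -realcV cj_rc.
  rewrite !cjK; ring.
have [C hC] := nice_decay (niceZ (rc c0 * rc c0) (niceM nf (niceJ ng))).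
have bu x : sqn (u x) * (1 + (x.1 ^+ 2 + x.2 ^+ 2)) ^+ 2 <= C.
  apply: le_trans (hC x); rewrite le_eqVlt; apply/orP; left; apply/eqP; congr (sqn _ * _).
  by rewrite /u /on_plane conjcM cj_rc; ring.
have c1 : cintegral setT (fun x => rc s * P x + cj (rc s) * Q x) = 0.
  apply: (@plane_cderive0 (1, 0) u _ C) => //; first by left.
  - by move=> x; apply: du; exact: cderive_aff1.
  - by apply: ccontinuousD; apply: ccontinuousM => //; exact: ccontinuous_cst.
  - by apply: cintegrableD; exact: cintegrableZ.
have c2 : cintegral setT (fun x => rc s * 'i%C * P x + cj (rc s * 'i%C) * Q x) = 0.
  apply: (@plane_cderive0 (0, 1) u _ C) => //; first by right.
  - by move=> x; apply: du; exact: cderive_aff2.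
  - by apply: ccontinuousD; apply: ccontinuousM => //; exact: ccontinuous_cst.
  - by apply: cintegrableD; exact: cintegrableZ.
move: c1 c2; rewrite !cintD ?cintZ //; try exact: cintegrableZ.
rewrite conjcM !cj_rc cj_imaginary.
set a := cintegral setT P; set b := cintegral setT Q => c1 c2.
have ia : a = - ip (on_plane fp) (on_plane g) + ip (on_plane f) (on_plane gm).
  by rewrite /a /P cintD ?intN //; [exact: iP|exact: iN (iP _ _ _ _)|exact: iP].
have s0 : rc s != 0.
  by apply/eqP => /(congr1 (@complex.Re R)) /= /eqP; rewrite gt_eqF // s_gt0.
have a0 : a = 0.
  apply/eqP; have : rc s * (2 * a) = 0.
    transitivity ((rc s * a + rc s * b) - 'i%C * (rc s * 'i%C * a + rc s * - 'i%C * b)).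
      transitivity (rc s * a + rc s * b - ('i%C * 'i%C) * (rc s * (a - b))); last by ring.
      by rewrite imaginary_sqr; ring.
    by rewrite c1 c2; ring.
  by move/eqP; rewrite !mulf_eq0 (negbTE s0) pnatr_eq0.
by move: ia; rewrite a0 => /esym/eqP; rewrite addrC subr_eq0 => /eqP.
Qed.

Let J k m l n := ip (on_plane (landau k m)) (on_plane (landau l n)).

Let plL k m : inL2 setT (on_plane (landau k m)).
Proof. by apply: on_plane_inL2; exact: nice_landau. Qed.

Lemma J_conj k m l n : J k m l n = cj (J l n k m).
Proof. by rewrite /J -(sip_ipC S). Qed.

(** [ladder_adjoint] for two Landau functions: raising the level on one side is lowering it on the
    other. *)
Lemma J_level k m l n : rt R k.+1 * J k.+1 m l n = rt R l * J k m l.-1 n.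
Proof.
have := ladder_adjoint (@ladder_landau R k m) (@ladder_landau R l n) (nice_landau R k m) (nice_up R k m)
  (nice_down R k m) (nice_landau R l n) (nice_up R l n) (nice_down R l n).
rewrite /up /down (on_planeZ (rt R k.+1) (landau k.+1 m)) (on_planeZ (rt R l) (landau l.-1 n)).
by rewrite (sip_ipZl S (rt R k.+1) (plL k.+1 m) (plL l n)) (ipZr S (rt R l) (plL k m) (plL l.-1 n)) cj_rt.
Qed.

(** Multiplication by w is adjoint to multiplication by its conjugate. After expansion of both sides
    the terms that shift the level agree by [J_level], and those that shift the angular index are
    left. *)
Lemma J_angular k m l n : rt R m.+1 * J k m.+1 l n = rt R n * J k m l n.-1.
Proof.
have e1 : ip (on_plane (fun z => z * landau k m z)) (on_plane (landau l n)) = ip (on_plane (landau k m)) (on_plane (fun z => cj z * landau l n z)).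
  rewrite /inner; congr cintegral; apply/funext => x; rewrite /on_plane -!/(cj _) !conjcM.
  by rewrite cjK; ring.
have E1 : (fun z : R[i] => z * landau k m z) = fun z => rt R k * landau k.-1 m z + rt R m.+1 * landau k m.+1 z.
  by apply/funext => z; exact: landau_mul.
have E2 : (fun z : R[i] => cj z * landau l n z) = fun z => rt R l.+1 * landau l.+1 n z + rt R n * landau l n.-1 z.
  by apply/funext => z; exact: landau_cj.
move: e1; rewrite E1 E2 (on_planeD (fun z => rt R k * landau k.-1 m z)) (on_planeD (fun z => rt R l.+1 * landau l.+1 n z)).
rewrite (on_planeZ (rt R k) (landau k.-1 m)) (on_planeZ (rt R m.+1) (landau k m.+1)) (on_planeZ (rt R l.+1) (landau l.+1 n)) (on_planeZ (rt R n) (landau l n.-1)).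
have LZ c (F : X) : inL2 setT F -> inL2 setT (c *: F) by exact: (sip_scale S).
have L1 a b (F G H : X) : inL2 setT F -> inL2 setT G -> inL2 setT H ->
    ip (a *: F + b *: G) H = a * ip F H + b * ip G H.
  by move=> hF hG hH; rewrite (sip_ipDl S (LZ a F hF) (LZ b G hG) hH) (sip_ipZl S a hF hH) (sip_ipZl S b hG hH).
have L2 a b (F G H : X) : inL2 setT F -> inL2 setT G -> inL2 setT H ->
    ip H (a *: F + b *: G) = cj a * ip H F + cj b * ip H G.
  by move=> hF hG hH; rewrite (ipDr S hH (LZ a F hF) (LZ b G hG)) (ipZr S a hH hF) (ipZr S b hH hG).
rewrite (L1 _ _ _ _ _ (plL k.-1 m) (plL k m.+1) (plL l n)) (L2 _ _ _ _ _ (plL l.+1 n) (plL l n.-1) (plL k m)) !cj_rt.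
rewrite -!/(J _ _ _ _).
have -> : rt R l.+1 * J k m l.+1 n = rt R k * J k.-1 m l n.
  rewrite (J_conj k m) -[rt R l.+1]cj_rt -conjcM J_level conjcM cj_rt.
  by rewrite -J_conj.
by move/addrI.
Qed.

Lemma J00 : J 0 0 0 0 = 1.
Proof.
have b2 : 0 < B / 2 by rewrite divr_gt0.
have E x : on_plane (landau 0 0) x * cj (on_plane (landau 0 0) x) = rc (B / 2 / pi * expR (- (B / 2 * (x.1 ^+ 2 + x.2 ^+ 2)))).
  rewrite mulJ /on_plane /= big_ord0 mul1r sqnM !sqn_rc c0_sqr /gaussian sqn_lcoord -expRM_natl.
  by congr (rc (_ * expR _)); [rewrite invfM mulrA|field].
rewrite /J /inner /cintegral; apply: complex_eqP => /=.
  have -> : Rintegral mu setT (fun x => complex.Re (on_plane (landau 0 0) x * cj (on_plane (landau 0 0) x))) =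
      Rintegral mu setT (fun x => B / 2 / pi * expR (- (B / 2 * (x.1 ^+ 2 + x.2 ^+ 2)))).
    by congr Rintegral; apply/funext => x; rewrite E.
  by rewrite /Rintegral gauss_plane.
have -> : Rintegral mu setT (fun x => complex.Im (on_plane (landau 0 0) x * cj (on_plane (landau 0 0) x))) = Rintegral mu setT (fun=> 0).
  by congr Rintegral; apply/funext => x; rewrite E.
by rewrite /Rintegral integral0.
Qed.

(** The two recursions lower both levels, then both angular indices, together. If one index reaches
    0 before its partner, the coefficient [rt 0] annihilates the product; otherwise [J00]
    remains. *)
Lemma landau_orthonormal k m l n : ip (on_plane (landau k m)) (on_plane (landau l n)) = ((k == l) && (m == n))%:R.
Proof.
rewrite -/(J k m l n).
have cancel j (a b : R[i]) : rt R j.+1 * a = rt R j.+1 * b -> a = b by apply: mulfI; exact: rtS_neq0.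
elim: k l => [|k IH] [|l].
- elim: m n => [|m IH] [|n].
  + exact: J00.
  + by rewrite J_conj -[RHS]cj0; congr cj; apply: (cancel n); rewrite J_angular rt0 mul0r mulr0.
  + by apply: (cancel m); rewrite J_angular rt0 mul0r mulr0.
  + have h : rt R m.+1 * J 0 m.+1 0 n.+1 = rt R n.+1 * J 0 m 0 n by rewrite J_angular.
    have [mn|mn] := eqVneq m n; first by move: h; rewrite IH mn !eqxx => /(cancel n).
    rewrite eqSS (negbTE mn) /=; move: h; rewrite IH (negbTE mn) mulr0 -(mulr0 (rt R m.+1)).
    exact: (cancel m).
- by rewrite J_conj -[RHS]cj0; congr cj; apply: (cancel l); rewrite J_level rt0 mul0r mulr0.
- by apply: (cancel k); rewrite J_level rt0 mul0r mulr0.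
have h : rt R k.+1 * J k.+1 m l.+1 n = rt R l.+1 * J k m l n by rewrite J_level.
rewrite eqSS; have [kl|kl] := eqVneq k l; first by move: h; rewrite IH kl eqxx => /(cancel l).
by apply: (cancel k); rewrite h IH (negbTE kl) !mulr0.
Qed.

End LandauBasis.

(** * The sum over the angular index of the squared moduli *)

Section LandauDensity.
Variable R : realType.
Implicit Types (z : R[i]) (k m n p l M : nat).

Lemma sqn_landau0 m z : sqn (landau 0 m z) = sqn z ^+ m / m`!%:R * expR (- sqn z).
Proof.
rewrite /= sqnM sqn_rc /gaussian -expRM_natl; congr (_ * expR _); last by field.
elim: m => [|m IH]; first by rewrite big_ord0 fact0 divr1 /sqn /= expr0n addr0 expr1n.
rewrite big_ord_recr /= sqnM IH sqnM factS natrM exprS invfM.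
have -> : sqn (rt R m.+1)^-1 = (m.+1%:R)^-1.
  have h : sqn (rt R m.+1)^-1 * m.+1%:R = 1.
    by rewrite -sqn_rt -sqnM mulVf ?rtS_neq0 // /sqn /= expr1n expr0n addr0.
  by apply: (@mulIf _ m.+1%:R); rewrite ?pnatr_eq0 // h mulVf ?pnatr_eq0.
by ring.
Qed.

Lemma exp_partial_le (y : R) n : 0 <= y -> \sum_(0 <= m < n) y ^+ m / m`!%:R <= expR y.
Proof.
move=> y0; have := @nondecreasing_cvgn_le R (series (exp_coeff y)) _ (is_cvg_series_exp_coeff y) n.
apply; apply: nondecreasing_series => m _ _; exact: exp_coeff_ge0.
Qed.

(** At the lowest level this is the factorial in the Poisson weight. One level more costs a factor
    M, absorbed by using the previous bound at 2 t, since M <= 2^M. *)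
Lemma landau_decay k (t : R) z : 1 <= t -> exists C : R, forall M, t ^+ M * sqn (landau k M z) <= C.
Proof.
elim: k t => [|k IH] t t1.
  exists (expR (t * sqn z)) => M; rewrite sqn_landau0.
  have ty : 0 <= t * sqn z by rewrite mulr_ge0 ?sqn_ge0 // (le_trans ler01).
  apply: le_trans (exp_partial_le M.+1 ty).
  rewrite big_nat_recr //= mulrA mulrA -exprMn; apply: le_trans (_ : (t * sqn z) ^+ M / M`!%:R <= _).
    apply: ler_piMr; first by rewrite divr_ge0 ?exprn_ge0.
    by rewrite -expR0 ler_expR oppr_le0 sqn_ge0.
  by rewrite lerDr sumr_ge0 // => i _; rewrite divr_ge0 ?exprn_ge0.
have [C hC] := IH t t1; have [D hD] := IH (2 * t) ltac:(lra).
have t0 : 0 <= t by lra.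
have k0 : (0 : R) < k.+1%:R by rewrite ltr0n.
exists (2 / k.+1%:R * (sqn z * C + 2 * t * D)) => M.
have e : k.+1%:R * sqn (landau k.+1 M z) = sqn (cj z * landau k M z - rt R M * landau k M.-1 z).
  by rewrite -(sqn_rt R k.+1) -sqnM landau_cj addrK.
have h1 : k.+1%:R * sqn (landau k.+1 M z) <= 2 * (sqn z * sqn (landau k M z) + M%:R * sqn (landau k M.-1 z)).
  rewrite e; apply: le_trans (sqnD_le _ _) _; rewrite -[- (_ * _)]mulN1r !sqnM sqnJ sqn_rt.
  rewrite (_ : sqn (-1) = 1); last by rewrite /sqn /= oppr0 expr0n addr0 sqrrN expr1n.
  by rewrite mul1r -mulrDr.
have h2 : t ^+ M * (M%:R * sqn (landau k M.-1 z)) <= 2 * t * D.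
  case: M {h1 e} => [|M].
    by rewrite mul0r mulr0 !mulr_ge0 //; apply: le_trans (hD 0); rewrite mulr_ge0 ?sqn_ge0 ?exprn_ge0 ?mulr_ge0.
  rewrite -[M.+1.-1]/M; apply: le_trans (_ : 2 * t * ((2 * t) ^+ M * sqn (landau k M z)) <= _); last first.
    by apply: ler_wpM2l => //; rewrite mulr_ge0.
  rewrite !mulrA -exprS exprMn [2 ^+ M.+1 * _]mulrC; apply: ler_wpM2r; first exact: sqn_ge0.
  apply: ler_wpM2l; first exact: exprn_ge0.
  by rewrite -natrX ler_nat ltnW // ltn_expl.
have h3 := ler_wpM2l (exprn_ge0 M t0) h1.
rewrite -(ler_pM2l k0) mulrCA; apply: le_trans h3 _.
rewrite [leRHS]mulrA [k.+1%:R * _]mulrCA divff ?gt_eqF // mulr1 mulrCA ler_wpM2l // mulrDr.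
by apply: lerD => //; rewrite mulrCA ler_wpM2l ?sqn_ge0.
Qed.

Definition landau_sum k M z : R := \sum_(m < M) sqn (landau k m z).

(* [cj z * landau k m] and [z * landau k.+1 m] expand in the same products, so that
   the difference of the sums over two consecutive levels telescopes. *)
Definition landau_flux k M z : R :=
  complex.Re ((rt R k.+1)^-1 * (rt R M * landau k M.-1 z * cj (landau k.+1 M z))).

Lemma landau_sumS k M z : landau_sum k M.+1 z = landau_sum k M z + sqn (landau k M z).
Proof. by rewrite /landau_sum big_ord_recr. Qed.

Lemma landau_sum_step k M z : landau_sum k.+1 M z = landau_sum k M z + landau_flux k M z.
Proof.
elim: M => [|M IH].
  by rewrite /landau_sum !big_ord0 /landau_flux rt0 !mul0r mulr0 add0r.
rewrite !landau_sumS IH -[LHS]addrA -[RHS]addrA; congr (_ + _).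
have e1 : rc (sqn (landau k.+1 M z)) =
   (rt R k.+1)^-1 * ((cj z * landau k M z - rt R M * landau k M.-1 z) * cj (landau k.+1 M z)).
  by rewrite -mulJ {1}[landau k.+1 M z]/((rt R k.+1)^-1 * (cj z * landau k M z - rt R M * landau k M.-1 z)) mulrA.
have e2 : cj z * cj (landau k.+1 M z) = rt R k.+1 * cj (landau k M z) + rt R M.+1 * cj (landau k.+1 M.+1 z).
  by rewrite -conjcM landau_mul -[k.+1.-1]/k conjcD !conjcM !cj_rt.
rewrite -(Re_rc (sqn (landau k.+1 M z))) -(Re_rc (sqn (landau k M z))) /landau_flux -!ReD; congr complex.Re.
rewrite e1 -mulrDr -[M.+1.-1]/M -mulJ.
transitivity ((rt R k.+1)^-1 * (landau k M z * (cj z * cj (landau k.+1 M z)))); first by congr (_ * _); ring.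
rewrite e2 mulrDr mulrDr; congr (_ + _); last by congr (_ * _); ring.
by rewrite [landau k M z * (rt _ _ * _)]mulrCA [LHS]mulrA mulVf ?rtS_neq0 // mul1r.
Qed.

Lemma landau_flux_cvg k z : (fun M => landau_flux k M z) @ \oo --> 0.
Proof.
(* 32 is 2 * 4^2: the bound wanted is for 4^M times the flux, whose square brings 4^(2 M) and a
   factor M <= 2^M. Then 4^M dominates 1 + M^2. *)
have [C hC] := landau_decay k z (lexx 1); have [D hD] := @landau_decay k.+1 32 z ltac:(lra).
have C0 : 0 <= C by apply: le_trans (hC 0); rewrite mulr_ge0 ?sqn_ge0 ?exprn_ge0.
have D0 : 0 <= D by apply: le_trans (hD 0); rewrite mulr_ge0 ?sqn_ge0 ?exprn_ge0.
have q0 := sqn_ge0 (rt R k.+1)^-1.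
apply: (@decay_cvg _ _ (1 + sqn (rt R k.+1)^-1 * (C * D))) => M.
apply: le_trans (_ : `|landau_flux k M z| * 4 ^+ M <= _).
  apply: ler_wpM2l => //; apply: le_trans (_ : (1 + M%:R) ^+ 2 <= _).
    by rewrite sqrrD expr1n lerD2r lerDl mulrn_wge0 // mulr_ge0.
  rewrite (_ : (4 : R) ^+ M = (2 ^+ M) ^+ 2); last by rewrite -exprM mulnC exprM expr2 -natrM.
  rewrite lerXn2r ?nnegrE ?addr_ge0 ?exprn_ge0 //.
  by rewrite -natrX addrC natr1 ler_nat ltn_expl.
rewrite -(ger0_norm (exprn_ge0 M (ler0n R 4))) -normrM; apply: sqr_bound; rewrite exprMn.
apply: le_trans (_ : sqn ((rt R k.+1)^-1 * (rt R M * landau k M.-1 z * cj (landau k.+1 M z))) * (4 ^+ M) ^+ 2 <= _).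
  by apply: ler_wpM2r; [exact: sqr_ge0|exact: sqr_re_sqn].
rewrite !sqnM sqnJ sqn_rt -mulrA; apply: ler_wpM2l => //.
have hC' := hC M.-1; rewrite expr1n mul1r in hC'.
rewrite mulrAC mulrC mulrA.
rewrite [leLHS](_ : _ = sqn (landau k M.-1 z) * (M%:R * (4 ^+ M) ^+ 2 * sqn (landau k.+1 M z))); last by ring.
apply: ler_pM => //; [exact: sqn_ge0|by rewrite !mulr_ge0 ?sqn_ge0 ?exprn_ge0|].
apply: le_trans (hD M); apply: ler_wpM2r; first exact: sqn_ge0.
rewrite -exprM mulnC exprM (_ : (32 : R) ^+ M = 2 ^+ M * (4 ^+ 2) ^+ M); last first.
  by rewrite -exprMn; congr (_ ^+ _); rewrite -natrX -natrM.
by apply: ler_wpM2r; [rewrite !exprn_ge0|rewrite -natrX ler_nat ltnW // ltn_expl].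
Qed.

(** The exponential series at the lowest level; passing to the next level adds the flux, which tends
    to 0. *)
Lemma landau_sum_cvg k z : (fun M => landau_sum k M z) @ \oo --> (1 : R).
Proof.
elim: k => [|k IH].
  have -> : (fun M => landau_sum 0 M z) = fun M => series (exp_coeff (sqn z)) M * expR (- sqn z).
    apply/funext => M; rewrite /landau_sum /series /= big_mkord mulr_suml.
    by apply: eq_bigr => m _; rewrite sqn_landau0.
  rewrite -(expRxMexpNx_1 (sqn z)); apply: cvgMl; exact: is_cvg_series_exp_coeff.
have -> : (fun M => landau_sum k.+1 M z) = (fun M => landau_sum k M z) + (fun M => landau_flux k M z).
  by apply/funext => M; rewrite landau_sum_step.
by rewrite -[1]addr0; apply: cvgD => //; exact: landau_flux_cvg.
Qed.

Lemma landau_sum_nd k z : {homo (fun M => landau_sum k M z) : M N / (M <= N)%N >-> M <= N}.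
Proof.
move=> M N MN; rewrite /landau_sum -!(big_mkord xpredT (fun m => sqn (landau k m z))).
by rewrite (@big_cat_nat _ _ _ M 0 N) //= lerDl sumr_ge0 // => i _; exact: sqn_ge0.
Qed.

(* Chernoff's bound for the Poisson weights [sqn z ^+ m / m! * expR (- sqn z)]. *)
Lemma landau_sum_tail (t : R) J z : 1 <= t ->
  1 - expR ((t - 1) * sqn z) / t ^+ J <= landau_sum 0 J z.
Proof.
move=> t1; have t0 : 0 < t by lra.
have b0 : 0 <= expR ((t - 1) * sqn z) / t ^+ J by rewrite divr_ge0 ?expR_ge0 ?exprn_ge0 // ltW.
rewrite lerBlDr -[leLHS](cvg_lim _ (landau_sum_cvg 0 z)) //.
apply: limr_le; first exact: cvgP (landau_sum_cvg 0 z).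
apply: nearW => M; have [JM|MJ] := leqP J M; last first.
  by apply: le_trans (landau_sum_nd 0 z (ltnW MJ)) _; rewrite lerDl.
rewrite /landau_sum -!(big_mkord xpredT (fun m => sqn (landau 0 m z))) (@big_cat_nat _ _ _ J 0 M) //= lerD2l.
rewrite ler_pdivlMr ?exprn_gt0 // mulr_suml.
have ty : 0 <= t * sqn z by rewrite mulr_ge0 ?sqn_ge0 // ltW.
apply: le_trans (_ : expR (t * sqn z) * expR (- sqn z) <= _); last by rewrite -expRD mulrBl mul1r.
apply: le_trans (ler_wpM2r (expR_ge0 _) (exp_partial_le M ty)); rewrite mulr_suml.
rewrite [leRHS](@big_cat_nat _ _ _ J 0 M) //=.
apply: ler_wpDl; first by rewrite sumr_ge0 // => i _; rewrite mulr_ge0 ?expR_ge0 // divr_ge0 ?exprn_ge0.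
rewrite !big_nat; apply: ler_sum => m /andP[Jm _].
rewrite sqn_landau0 mulrAC; apply: ler_wpM2r; first exact: expR_ge0.
rewrite mulrAC; apply: ler_wpM2r; first by rewrite invr_ge0.
rewrite exprMn mulrC; apply: ler_wpM2r; first by rewrite exprn_ge0 ?sqn_ge0.
by apply: ler_weXn2l.
Qed.

End LandauDensity.

(** * Magnetic translations and the energy on a moved domain *)

Section GaugePullback.
Variable R : realType.
Notation R' := (measurableTypeR R).
Notation T2 := (R' * R')%type.
Local Notation mu := (leb2 R).
Notation X := (R * R -> R[i]^o : lmodType R[i]).
Variable B : R.
Hypothesis B_gt0 : 0 < B.
Implicit Types (f g : R[i] -> R[i]) (x e : R * R) (Om : set (R * R)).

(* Gauge factor of the magnetic translation: it turns the pull-back of a function of w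
   by the affine map om * z + al into one with the same momenta. *)
Definition phase (om al : R[i]) x : R[i] :=
  let th := - complex.Im (om * cj al) * x.1 - complex.Re (om * cj al) * x.2 in cos th +i* sin th.

Lemma sqn_phase om al x : sqn (phase om al x) = 1.
Proof. by rewrite /sqn /= cos2Dsin2. Qed.

Lemma is_derive_affine (p q : R) x (e : R * R) :
  is_derive x e (fun y : R * R => p * y.1 + q * y.2) (p * e.1 + q * e.2).
Proof.
apply/is_derive_line.
rewrite (_ : (fun t : R => _) = fun t => t * (p * e.1 + q * e.2) + (p * x.1 + q * x.2)); last first.
  by apply/funext => t /=; rewrite /GRing.scale /=; ring.
by apply: is_derive_eq; rewrite /GRing.scale /=; ring.
Qed.

Lemma cderive_phase om al x e : cderive x e (phase om al)
  ('i%C * rc (- complex.Im (om * cj al) * e.1 - complex.Re (om * cj al) * e.2) * phase om al x).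
Proof.
pose p := - complex.Im (om * cj al); pose q := - complex.Re (om * cj al).
pose th y : R := p * y.1 + q * y.2.
have E : phase om al = fun y => cos (th y) +i* sin (th y).
  by apply/funext => y; rewrite /phase /th /p /q !mulNr.
have dth : is_derive x e th (p * e.1 + q * e.2) by exact: is_derive_affine.
rewrite -[complex.Re _ * _]opprK -mulNr opprK -/p -/q E; split.
  have h := is_derive_comp_real (is_derive_cos (th x)) dth.
  by apply: (is_derive_eq h); rewrite !(ReM, ImM) /=; ring.
have h := is_derive_comp_real (is_derive_sin (th x)) dth.
by apply: (is_derive_eq h); rewrite !(ReM, ImM) /=; ring.
Qed.

Lemma ccontinuous_phase om al : ccontinuous (phase om al).
Proof.
have cth : continuous (fun x : R * R => - complex.Im (om * cj al) * x.1 - complex.Re (om * cj al) * x.2).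
  move=> x; apply: cvgB; apply: cvgM; [exact: cvg_cst|exact: cvg_fst|exact: cvg_cst|exact: cvg_snd].
split=> x.
  apply: (continuous_comp (cth x)); exact: continuous_cos.
apply: (continuous_comp (cth x)); exact: continuous_sin.
Qed.

(** The gradient of the phase is a constant vector and cancels the contribution of [al]; the linear
    contribution of [om] is the vector potential exactly because |om|^2 = B / 2. Only the shifts
    [fp] and [fm] survive. *)
Lemma gauge_momentum f fp fm om al : ladder f fp fm -> sqn om = B / 2 ->
  let v x := phase om al x * f (aff om al x) in
  exists v1 v2 : R * R -> R[i],
  [/\ forall x, cderive x (1, 0) v (v1 x), forall x, cderive x (0, 1) v (v2 x),
      forall x, classical_mom (fun y => (homogeneous_field B y).1) v1 v x =
        phase om al x * ('i%C * (om * fp (aff om al x) - cj om * fm (aff om al x))) &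
      forall x, classical_mom (fun y => (homogeneous_field B y).2) v2 v x =
        phase om al x * - (om * fp (aff om al x) + cj om * fm (aff om al x))].
Proof.
move=> lf om2 v.
pose d e om' x := 'i%C * rc (- complex.Im (om * cj al) * e.1 - complex.Re (om * cj al) * e.2) * phase om al x * f (aff om al x) +
  phase om al x * ((2^-1 * cj (aff om al x) * f (aff om al x) - fp (aff om al x)) * om' +
    (fm (aff om al x) - 2^-1 * aff om al x * f (aff om al x)) * cj om').
have hd e om' x : cderive x e (aff om al) om' -> cderive x e v (d e om' x).
  by move=> h; exact: cderiveM (cderive_phase om al x e) (lf _ _ _ _ h).
exists (d (1, 0) om), (d (0, 1) (om * 'i%C)).
have h2 : (2^-1 : R[i]) = rc 2^-1 by rewrite realcV -(rc_nat R 2).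
split.
- by move=> x; apply: hd; exact: cderive_aff1.
- by move=> x; apply: hd; exact: cderive_aff2.
- move=> x; rewrite /classical_mom /d /v -/(rc _) /=.
  have key : rc (- complex.Im (om * cj al) * 1 - complex.Re (om * cj al) * 0) -
     'i%C * 2^-1 * (cj (aff om al x) * om - aff om al x * cj om) - rc (B / 2 * - x.2) = 0.
    rewrite h2 -om2 /aff; move: om al {om2 v d hd} => [a b] [c e]; case: x => x y.
    by apply: complex_eqP; rewrite /sqn !(ReD, ImD, ReN, ImN, ReM, ImM, ReJ, ImJ) /=; field.
  rewrite -[RHS]addr0 -(mulr0 (phase om al x * f (aff om al x))) -key.
  move: (rc (_ - _)) (rc (B / 2 * _)) => P0 P1.
  transitivity (phase om al x * (- ('i%C * 'i%C) * P0 * f (aff om al x) - 'i%C * ((2^-1 * cj (aff om al x) * f (aff om al x) - fp (aff om al x)) * om +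
    (fm (aff om al x) - 2^-1 * aff om al x * f (aff om al x)) * cj om) - P1 * f (aff om al x))); first by ring.
  by rewrite imaginary_sqr; ring.
move=> x; rewrite /classical_mom /d /v -/(rc _) /=.
have key : rc (- complex.Im (om * cj al) * 0 - complex.Re (om * cj al) * 1) +
   2^-1 * (cj (aff om al x) * om + aff om al x * cj om) - rc (B / 2 * x.1) = 0.
  rewrite h2 -om2 /aff; move: om al {om2 v d hd} => [a b] [c e]; case: x => x y.
  by apply: complex_eqP; rewrite /sqn !(ReD, ImD, ReN, ImN, ReM, ImM, ReJ, ImJ) /=; field.
rewrite -[RHS]addr0 -(mulr0 (phase om al x * f (aff om al x))) -key conjcM cj_imaginary.
move: (rc (_ - _)) (rc (B / 2 * _)) => P0 P1.
transitivity (phase om al x * (- ('i%C * 'i%C) * P0 * f (aff om al x) - ('i%C * 'i%C) * ((2^-1 * cj (aff om al x) * f (aff om al x) - fp (aff om al x)) * om -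
  (fm (aff om al x) - 2^-1 * aff om al x * f (aff om al x)) * cj om) - P1 * f (aff om al x))); first by ring.
by rewrite imaginary_sqr; ring.
Qed.

Let s : R := Num.sqrt (B / 2).

Definition rot_coef (t : R) : R[i] := rc s * (cos t +i* sin t).
Definition shift_coef (a : R * R) : R[i] := rc s * (a.1 +i* a.2).

Lemma lcoord_rigid t a x : lcoord B (rigid t a x) = aff (rot_coef t) (shift_coef a) x.
Proof.
rewrite /lcoord /aff /rot_coef /shift_coef addr0 /s; apply: complex_eqP; rewrite !(ReM, ImM, ReD, ImD) /=; ring.
Qed.

Lemma sqn_rot_coef t : sqn (rot_coef t) = B / 2.
Proof. by rewrite /rot_coef sqnM sqn_rc s_sqr // /sqn /= cos2Dsin2 mulr1. Qed.

(** Transports the plane function from the tile back to the fixed domain Om, where the form and the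
    eigenfunctions live; the phase has modulus 1 and leaves masses unchanged. *)
Definition pullback t a f x : R[i] :=
  phase (rot_coef t) (shift_coef a) x * on_plane B f (rigid t a x).

Lemma rigid_image_measurable Om t a : measurable (Om : set T2) -> measurable (rigid t a @` Om : set T2).
Proof.
move=> mOm.
(* The opposite of the shift, rotated back: [rigid (- t) b] is the inverse motion. *)
pose b : R * R := (- (cos t * a.1 + sin t * a.2), sin t * a.1 - cos t * a.2).
have K1 : cancel (rigid t a) (rigid (- t) b).
  move=> [x y]; rewrite /rigid /b /= cosN sinN; have h := cos2Dsin2 t.
  congr pair.
    transitivity ((cos t ^+ 2 + sin t ^+ 2) * x); first ring.
    by rewrite h mul1r.
  transitivity ((cos t ^+ 2 + sin t ^+ 2) * y); first ring.
  by rewrite h mul1r.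
have K2 : cancel (rigid (- t) b) (rigid t a).
  move=> [x y]; rewrite /rigid /b /= cosN sinN; have h := cos2Dsin2 t.
  congr pair.
    transitivity ((cos t ^+ 2 + sin t ^+ 2) * x + (1 - (cos t ^+ 2 + sin t ^+ 2)) * a.1); first ring.
    by rewrite h mul1r subrr mul0r addr0.
  transitivity ((cos t ^+ 2 + sin t ^+ 2) * y + (1 - (cos t ^+ 2 + sin t ^+ 2)) * a.2); first ring.
  by rewrite h mul1r subrr mul0r addr0.
have -> : rigid t a @` Om = rigid (- t) b @^-1` Om.
  apply/seteqP; split=> [_ [x Ox <-]|y Oy]; first by rewrite /= K1.
  by exists (rigid (- t) b y).
have [mf _] := preserving_rigid (- t) b.
by rewrite -[X in measurable X]setTI; exact: mf.
Qed.

Lemma rigid_inj t a : injective (@rigid R t a).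
Proof.
move=> [x y] [x' y']; rewrite /rigid /= => -[e1 e2]; have h := cos2Dsin2 t.
have e1' : cos t * (x - x') - sin t * (y - y') = 0 by move: e1 => /addIr e1; rewrite !mulrBr; lra.
have e2' : sin t * (x - x') + cos t * (y - y') = 0 by move: e2 => /addIr e2; rewrite !mulrBr; lra.
congr pair; apply/eqP; rewrite -subr_eq0.
  have -> : x - x' = (cos t ^+ 2 + sin t ^+ 2) * (x - x') by rewrite h mul1r.
  apply/eqP; transitivity (cos t * (cos t * (x - x') - sin t * (y - y')) + sin t * (sin t * (x - x') + cos t * (y - y'))); first ring.
  by rewrite e1' e2' !mulr0 addr0.
have -> : y - y' = (cos t ^+ 2 + sin t ^+ 2) * (y - y') by rewrite h mul1r.
apply/eqP; transitivity (cos t * (sin t * (x - x') + cos t * (y - y')) - sin t * (cos t * (x - x') - sin t * (y - y'))); first ring.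
by rewrite e1' e2' !mulr0 subr0.
Qed.

Lemma sqnormE_sqn (D : set (R * R)) u : sqnorm D u = (\int[mu]_(x in D) (sqn (u x))%:E)%E.
Proof. by []. Qed.

Lemma ccontinuous_sqn_measurable (D : set T2) u : measurable D -> ccontinuous u ->
  measurable_fun D (fun x : T2 => (sqn (u x))%:E).
Proof.
move=> mD [cr ci]; apply/measurable_EFinP; apply: measurable_funD; apply: measurable_funX.
  exact: continuous2_measurable.
exact: continuous2_measurable.
Qed.

Lemma pullback_sqnorm Om t a f : measurable (Om : set T2) -> nice f ->
  sqnorm Om (pullback t a f) = sqnorm (rigid t a @` Om) (on_plane B f).
Proof.
move=> mOm nf; rewrite !sqnormE_sqn.
have := @preserving_integral R (rigid t a) (rigid t a @` Om : set T2) (fun x => (sqn (on_plane B f x))%:E)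
  (preserving_rigid t a) (rigid_image_measurable t a mOm).
have -> : rigid t a @^-1` (rigid t a @` Om) = Om.
  apply/seteqP; split=> [x [y Oy /rigid_inj <-]//|x Ox]; by exists x.
move=> <-; first by apply: eq_integral => x _; rewrite /pullback sqnM sqn_phase mul1r.
  exact: ccontinuous_sqn_measurable measurableT (ccontinuous_on_plane B nf).
by move=> x; rewrite lee_fin sqn_ge0.
Qed.

Lemma ccontinuous_pullback t a f : nice f -> ccontinuous (pullback t a f).
Proof.
move=> nf; apply: ccontinuousM; first exact: ccontinuous_phase.
apply: ccontinuousM; first exact: ccontinuous_cst.
have [cf _] := nf; apply: cf.
have -> : (fun x => lcoord B (rigid t a x)) = aff (rot_coef t) (shift_coef a).
  by apply/funext => x; exact: lcoord_rigid.
exact: ccontinuous_aff.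
Qed.

Lemma on_plane_sqnorm_le D D' f : measurable (D : set T2) -> measurable (D' : set T2) -> D `<=` D' -> nice f ->
  (sqnorm D (on_plane B f) <= sqnorm D' (on_plane B f))%E.
Proof.
move=> mD mD' DD nf; rewrite !sqnormE_sqn; apply: ge0_subset_integral => //.
  exact: ccontinuous_sqn_measurable mD' (ccontinuous_on_plane B nf).
by move=> x _; rewrite lee_fin sqn_ge0.
Qed.

Lemma on_plane_sqnorm_fin f : nice f -> (sqnorm setT (on_plane B f) < +oo)%E.
Proof. by move=> /(on_plane_inL2 B_gt0)[]. Qed.

Lemma pullback_inL2 Om t a f : measurable (Om : set T2) -> nice f -> inL2 Om (pullback t a f).
Proof.
move=> mOm nf; have [cr ci] := ccontinuous_pullback t a nf; split.
  by split; exact: continuous2_measurable.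
rewrite pullback_sqnorm //; apply: le_lt_trans (on_plane_sqnorm_fin nf).
by apply: on_plane_sqnorm_le => //; exact: rigid_image_measurable.
Qed.

Lemma homogeneous_field_continuous1 : continuous (fun x => (homogeneous_field B x).1).
Proof. by move=> x; apply: cvgM; [exact: cvg_cst|apply: cvgN; exact: cvg_snd]. Qed.

Lemma homogeneous_field_continuous2 : continuous (fun x => (homogeneous_field B x).2).
Proof. by move=> x; apply: cvgM; [exact: cvg_cst|exact: cvg_fst]. Qed.

(** The two momenta are, up to phases, the difference and the sum of om fp and its counterpart with
    [fm]. By the parallelogram identity their squares add up to 2 |om|^2 = B times |fp|^2 +
    |fm|^2. *)
Lemma pullback_form Om t a f fp fm : open Om -> ladder f fp fm -> nice f -> nice fp -> nice fm ->
  form_domain Om (homogeneous_field B) (pullback t a f) /\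
  (nsq (magnetic_form Om (homogeneous_field B) : X -> X -> R[i]) (pullback t a f))%:E =
    (B%:E * (sqnorm (rigid t a @` Om) (on_plane B fp) + sqnorm (rigid t a @` Om) (on_plane B fm)))%E.
Proof.
move=> Oo lf nf nfp nfm; have mOm : measurable (Om : set T2) by exact: open2_measurable.
set om := rot_coef t; set al := shift_coef a.
pose c := rc (Num.sqrt (B / (2 * pi))).
have vE g : pullback t a g = fun x => phase om al x * (c * g (aff om al x)).
  by apply/funext => x; rewrite /pullback /on_plane lcoord_rigid.
have [v1 [v2 [d1 d2 m1 m2]]] := gauge_momentum al (ladderZ c lf) (sqn_rot_coef t).
pose g1 z := 'i%C * om * fp z + - ('i%C * cj om) * fm z.
pose g2 z := - om * fp z + - cj om * fm z.
have ng1 : nice g1 by apply: niceD; exact: niceZ.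
have ng2 : nice g2 by apply: niceD; exact: niceZ.
pose v := pullback t a f.
have eM1 : classical_mom (fun x => (homogeneous_field B x).1) v1 v = pullback t a g1.
  by apply/funext => x; rewrite /v vE m1 vE /g1 /om; ring.
have eM2 : classical_mom (fun x => (homogeneous_field B x).2) v2 v = pullback t a g2.
  by apply/funext => x; rewrite /v vE m2 vE /g2 /om; ring.
have cv : ccontinuous v by exact: ccontinuous_pullback.
have solve (A u w : R * R -> R[i]) : (forall x, - 'i%C * u x - A x * v x = w x) -> u = fun x => 'i%C * (w x + A x * v x).
  move=> h; apply/funext => x; rewrite -h; transitivity (- ('i%C * 'i%C) * u x); last by ring.
  by rewrite imaginary_sqr opprK mul1r.
have cderiv A u g : continuous A -> nice g -> classical_mom A u v = pullback t a g -> ccontinuous u.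
  move=> cA ng e; rewrite (solve (fun x => rc (A x)) u (pullback t a g)); last by move=> x; rewrite -e.
  apply: ccontinuousM; first exact: ccontinuous_cst.
  apply: ccontinuousD; first exact: ccontinuous_pullback.
  by apply: ccontinuousM => //; exact: ccontinuous_real.
have [fd q] := @classical_form_domain R Om (homogeneous_field B) Oo homogeneous_field_continuous1 homogeneous_field_continuous2
  v v1 v2 ltac:(by move=> x; rewrite /v vE; exact: d1) ltac:(by move=> x; rewrite /v vE; exact: d2) cv
  (cderiv _ _ _ homogeneous_field_continuous1 ng1 eM1) (cderiv _ _ _ homogeneous_field_continuous2 ng2 eM2)
  (pullback_inL2 t a mOm nf) ltac:(by rewrite eM1; exact: pullback_inL2) ltac:(by rewrite eM2; exact: pullback_inL2).
split=> //; rewrite q eM1 eM2 EFinD -!(sqnorm_nsq mOm) ?pullback_sqnorm //; try exact: pullback_inL2.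
have mi := rigid_image_measurable t a mOm.
have mg g : nice g -> measurable_fun (rigid t a @` Om : set T2) (fun x : T2 => (sqn (on_plane B g x))%:E).
  by move=> ng; apply: ccontinuous_sqn_measurable => //; exact: ccontinuous_on_plane.
rewrite !sqnormE_sqn -!ge0_integralD //; try (by move=> x _; rewrite lee_fin sqn_ge0); try exact: mg.
rewrite -ge0_integralZl //; last 3 first.
- by apply: emeasurable_funD; exact: mg.
- by move=> x _; rewrite adde_ge0 ?lee_fin ?sqn_ge0.
- by rewrite lee_fin ltW.
apply: eq_integral => x _; rewrite -!EFinD -EFinM; congr (_%:E).
rewrite /on_plane !sqnM -!mulrDr mulrCA; congr (_ * _).
have := sqn_rot_coef t; rewrite -/om /g1 /g2.
move: (fp _) (fm _) (om) => [a1 b1] [a2 b2] [p q'].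
rewrite /sqn !(ReD, ImD, ReN, ImN, ReM, ImM, ReJ, ImJ) /= => h.
have -> : B = 2 * (p ^+ 2 + q' ^+ 2) by rewrite h; field.
ring.
Qed.

End GaugePullback.

Section LandauCombinations.
Variable R : realType.
Notation R' := (measurableTypeR R).
Notation T2 := (R' * R')%type.
Local Notation mu := (leb2 R).
Notation X := (R * R -> R[i]^o : lmodType R[i]).
Variable B : R.
Hypothesis B_gt0 : 0 < B.
Local Notation ip := (inner setT : X -> X -> R[i]).
Let S : sip (inL2 setT : X -> Prop) ip := inner_sip measurableT.

Lemma pythagoras (L : X -> Prop) (q : X -> X -> R[i]) (T : finType) (v : T -> X) :
  sip L q -> (exists u, L u) -> (forall i, L (v i)) -> (forall i j, i != j -> q (v i) (v j) = 0) ->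
  nsq q (\sum_(i : T) v i) = \sum_(i : T) nsq q (v i).
Proof.
move=> SL L0 Lv orth; have Lz : L 0 by have [u Lu] := L0; rewrite -(scale0r u); exact: (sip_scale SL).
have lin w : L w -> L (\sum_(i : T) v i) /\ q (\sum_(i : T) v i) w = \sum_(i : T) q (v i) w.
  move=> Lw; elim/big_rec2 : _ => [|i y x _ [Lx <-]]; first by rewrite (ip0l SL).
  by split; [exact: (sip_add SL)|rewrite (sip_ipDl SL)].
have [Ls _] := lin 0 Lz.
rewrite /nsq /rip; have [_ ->] := lin _ Ls.
transitivity (complex.Re (\sum_(i : T) q (v i) (v i))).
  congr complex.Re; apply: eq_bigr => i _; rewrite (sip_ipC SL) //.
  have [_ ->] := lin _ (Lv i); rewrite (bigD1 i) //= big1 => [|j ji]; last exact: orth.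
  by rewrite addr0 -(sip_ipC SL).
by elim/big_rec2 : _ => // i y x _ <-; rewrite ReD.
Qed.

(** Index pairs may coincide where a coefficient vanishes: lowering sends the levels 0 and 1 both to
    0, the former with coefficient [rt 0]. *)
Lemma landau_sum_nsq (T : finType) (d : T -> R[i]) (a b : T -> nat) :
  (forall i j, i != j -> d i = 0 \/ d j = 0 \/ (a i, b i) <> (a j, b j)) ->
  nsq ip (on_plane B (fun z => \sum_(i : T) d i * landau (a i) (b i) z)) = \sum_(i : T) sqn (d i).
Proof.
move=> inj; have Ll k m : inL2 setT (on_plane B (landau k m)) by apply: on_plane_inL2 => //; exact: nice_landau.
have -> : on_plane B (fun z => \sum_(i : T) d i * landau (a i) (b i) z) = \sum_(i : T) (d i *: (on_plane B (landau (a i) (b i)) : X)).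
  rewrite (on_plane_sum B (fun i z => d i * landau (a i) (b i) z)); apply: eq_bigr => i _; exact: on_planeZ.
have LZ i : inL2 setT (d i *: (on_plane B (landau (a i) (b i)) : X)) by apply: (sip_scale S); exact: Ll.
rewrite (pythagoras S) //; last 2 first.
- by exists (on_plane B (landau 0 0)); exact: Ll.
- move=> i j /inj; rewrite (sip_ipZl S (d i) (Ll _ _) (LZ j)) (ipZr S (d j) (Ll _ _) (Ll _ _)) landau_orthonormal //.
  case=> [->|[->|ne]]; rewrite ?cj0 ?mul0r ?mulr0 //.
  case: eqP => [e1|]; case: eqP => [e2|]; rewrite /= ?mulr0 ?mul0r //.
  by case: ne; rewrite e1 e2.
apply: eq_bigr => i _; rewrite (nsqZ S (d i) (Ll _ _)) /nsq /rip landau_orthonormal // !eqxx /= mulr1 //.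
Qed.

Variables (K M : nat) (c : nat -> nat -> R[i]).

Definition comb z := \sum_(p : 'I_K * 'I_M) c p.1 p.2 * landau p.1 p.2 z.
Definition comb_up z := \sum_(p : 'I_K * 'I_M) c p.1 p.2 * up p.1 p.2 z.
Definition comb_down z := \sum_(p : 'I_K * 'I_M) c p.1 p.2 * down p.1 p.2 z.

Lemma ladder_comb : ladder comb comb_up comb_down.
Proof. by apply: ladder_sum => p; apply: ladderZ; exact: ladder_landau. Qed.

Lemma nice_comb : nice comb.
Proof. by apply: nice_sum => p; apply: niceZ; exact: nice_landau. Qed.

Lemma nice_comb_up : nice comb_up.
Proof. by apply: nice_sum => p; apply: niceZ; exact: nice_up. Qed.

Lemma nice_comb_down : nice comb_down.
Proof. by apply: nice_sum => p; apply: niceZ; exact: nice_down. Qed.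

Lemma comb_nsq : nsq ip (on_plane B comb) = \sum_(p : 'I_K * 'I_M) sqn (c p.1 p.2).
Proof.
apply: (@landau_sum_nsq _ (fun p : 'I_K * 'I_M => c p.1 p.2) (fun p => p.1) (fun p => p.2)) => p q pq; right; right=> -[e1 e2].
by case/eqP: pq; apply/eqP; rewrite [_ == _]/eq_op /= -!val_eqE /= e1 e2 !eqxx.
Qed.

Lemma comb_up_nsq : nsq ip (on_plane B comb_up) = \sum_(p : 'I_K * 'I_M) sqn (c p.1 p.2) * p.1.+1%:R.
Proof.
have -> : comb_up = fun z => \sum_(p : 'I_K * 'I_M) (c p.1 p.2 * rt R p.1.+1) * landau p.1.+1 p.2 z.
  by apply/funext => z; apply: eq_bigr => p _; rewrite mulrA.
rewrite (@landau_sum_nsq _ (fun p : 'I_K * 'I_M => c p.1 p.2 * rt R p.1.+1) (fun p => p.1.+1) (fun p => p.2)).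
  by apply: eq_bigr => p _; rewrite sqnM sqn_rt.
move=> p q pq; right; right=> -[e1 e2].
by case/eqP: pq; apply/eqP; rewrite [_ == _]/eq_op /= -!val_eqE /= e1 e2 !eqxx.
Qed.

Lemma comb_down_nsq : nsq ip (on_plane B comb_down) = \sum_(p : 'I_K * 'I_M) sqn (c p.1 p.2) * p.1%:R.
Proof.
have -> : comb_down = fun z => \sum_(p : 'I_K * 'I_M) (c p.1 p.2 * rt R p.1) * landau p.1.-1 p.2 z.
  by apply/funext => z; apply: eq_bigr => p _; rewrite mulrA.
rewrite (@landau_sum_nsq _ (fun p : 'I_K * 'I_M => c p.1 p.2 * rt R p.1) (fun p => p.1.-1) (fun p => p.2)).
  by apply: eq_bigr => p _; rewrite sqnM sqn_rt.
move=> p q pq.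
have [p0|p0] := eqVneq (p.1 : nat) 0; first by left; rewrite p0 rt0 mulr0.
have [q0|q0] := eqVneq (q.1 : nat) 0; first by right; left; rewrite q0 rt0 mulr0.
right; right=> -[e1 e2]; case/eqP: pq; apply/eqP; rewrite [_ == _]/eq_op /= -!val_eqE /= e2 eqxx andbT.
by rewrite -[p.1 : nat]prednK ?lt0n // -[q.1 : nat]prednK ?lt0n // e1.
Qed.

Lemma on_plane_sqnorm f : nice f -> sqnorm setT (on_plane B f) = (nsq ip (on_plane B f))%:E.
Proof. by move=> nf; apply: sqnorm_nsq => //; exact: on_plane_inL2. Qed.

End LandauCombinations.

Section MonotoneDensity.
Variable R : realType.
Notation R' := (measurableTypeR R).
Notation T2 := (R' * R')%type.
Local Notation mu := (leb2 R).
Variables (B : R) (Om : set (R * R)).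
Hypothesis B_gt0 : 0 < B.
Hypothesis mOm : measurable (Om : set T2).
Hypothesis fOm : (mu Om < +oo)%E.

Definition landau_mass k m : R := fine (sqnorm Om (on_plane B (landau k m))).

Lemma landau_massE k m : sqnorm Om (on_plane B (landau k m)) = (landau_mass k m)%:E.
Proof.
rewrite /landau_mass fineK // ge0_fin_numE.
  apply: le_lt_trans (on_plane_sqnorm_fin B_gt0 (nice_landau R k m)).
  by apply: on_plane_sqnorm_le => //; exact: nice_landau.
by apply: integral_ge0 => x _; rewrite lee_fin sqn_ge0.
Qed.

(** Monotone convergence: the partial sums of the squared moduli increase to a constant at every
    point, whatever the level. *)
Lemma landau_mass_cvg k : (fun M => \sum_(m < M) landau_mass k m) @ \oo --> B / (2 * pi) * fine (mu Om).
Proof.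
have c0 : 0 <= B / (2 * pi) by rewrite divr_ge0 ?mulr_ge0 ?pi_ge0 // ltW.
pose F M x : \bar R := (B / (2 * pi) * landau_sum k M (lcoord B x))%:E.
have FE M : ((\sum_(m < M) landau_mass k m)%:E = \int[mu]_(x in Om) F M x)%E.
  rewrite -sumEFin; under eq_bigr do rewrite -landau_massE sqnormE_sqn.
  rewrite -(@ge0_integral_sum _ T2 R mu Om mOm _ (fun (m : 'I_M) x => (sqn (on_plane B (landau k m) x))%:E)).
  - by apply: eq_integral => x _; rewrite /F /landau_sum mulr_sumr -sumEFin; apply: eq_bigr => m _; rewrite /on_plane sqnM sqn_rc c0_sqr.
  - move=> m; apply: ccontinuous_sqn_measurable => //.
    by apply: ccontinuous_on_plane; exact: nice_landau.
  - by move=> m x _; rewrite lee_fin sqn_ge0.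
have cF : (fun M => \int[mu]_(x in Om) F M x)%E @ \oo --> (\int[mu]_(x in Om) (B / (2 * pi))%:E)%E.
  have -> : (\int[mu]_(x in Om) (B / (2 * pi))%:E = \int[mu]_(x in Om) limn (fun M => F M x))%E.
    apply: eq_integral => x _; apply/esym/cvg_lim => //; apply: cvg_EFin; first by near=> n.
    by rewrite -[X in _ --> X]mulr1; apply: cvgMr; exact: landau_sum_cvg.
  apply: cvg_monotone_convergence => //.
  - move=> M; apply/measurable_EFinP; apply: measurable_funM => //.
    rewrite (_ : (fun x => landau_sum k M (lcoord B x)) = fun x => \sum_(m < M) sqn (landau k m (lcoord B x))) //.
    apply: measurable_sum => m; apply/measurable_EFinP; apply: ccontinuous_sqn_measurable => //.
    have [cf _] := nice_landau R k m; apply: cf; exact: ccontinuous_aff.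
  - by move=> M x _; rewrite lee_fin mulr_ge0 // sumr_ge0 // => i _; exact: sqn_ge0.
  - by move=> x _ M N MN; rewrite lee_fin; apply: ler_wpM2l => //; exact: landau_sum_nd.
have -> : (fun M => \sum_(m < M) landau_mass k m) = fun M => fine (\int[mu]_(x in Om) F M x)%E.
  by apply/funext => M; rewrite -FE.
apply: fine_cvg; rewrite -[X in _ --> X](_ : (\int[mu]_(x in Om) (B / (2 * pi))%:E)%E = _) //.
by rewrite (@integral_cst _ T2 R mu Om mOm) [RHS]EFinM fineK // ge0_fin_numE.
Unshelve. all: by end_near.
Qed.

End MonotoneDensity.

(** * Convex moments *)
Section ZeroExtension.
Variable R : realType.
Notation R' := (measurableTypeR R).
Notation T2 := (R' * R')%type.
Local Notation mu := (leb2 R).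
Notation X := (R * R -> R[i]^o : lmodType R[i]).
Variable Om : set (R * R).
Hypothesis mOm : measurable (Om : set T2).
Implicit Types u v : R * R -> R[i].

(** The Landau functions are orthonormal on the plane but not on Om; extending an eigenfunction by 0
    makes Bessel's inequality on the plane available for it. *)
Definition zero_ext u x : R[i] := if x \in Om then u x else 0.

Lemma inner_zero_ext u v : inner setT v (zero_ext u) = inner Om v u.
Proof.
rewrite /inner /cintegral; congr (_ +i* _); rewrite [RHS]Rintegral_mkcond; congr Rintegral; apply/funext => x.
  by rewrite patchE /zero_ext; case: ifP => _ //; rewrite -/(cj 0) cj0 mulr0.
by rewrite patchE /zero_ext; case: ifP => _ //; rewrite -/(cj 0) cj0 mulr0.
Qed.

Lemma sqnorm_zero_ext u : sqnorm setT (zero_ext u) = sqnorm Om u.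
Proof.
rewrite /sqnorm [RHS]integral_mkcond; apply: eq_integral => x _.
by rewrite patchE /zero_ext; case: ifP => _ //=; rewrite expr0n addr0.
Qed.

Lemma zero_ext_inL2 u : inL2 Om u -> inL2 setT (zero_ext u).
Proof.
move=> [[mr mi] fu]; split; last by rewrite sqnorm_zero_ext.
split.
  rewrite (_ : (fun x => _) = (fun x => complex.Re (u x)) \_ Om); last first.
    by apply/funext => x; rewrite patchE /zero_ext; case: ifP.
  by apply/(@measurable_restrict _ _ T2 R') => //; rewrite setTI.
rewrite (_ : (fun x => _) = (fun x => complex.Im (u x)) \_ Om); last first.
  by apply/funext => x; rewrite patchE /zero_ext; case: ifP.
by apply/(@measurable_restrict _ _ T2 R') => //; rewrite setTI.
Qed.

Lemma nsq_zero_ext u : inL2 Om u ->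
  nsq (inner setT : X -> X -> R[i]) (zero_ext u) = nsq (inner Om : X -> X -> R[i]) u.
Proof.
move=> lu; apply: EFin_inj; rewrite -(sqnorm_nsq mOm lu) -(sqnorm_nsq measurableT (zero_ext_inL2 lu)).
exact: sqnorm_zero_ext.
Qed.

End ZeroExtension.

Lemma cvg_sum_fin (R : realType) (T : finType) (u : T -> R ^nat) (l : T -> R) :
  (forall i, u i @ \oo --> l i) -> (fun n => \sum_(i : T) u i n) @ \oo --> \sum_(i : T) l i.
Proof.
move=> h; have -> : (fun n => \sum_(i : T) u i n) = \sum_(i : T) u i.
  by apply/funext => n; rewrite fct_sumE.
elim/big_ind2 : _ => //; first exact: cvg_cst.
by move=> u1 l1 u2 l2 h1 h2; exact: cvgD.
Qed.

Section TangentLine.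
Variable R : realType.

(** Young's inequality for the product of x and y^(g - 1) with exponents g and g / (g - 1); the case
    g = 1, without conjugate exponent, is an equality. *)
Lemma powR_tangent (g x y : R) : 1 <= g -> 0 < x -> 0 < y ->
  y `^ g + g * y `^ (g - 1) * (x - y) <= x `^ g.
Proof.
move=> g1 x0 y0; have g0 : 0 < g by lra.
have yE : y * y `^ (g - 1) = y `^ g by rewrite -{1}[y]powRr1 ?ltW // -powRD ?gt_eqF ?implybT // addrC subrK.
have [->|gn] := eqVneq g 1.
  by rewrite subrr powRr0 (powRr1 (ltW x0)) (powRr1 (ltW y0)) !mul1r; lra.
have g1' : 0 < g - 1 by rewrite subr_gt0 lt_neqAle eq_sym gn.
have q0 : 0 < g / (g - 1) by rewrite divr_gt0.
have := @conjugate_powR R x (y `^ (g - 1)) g (g / (g - 1)) (ltW x0) (powR_ge0 _ _) g0 q0.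
have -> : g^-1 + (g / (g - 1))^-1 = 1 by field; rewrite ?gt_eqF.
move=> /(_ erefl); rewrite -powRrM mulrCA divff ?gt_eqF // mulr1 => h.
have h2 := ler_wpM2l (ltW g0) h.
have e : g * (x `^ g / g + y `^ g / (g / (g - 1))) = x `^ g + (g - 1) * y `^ g by field; rewrite ?gt_eqF.
rewrite e in h2.
have -> : g * y `^ (g - 1) * (x - y) = g * (x * y `^ (g - 1)) - g * y `^ g by rewrite -yE; ring.
lra.
Qed.

(** [p] is the slope of a supporting line at [E]. Its sign allows a lower bound on the energy to be
    inserted, and the nonpositive value of the line at [l] allows the mass with energy at least [l]
    to be discarded. *)
Lemma neg_pow_tangent (g l E : R) : 1 <= g -> exists p, [/\ p <= 0,
  neg_pow g (E - l) + p * (l - E) <= 0 &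
  forall m, m < l -> neg_pow g (E - l) + p * (m - E) <= neg_pow g (m - l)].
Proof.
move=> g1; have g0 : g != 0 by rewrite gt_eqF //; lra.
have negE s : neg_pow g s = (Num.max (- s) 0) `^ g by rewrite /neg_pow (negbTE g0).
have [lE|El] := leP l E.
  have z : neg_pow g (E - l) = 0 by rewrite negE max_r ?powR0 // opprB subr_le0.
  exists 0; rewrite z; split; rewrite ?mul0r ?addr0 // => m _.
  by rewrite mul0r addr0 neg_pow_ge0.
have y0 : 0 < l - E by lra.
have yE : neg_pow g (E - l) = (l - E) `^ g by rewrite negE opprB max_l // ltW.
exists (- (g * (l - E) `^ (g - 1))); rewrite yE; split.
- by rewrite oppr_le0 mulr_ge0 ?powR_ge0 //; lra.
- rewrite mulNr -mulrA [_ * (l - E)]mulrC -{2}[l - E]powRr1 ?(ltW y0) // -powRD ?(gt_eqF y0) ?implybT //.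
  have -> : 1 + (g - 1) = g by ring.
  by have := powR_ge0 (l - E) g; nra.
move=> m ml; have x0 : 0 < l - m by lra.
have -> : neg_pow g (m - l) = (l - m) `^ g by rewrite negE opprB max_l // ltW.
by apply: le_trans (powR_tangent g1 x0 y0); rewrite lerD2l; lra.
Qed.

End TangentLine.

(** * The trace bound for exponents at least 1 *)

Section BerezinLiYau.
Variable R : realType.
Notation R' := (measurableTypeR R).
Notation T2 := (R' * R')%type.
Local Notation mu := (leb2 R).
Notation X := (R * R -> R[i]^o : lmodType R[i]).
Variables (B : R) (Om : set (R * R)).
Hypothesis B_gt0 : 0 < B.
Hypothesis Om_open : open Om.
Hypothesis Om_fin : (mu Om < +oo)%E.
Hypothesis disc : discrete_spectrum Om (magnetic_neumann Om (homogeneous_field B)).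
Local Notation ipO := (inner Om : X -> X -> R[i]).
Local Notation qO := (magnetic_form Om (homogeneous_field B) : X -> X -> R[i]).

Let mOm : measurable (Om : set T2).
Proof. exact: open2_measurable. Qed.

Lemma rigid_id : rigid 0 (0, 0) = @id (R * R).
Proof. by apply/funext => -[x y]; rewrite /rigid /= cos0 sin0 !mul1r !mul0r !addr0 subr0 add0r. Qed.

Lemma pullback_id f : pullback B 0 (0, 0) f = on_plane B f.
Proof.
apply/funext => x; rewrite /pullback rigid_id /phase.
have -> : rot_coef B 0 * cj (shift_coef B (0, 0)) = 0.
  by rewrite /shift_coef (_ : (_ +i* _) = 0) // mulr0 cj0 mulr0.
by rewrite /= oppr0 !mul0r subr0 cos0 sin0 mul1r.
Qed.

Lemma on_plane_Om_inL2 f : nice f -> inL2 Om (on_plane B f).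
Proof. by move=> nf; rewrite -pullback_id; exact: pullback_inL2. Qed.

Lemma landau_nsq k m : nsq ipO (on_plane B (landau k m)) = landau_mass B Om k m.
Proof. by apply: EFin_inj; rewrite -(landau_massE B_gt0 mOm) (sqnorm_nsq mOm) //; apply: on_plane_Om_inL2; exact: nice_landau. Qed.

Lemma landau_form k m : form_domain Om (homogeneous_field B) (on_plane B (landau k m)) /\
  nsq qO (on_plane B (landau k m)) = B * (k.+1%:R * landau_mass B Om k.+1 m + k%:R * landau_mass B Om k.-1 m).
Proof.
have [fd q] := pullback_form B_gt0 0 (0, 0) Om_open (@ladder_landau R k m) (nice_landau R k m) (nice_up R k m) (nice_down R k m).
rewrite !pullback_id rigid_id image_id in fd q; split=> //; apply: EFin_inj; rewrite q.
have E j n a : sqnorm Om (on_plane B (fun z => rt R a * landau j n z)) = (a%:R * landau_mass B Om j n)%:E.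
  have lj := on_plane_Om_inL2 (nice_landau R j n).
  rewrite (on_planeZ B (rt R a) (landau j n)) (sqnorm_nsq mOm); last exact: (sip_scale (inner_sip mOm) (rt R a) lj).
  by rewrite (nsqZ (inner_sip mOm) (rt R a) lj) sqn_rt landau_nsq.
by rewrite /up /down !E -EFinD -EFinM.
Qed.

Lemma landau_bessel (K M : nat) u : inL2 Om u ->
  \sum_(p : 'I_K * 'I_M) sqn (ipO (on_plane B (landau p.1 p.2)) u) <= nsq ipO u.
Proof.
move=> lu; rewrite -(nsq_zero_ext mOm lu).
have lz := zero_ext_inL2 mOm lu.
have Ll k m : inL2 setT (on_plane B (landau k m)) by apply: on_plane_inL2 => //; exact: nice_landau.
apply: le_trans (@bessel R X _ _ (inner_sip measurableT) ('I_K * 'I_M)%type (fun p => on_plane B (landau p.1 p.2)) (zero_ext Om u) _ _ lz).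
- apply: ler_sum => p _; rewrite (sip_ipC (inner_sip measurableT) (Ll _ _) lz) sqnJ.
  by rewrite inner_zero_ext.
- by move=> p; exact: Ll.
- move=> p q; rewrite landau_orthonormal // -[p == q]/((p.1 == q.1) && (p.2 == q.2)).
Qed.

Definition level k : R := B * (2 * k%:R + 1).

Lemma trace_lower_bound (g l : R) (K : nat) : 1 <= g ->
  ((B / (2 * pi) * fine (mu Om) * \sum_(k < K) neg_pow g (level k - l))%:E <=
    tr_neg_pow Om (magnetic_neumann Om (homogeneous_field B)) g l)%E.
Proof.
move=> g1; have cA1 := @homogeneous_field_continuous1 R B; have cA2 := @homogeneous_field_continuous2 R B.
have [N [psi [m [on eig ml low]]]] := magnetic_spectral_family Om_open cA1 cA2 disc l.
apply: le_trans (tr_neg_pow_ge Om_open g l on eig); rewrite lee_fin.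
have Lpsi j : inL2 Om (psi j) by case: (eig j) => -[].
have /choice[p hp] : forall k, exists p, [/\ p <= 0,
  neg_pow g (level k - l) + p * (l - level k) <= 0 &
  forall m, m < l -> neg_pow g (level k - l) + p * (m - level k) <= neg_pow g (m - l)].
  by move=> k; exact: neg_pow_tangent.
pose a M k := \sum_(n < M) landau_mass B Om k n.
(* The energy on Om of the first M functions of level k, as given by [landau_form]. *)
pose q M k := B * (k.+1%:R * a M k.+1 + k%:R * a M k.-1).
have main M : \sum_(k < K) (neg_pow g (level k - l) * a M k + p k * (q M k - level k * a M k))
    <= \sum_(j < N) neg_pow g (m j - l).
  pose s (k n : nat) j := sqn (ipO (on_plane B (landau k n)) (psi j)).
  apply: le_trans (_ : \sum_(j < N) neg_pow g (m j - l) * \sum_(x : 'I_K * 'I_M) s x.1 x.2 j <= _); last first.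
    apply: ler_sum => j _; apply: ler_piMr; first exact: neg_pow_ge0.
    apply: le_trans (landau_bessel K M (Lpsi j)) _.
    by rewrite /nsq /rip on eqxx.
  apply: le_trans (_ : \sum_(x : 'I_K * 'I_M) \sum_(j < N) neg_pow g (m j - l) * s x.1 x.2 j <= _); last first.
    by rewrite exchange_big /=; apply: ler_sum => j _; rewrite mulr_sumr.
  apply: le_trans (_ : \sum_(x : 'I_K * 'I_M) (neg_pow g (level x.1 - l) * landau_mass B Om x.1 x.2 +
      p x.1 * (B * (x.1.+1%:R * landau_mass B Om x.1.+1 x.2 + x.1%:R * landau_mass B Om x.1.-1 x.2) - level x.1 * landau_mass B Om x.1 x.2)) <= _).
    rewrite le_eqVlt; apply/orP; left; apply/eqP.
    rewrite -(pair_big xpredT xpredT (fun (k : 'I_K) (n : 'I_M) => neg_pow g (level k - l) * landau_mass B Om k n +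
      p k * (B * (k.+1%:R * landau_mass B Om k.+1 n + k%:R * landau_mass B Om k.-1 n) - level k * landau_mass B Om k n))) /=.
    apply: eq_bigr => k _; rewrite /q /a !mulr_sumr -big_split /= mulr_sumr -sumrB mulr_sumr -big_split /=.
    by apply: eq_bigr => n _; ring.
  apply: ler_sum => -[k n] _ /=.
  have [fd qf] := landau_form k n.
  have := spectral_lower (inner_sip mOm) (magnetic_sip Om_open cA1 cA2) (fun u (h : form_domain Om (homogeneous_field B) u) => let: And4 h1 _ _ _ := h in h1) on eig low fd.
  rewrite -landau_nsq -qf; rewrite -/(s k n _).
  have [p0 h1 h2] := hp k.
  set F := nsq ipO _; set Q := nsq qO _.
  have Sle : \sum_(j < N) s k n j <= F.
    have := bessel (inner_sip mOm) Lpsi on (on_plane_Om_inL2 (nice_landau R k n)); exact.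
  have -> : \sum_(i < N) m i * sqn (ipO (on_plane B (landau k n)) (psi i)) = \sum_(i < N) m i * s k n i by [].
  have -> : \sum_(i < N) sqn (ipO (on_plane B (landau k n)) (psi i)) = \sum_(i < N) s k n i by [].
  set S := \sum_(i < N) s k n i in Sle *; set W := \sum_(i < N) m i * s k n i => hl.
  (* The mass F - S not carried by the eigenfunctions has energy at least l, so it enters with the
     value of the supporting line at l, which is at most 0. *)
  apply: le_trans (_ : (neg_pow g (level k - l) - p k * level k) * S + p k * W <= _); last first.
    rewrite /S /W !mulr_sumr -big_split /=; apply: ler_sum => j _.
    have := ler_wpM2r (sqn_ge0 (ipO (on_plane B (landau k n)) (psi j))) (h2 _ (ml j)); rewrite -/(s k n j).
    by apply: le_trans; rewrite le_eqVlt; apply/orP; left; apply/eqP; ring.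
  have h3 := ler_wnM2l p0 hl.
  have h4 := ler_wnM2l h1 Sle.
  nra.
have cva k : (fun M => a M k) @ \oo --> B / (2 * pi) * fine (mu Om) by exact: landau_mass_cvg.
set V := B / (2 * pi) * fine (mu Om) in cva *.
have cvm : (fun M => \sum_(k < K) (neg_pow g (level k - l) * a M k + p k * (q M k - level k * a M k))) @ \oo -->
    \sum_(k < K) (neg_pow g (level k - l) * V + p k * (B * (k.+1%:R * V + k%:R * V) - level k * V)).
  apply: cvg_sum_fin => k; apply: cvgD; first exact: cvgMr.
  apply: cvgMr; apply: cvgB; last exact: cvgMr.
  by apply: cvgMr; apply: cvgD; exact: cvgMr.
(* All the masses tend to the same limit V, and (k + 1) + k = 2 k + 1 makes the linear term
   vanish. *)
have -> : V * \sum_(k < K) neg_pow g (level k - l) =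
    \sum_(k < K) (neg_pow g (level k - l) * V + p k * (B * (k.+1%:R * V + k%:R * V) - level k * V)).
  rewrite mulr_sumr; apply: eq_bigr => k _; rewrite /level -natr1; ring.
rewrite -(cvg_lim _ cvm) //; apply: limr_le; first exact: cvgP cvm.
by apply: nearW => M; exact: main.
Qed.

End BerezinLiYau.

(** * Tiling domains *)
Section FiniteTools.

(** An injective family that cannot be extended exhausts [S]; if none existed, families would grow
    beyond the bound [b]. *)
Lemma finite_cover (I : Type) (S : I -> Prop) (b : nat) :
  (forall n (s : 'I_n -> I), injective s -> (forall i, S (s i)) -> (n <= b)%N) ->
  exists n (s : 'I_n -> I), [/\ injective s, forall i, S (s i) & forall i, S i -> exists j, s j = i].
Proof.
move=> bd; apply: contrapT => nE.
suff : forall n, exists s : 'I_n -> I, injective s /\ forall i, S (s i).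
  by move=> /(_ b.+1)[s [si sS]]; have := bd _ s si sS; rewrite ltnn.
elim=> [|n [s [si sS]]]; first by exists (fun i : 'I_0 => match notF (ltn_ord i) with end); split=> -[].
have [i0 [Si0 ni0]] : exists i, S i /\ ~ exists j, s j = i.
  apply: contrapT => h; apply: nE; exists n, s; split=> // i Si.
  by apply: contrapT => ne; apply: h; exists i.
exists (fun j => if unlift ord_max j is Some j' then s j' else i0); split=> [j k|j].
  case: unliftP => [j'|] ->; case: unliftP => [k'|] -> // h.
  - by rewrite (si _ _ h).
  - by case: ni0; exists j'.
  - by case: ni0; exists k'.
by case: unliftP.
Qed.

Lemma kernel_vector (F : fieldType) (T U : finType) (A : T -> U -> F) : (#|U| < #|T|)%N ->
  exists c : T -> F, (exists p, c p != 0) /\ forall u, \sum_(p : T) c p * A p u = 0.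
Proof.
move=> UT; pose M : 'M[F]_(#|T|, #|U|) := \matrix_(i, j) A (enum_val i) (enum_val j).
have : kermx M != 0.
  rewrite -mxrank_eq0 mxrank_ker -lt0n subn_gt0; apply: leq_ltn_trans UT; exact: rank_leq_col.
move=> /eqP/matrixP h.
have [i [j nz]] : exists i j, kermx M i j != 0.
  apply: contrapT => n; apply: h => i j; rewrite [RHS]mxE; apply/eqP; apply: contrapT => /negP nz.
  by apply: n; exists i, j.
exists (fun p => kermx M i (enum_rank p)); split; first by exists (enum_val j); rewrite enum_valK.
move=> u; have /matrixP/(_ i (enum_rank u)) := mulmx_ker M.
rewrite !mxE (reindex (@enum_rank T)) /=; last by exists (@enum_val T T) => ? _; rewrite ?enum_rankK ?enum_valK.
by move=> e; rewrite -[RHS]e; apply: eq_bigr => p _; rewrite [M _ _]mxE !enum_rankK.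
Qed.

Lemma factor_above (R : realType) (a b : R) (n : nat) : 0 <= a -> a < b ->
  exists t, [/\ 1 < t & a * t ^+ n <= b].
Proof.
move=> a0 ab; have [az|az] := eqVneq a 0.
  by exists 2; split; [lra|rewrite az mul0r; lra].
have ap : 0 < a by rewrite lt_neqAle eq_sym az.
have r1 : 1 < b / a by rewrite ltr_pdivlMr // mul1r.
have r0 : 0 < b / a by lra.
(* The root of order n + 1 exists also for n = 0, and t^n <= t^(n + 1) as t > 1. *)
pose t := (b / a) `^ (n.+1%:R)^-1.
have e : t ^+ n.+1 = b / a.
  by rewrite -powR_mulrn ?powR_ge0 // -powRrM mulVf ?pnatr_eq0 // powRr1 // ltW.
have t1 : 1 < t.
  rewrite ltNge; apply/negP => tle; move: r1; rewrite -e ltNge => /negP; apply.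
  by rewrite exprn_ile1 // powR_ge0.
exists t; split=> //; rewrite mulrC -ler_pdivlMr // -e; apply: ler_weXn2l => //; exact: ltW.
Qed.

Lemma geometric_small (R : realType) (q e : R) : 0 <= q -> q < 1 -> 0 < e -> exists n, q ^+ n < e.
Proof.
move=> q0 q1 e0.
have := @cvg_expr R q; rewrite ger0_norm // => /(_ q1) /cvgrPdist_lt /(_ e e0) [n _ /(_ n (leqnn n))] /=.
by rewrite sub0r normrN ger0_norm ?exprn_ge0 // => h; exists n.
Qed.

Lemma nat_above (R : realType) (x : R) : exists n : nat, x <= n%:R.
Proof.
exists (Num.truncn `|x|).+1; apply: le_trans (ler_norm x) _; apply: ltW.
by have /andP[] := truncn_itv (normr_ge0 x).
Qed.

End FiniteTools.

(** * Masses on disjoint tiles *)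

Section PlaneSums.
Variable R : realType.
Notation R' := (measurableTypeR R).
Notation T2 := (R' * R')%type.
Local Notation mu := (leb2 R).
Implicit Types u : R * R -> R[i].

Let mu_f u : ccontinuous u -> measurable_fun [set: T2] (fun x : T2 => (sqn (u x))%:E).
Proof. by move=> cu; exact: ccontinuous_sqn_measurable. Qed.

Let tile_union n (D : 'I_n -> set T2) : \bigcup_i D i = \big[setU/set0]_(i <- index_enum 'I_n) D i.
Proof.
rewrite -bigcup_seq; apply: eq_bigcupl; split=> i _ //=.
by rewrite mem_index_enum.
Qed.

Lemma tiles_sqnorm n (D : 'I_n -> set T2) u : (forall i, measurable (D i)) ->
  trivIset [set: 'I_n] D -> ccontinuous u ->
  sqnorm (\bigcup_i D i) u = (\sum_(i < n) sqnorm (D i) u)%E.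
Proof.
move=> mD tD cu; rewrite !sqnormE_sqn tile_union.
rewrite (@ge0_integral_bigsetU _ T2 R mu _ D) //.
- exact: index_enum_uniq.
- by apply: sub_trivIset tD.
- exact: measurable_funS (mu_f cu).
- by move=> x _; rewrite lee_fin sqn_ge0.
Qed.

Lemma tiles_sqnorm_le n (D : 'I_n -> set T2) u : (forall i, measurable (D i)) ->
  trivIset [set: 'I_n] D -> ccontinuous u -> (\sum_(i < n) sqnorm (D i) u <= sqnorm setT u)%E.
Proof.
move=> mD tD cu; rewrite -tiles_sqnorm // !sqnormE_sqn; apply: ge0_subset_integral => //.
- by rewrite tile_union; exact: bigsetU_measurable.
- exact: mu_f.
- by move=> x _; rewrite lee_fin sqn_ge0.
Qed.

Lemma tiles_sqnorm_ge n (D : 'I_n -> set T2) (out : set T2) u : (forall i, measurable (D i)) ->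
  trivIset [set: 'I_n] D -> measurable out -> ccontinuous u ->
  mu.-negligible (~` (\bigcup_i D i `|` out)) ->
  (sqnorm setT u <= \sum_(i < n) sqnorm (D i) u + sqnorm out u)%E.
Proof.
move=> mD tD mout cu neg; rewrite -tiles_sqnorm // !sqnormE_sqn.
set U := \bigcup_i D i in neg *; have mU : measurable U by rewrite /U tile_union; exact: bigsetU_measurable.
pose f (x : T2) : \bar R := (sqn (u x))%:E.
have f0 x : (0 <= f x)%E by rewrite lee_fin sqn_ge0.
have mf : measurable_fun [set: T2] f by exact: mu_f.
have mr (E : set T2) : measurable E -> measurable_fun [set: T2] (f \_ E).
  by move=> mE; apply/(@measurable_restrict _ _ T2) => //; exact: measurable_funS mf.
have r0 (E : set T2) x : (0 <= (f \_ E) x)%E by rewrite patchE; case: ifP.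
rewrite [X in (_ <= X + _)%E]integral_mkcond [X in (_ <= _ + X)%E]integral_mkcond.
rewrite -/f -ge0_integralD //; [|exact: mr|exact: mr].
apply: ae_ge0_le_integral => //.
- by move=> x _; rewrite lee_fin sqn_ge0.
- by move=> x _; rewrite adde_ge0.
- by apply: emeasurable_funD; exact: mr.
apply: negligibleS neg => x /= nh; apply: contrapT => /contrapT h; apply: nh => _.
rewrite !patchE; case: h => /mem_set ->; first by rewrite leeDl //; case: ifP.
by rewrite leeDr //; case: ifP.
Qed.

End PlaneSums.

(** * Moments of combinations of Landau functions *)

Section Raising.
Variable R : realType.
Notation X := (R * R -> R[i]^o : lmodType R[i]).
Implicit Types (c : nat -> nat -> R[i]) (K M : nat).

Definition supported K M c := forall k m, (K <= k)%N || (M <= m)%N -> c k m = 0.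

Definition coef_nsq K M c : R := \sum_(p : 'I_K * 'I_M) sqn (c p.1 p.2).

Definition raise_l c k m : R[i] := if k is j.+1 then rt R j.+1 * c j m else 0.
Definition lower_a c k m : R[i] := rt R m.+1 * c k m.+1.
(** The coefficients of the conjugate of z times a combination, read off [landau_cj]. One level is
    added, but the bound on the angular index persists. *)
Definition raise c k m := raise_l c k m + lower_a c k m.

Lemma supported_raise K M c : supported K M c -> supported K.+1 M (raise c).
Proof.
move=> sc k m h; rewrite /raise /raise_l /lower_a [c k m.+1]sc ?mulr0 ?addr0; last first.
  by case/orP: h => h; [rewrite (ltnW h)|rewrite (leqW h) orbT].
by case: k h => [//|k] h; rewrite sc ?mulr0.
Qed.

Let pairE K M (F : nat -> nat -> R[i]) :
  \sum_(p : 'I_K * 'I_M) F p.1 p.2 = \sum_(k < K) \sum_(m < M) F k m.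
Proof. by rewrite (pair_big xpredT xpredT (fun (k : 'I_K) (m : 'I_M) => F k m)). Qed.

Let pairER K M (F : nat -> nat -> R) :
  \sum_(p : 'I_K * 'I_M) F p.1 p.2 = \sum_(k < K) \sum_(m < M) F k m.
Proof. by rewrite (pair_big xpredT xpredT (fun (k : 'I_K) (m : 'I_M) => F k m)). Qed.

Lemma comb_raise K M c z : supported K M c -> cj z * comb K M c z = comb K.+1 M (raise c) z.
Proof.
move=> sc; rewrite /comb (pairE K M (fun k m => c k m * landau k m z)) (pairE K.+1 M (fun k m => raise c k m * landau k m z)).
transitivity (\sum_(k < K) \sum_(m < M) (rt R k.+1 * c k m * landau k.+1 m z) +
   \sum_(k < K) \sum_(m < M) (rt R m * c k m * landau k m.-1 z)).
  rewrite mulr_sumr -big_split /=; apply: eq_bigr => k _.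
  rewrite mulr_sumr -big_split /=; apply: eq_bigr => m _.
  have r := rtV R k; rewrite mulrCA -[RHS]/(_ * ((rt R k.+1)^-1 * (cj z * landau k m z - rt R m * landau k m.-1 z)) + _).
  transitivity (c k m * (rt R k.+1 / rt R k.+1) * (cj z * landau k m z - rt R m * landau k m.-1 z) + rt R m * c k m * landau k m.-1 z); last by ring.
  by rewrite r; ring.
transitivity (\sum_(k < K.+1) \sum_(m < M) (raise_l c k m * landau k m z) +
   \sum_(k < K.+1) \sum_(m < M) (lower_a c k m * landau k m z)); last first.
  rewrite -big_split /=; apply: eq_bigr => k _.
  by rewrite -big_split /=; apply: eq_bigr => m _; rewrite /raise mulrDl.
congr (_ + _).
  by rewrite [RHS]big_ord_recl /= [X in _ = X + _]big1 ?add0r // => m _; rewrite mul0r.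
rewrite [RHS]big_ord_recr /= [X in _ = _ + X]big1 ?addr0; last first.
  by move=> m _; rewrite /lower_a sc ?leqnn // mulr0 mul0r.
apply: eq_bigr => k _; case: M sc => [|M] sc; first by rewrite !big_ord0.
rewrite [LHS]big_ord_recl [RHS]big_ord_recr /= rt0 !mul0r add0r /lower_a.
by rewrite [X in _ = _ + X](_ : _ = 0) ?addr0 // sc ?leqnn ?orbT // mulr0 mul0r.
Qed.

Lemma sqn_young (th : R) (a b : R[i]) : 0 < th ->
  sqn (a + b) <= (1 + th^-1) * sqn a + (1 + th) * sqn b.
Proof.
move=> th0; rewrite /sqn !ReD !ImD.
have key (x y : R) : (x + y) ^+ 2 <= (1 + th^-1) * x ^+ 2 + (1 + th) * y ^+ 2.
  have -> : (1 + th^-1) * x ^+ 2 + (1 + th) * y ^+ 2 = (x + y) ^+ 2 + th * (th^-1 * x - y) ^+ 2.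
    by field; rewrite gt_eqF.
  by rewrite lerDl mulr_ge0 ?sqr_ge0 // ltW.
have := key (complex.Re a) (complex.Re b); have := key (complex.Im a) (complex.Im b); lra.
Qed.

(** The large constant 1 + th^-1 falls on the number of levels, which stays fixed while M grows; the
    angular shift costs only 1 + th times M. *)
Lemma raise_nsq (th : R) K M c : 0 < th -> supported K M c ->
  coef_nsq K.+1 M (raise c) <= ((1 + th^-1) * K%:R + (1 + th) * M%:R) * coef_nsq K M c.
Proof.
move=> th0 sc; have t0 : 0 <= 1 + th^-1 by rewrite addr_ge0 ?invr_ge0 // ltW.
have t1 : 0 <= 1 + th by rewrite addr_ge0 // ltW.
have sqn0 : sqn 0 = 0 :> R by rewrite /sqn /= expr0n addr0.
apply: le_trans (_ : (1 + th^-1) * coef_nsq K.+1 M (raise_l c) + (1 + th) * coef_nsq K.+1 M (lower_a c) <= _).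
  by rewrite /coef_nsq !mulr_sumr -big_split /=; apply: ler_sum => p _; exact: sqn_young.
rewrite [leRHS]mulrDl -[X in _ <= X + _]mulrA -[X in _ <= _ + X]mulrA; apply: lerD; apply: ler_wpM2l => //.
  rewrite /coef_nsq (pairER K.+1 M (fun k m => sqn (raise_l c k m))) (pairER K M (fun k m => sqn (c k m))).
  rewrite big_ord_recl /= [X in X + _]big1 ?add0r => [|m _]; last exact: sqn0.
  rewrite mulr_sumr; apply: ler_sum => k _; rewrite mulr_sumr; apply: ler_sum => m _.
  by rewrite sqnM sqn_rt; apply: ler_wpM2r; [exact: sqn_ge0|rewrite ler_nat ltn_ord].
rewrite /coef_nsq (pairER K.+1 M (fun k m => sqn (lower_a c k m))) (pairER K M (fun k m => sqn (c k m))).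
rewrite big_ord_recr /= [X in _ + X]big1 ?addr0 => [|m _]; last first.
  by rewrite /lower_a sc ?leqnn // mulr0 sqn0.
rewrite mulr_sumr; apply: ler_sum => k _; case: M sc => [|M] sc; first by rewrite !big_ord0 mulr0.
rewrite mulr_sumr [leLHS]big_ord_recr [leRHS]big_ord_recl /= {2}/lower_a sc ?leqnn ?orbT // mulr0 sqn0 addr0.
apply: ler_wpDl; first by rewrite mulr_ge0 ?sqn_ge0.
apply: ler_sum => m _; rewrite /lower_a sqnM sqn_rt; apply: ler_wpM2r; first exact: sqn_ge0.
by rewrite ler_nat ltnS ltnW // ltn_ord.
Qed.

(** The squared norm of the left-hand side is the moment of order p in |z|^2. Each of the p
    multiplications is charged with the largest number of levels, K + p. *)
Lemma comb_raise_iter K M p c : supported K M c -> exists c', supported (K + p) M c' /\ (forall z, cj z ^+ p * comb K M c z = comb (K + p) M c' z) /\ forall th : R, 0 < th -> coef_nsq (K + p) M c' <=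
    ((1 + th^-1) * (K + p)%:R + (1 + th) * M%:R) ^+ p * coef_nsq K M c.
Proof.
move=> sc; elim: p => [|p [c' [sc' [ec' nc']]]].
  by exists c; rewrite addn0; split=> //; split=> [z|th th0]; rewrite expr0 mul1r.
exists (raise c'); rewrite addnS; split; first exact: supported_raise.
split=> [z|th th0]; first by rewrite exprS -mulrA ec' comb_raise.
apply: le_trans (raise_nsq th0 sc') _.
have t0 : 0 <= 1 + th^-1 by rewrite addr_ge0 ?invr_ge0 // ltW.
have t1 : 0 <= 1 + th by rewrite addr_ge0 // ltW.
have le1 : (1 + th^-1) * (K + p)%:R + (1 + th) * M%:R <= (1 + th^-1) * (K + p).+1%:R + (1 + th) * M%:R.
  by rewrite lerD2r; apply: ler_wpM2l => //; rewrite ler_nat.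
have b0 : 0 <= (1 + th^-1) * (K + p)%:R + (1 + th) * M%:R by rewrite addr_ge0 ?mulr_ge0.
have n0 : 0 <= coef_nsq K M c by apply: sumr_ge0 => q _; exact: sqn_ge0.
rewrite exprS -mulrA; apply: ler_pM => //; first by apply: sumr_ge0 => q _; exact: sqn_ge0.
apply: le_trans (nc' th th0) _; apply: ler_wpM2r => //.
by rewrite lerXn2r // nnegrE // (le_trans b0).
Qed.

End Raising.

(** * Counting eigenvalues of a tiling domain *)

Section TilingCount.
Variable R : realType.
Notation R' := (measurableTypeR R).
Notation T2 := (R' * R')%type.
Local Notation mu := (leb2 R).
Notation X := (R * R -> R[i]^o : lmodType R[i]).
Variables (B : R) (Om : set (R * R)).
Hypothesis B_gt0 : 0 < B.
Hypothesis Om_open : open Om.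
Hypothesis Om_fin : (mu Om < +oo)%E.
Hypothesis Om_bounded : bounded_set Om.
Hypothesis disc : discrete_spectrum Om (magnetic_neumann Om (homogeneous_field B)).
Variables (I : Type) (ang : I -> R) (sh : I -> R * R).
Definition tile i : set (R * R) := rigid (ang i) (sh i) @` Om.
Hypothesis tile_disjoint : trivIset [set: I] tile.
Hypothesis tile_cover : mu.-negligible (~` \bigcup_i tile i).
Local Notation ipO := (inner Om : X -> X -> R[i]).
Local Notation qO := (magnetic_form Om (homogeneous_field B) : X -> X -> R[i]).
Local Notation pb i f := (pullback B (ang i) (sh i) f).

Let mOm : measurable (Om : set T2).
Proof. exact: open2_measurable. Qed.

Let m_tile i : measurable (tile i : set T2).
Proof. exact: rigid_image_measurable. Qed.

Definition density : R := B / (2 * pi) * fine (mu Om).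

(** [s'] is the least of [s] and the finitely many values above [E], so orthogonality is needed only
    against values at most [E]. The gain from [E] to [s'] is the factor that produces the
    contradiction in [eigenvalue_count]. *)
Lemma spectral_gap N (psi : 'I_N -> X) (m : 'I_N -> R) (s E : R) : orthonormal ipO psi ->
  (forall i, graph (inL2 Om : X -> Prop) (form_domain Om (homogeneous_field B) : X -> Prop) ipO qO (psi i) (rc (m i) *: psi i)) ->
  (forall f, form_domain Om (homogeneous_field B) f -> (forall i, ipO f (psi i) = 0) -> s * nsq ipO f <= nsq qO f) ->
  E < s -> exists2 s', E < s' & forall f, form_domain Om (homogeneous_field B) f ->
    (forall i, m i <= E -> ipO f (psi i) = 0) -> s' * nsq ipO f <= nsq qO f.
Proof.
move=> on eig low Es.
pose s' := \big[Num.min/s]_(j < N | E < m j) m j.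
have s's : s' <= s by exact: bigmin_le_id.
have s'm j : E < m j -> s' <= m j by move=> h; exact: bigmin_le_cond.
have Lpsi j : inL2 Om (psi j) by case: (eig j) => -[].
exists s'; first by rewrite /s'; elim/big_ind : _ => // x y hx hy; rewrite lt_min hx.
move=> f Df orth; have Lf : inL2 Om f by case: Df.
have := spectral_lower (inner_sip mOm) (magnetic_sip Om_open (@homogeneous_field_continuous1 R B) (@homogeneous_field_continuous2 R B))
  (fun u (h : form_domain Om (homogeneous_field B) u) => let: And4 h1 _ _ _ := h in h1) on eig low Df.
have bes := bessel (inner_sip mOm) Lpsi on Lf.
apply: le_trans.
apply: le_trans (_ : s' * \sum_(i < N) sqn (ipO f (psi i)) + s' * (nsq ipO f - \sum_(i < N) sqn (ipO f (psi i))) <= _).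
  by rewrite -mulrDr addrC subrK.
apply: lerD; last by apply: ler_wpM2r => //; rewrite subr_ge0.
rewrite mulr_sumr; apply: ler_sum => j _; have [mE|Em] := leP (m j) E.
  by rewrite orth // /sqn /= expr0n addr0 !mulr0.
by apply: ler_wpM2r; [exact: sqn_ge0|exact: s'm].
Qed.

Lemma tile_diameter : exists2 D : R, 0 <= D &
  forall i x y, tile i x -> tile i y -> sqn (lcoord B x - lcoord B y) <= D.
Proof.
have [M [_ hM]] := Om_bounded; pose M' := `|M| + 1.
have bd x : Om x -> `|x| <= M' by move=> Ox; apply: hM => //; rewrite /M' (le_lt_trans (ler_norm M)) // ltrDl.
have M0 : 0 <= M' by rewrite addr_ge0.
(* Two points of Om differ by at most 2 M' in each of the two coordinates; B / 2 is the square of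
   the scale of [lcoord]. *)
exists (B / 2 * (2 * (2 * M') ^+ 2)); first by rewrite mulr_ge0 ?divr_ge0 ?(ltW B_gt0) // mulr_ge0 ?sqr_ge0.
move=> i _ _ [x Ox <-] [y Oy <-]; rewrite !lcoord_rigid.
have -> : aff (rot_coef B (ang i)) (shift_coef B (sh i)) x - aff (rot_coef B (ang i)) (shift_coef B (sh i)) y =
  rot_coef B (ang i) * ((x.1 +i* x.2) - (y.1 +i* y.2)) by rewrite /aff; ring.
rewrite sqnM sqn_rot_coef //; apply: ler_wpM2l; first by rewrite divr_ge0 // ltW.
have le1 (u v : R) : `|u| <= M' -> `|v| <= M' -> (u - v) ^+ 2 <= (2 * M') ^+ 2.
  move=> hu hv; rewrite -real_normK ?num_real // lerXn2r ?nnegrE ?mulr_ge0 //.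
  by apply: le_trans (ler_normB _ _) _; lra.
have n1 (u : R * R) : `|u.1| <= `|u| /\ `|u.2| <= `|u|.
  by rewrite prod_normE /= !le_max !lexx orbT.
have [x1 x2] := n1 x; have [y1 y2] := n1 y; have hx := bd x Ox; have hy := bd y Oy.
rewrite mulr_natl mulr2n /sqn; apply: lerD; rewrite ?ReD ?ImD ?ReN ?ImN /=; apply: le1; exact: le_trans hx || exact: le_trans hy.
Qed.

Let landau0_nsq m : sqnorm setT (on_plane B (landau 0 m)) = 1%E.
Proof.
by rewrite (on_plane_sqnorm B_gt0 (nice_landau R 0 m)) /nsq /rip landau_orthonormal // !eqxx.
Qed.

Let tile_mass i f : nice f -> sqnorm (tile i) (on_plane B f) = sqnorm Om (pb i f).
Proof. by move=> nf; rewrite pullback_sqnorm. Qed.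

Lemma tile_landau_mass i J (d : R) : 0 <= d ->
  (forall x, tile i x -> d <= landau_sum 0 J (lcoord B x)) ->
  ((d * density)%:E <= \sum_(m < J) sqnorm (tile i) (on_plane B (landau 0 m)))%E.
Proof.
move=> d0 hd; have c0 : 0 <= B / (2 * pi) by rewrite divr_ge0 ?mulr_ge0 ?pi_ge0 // ltW.
have -> : (\sum_(m < J) sqnorm (tile i) (on_plane B (landau 0 m)) = \sum_(m < J) \int[mu]_(x in Om) (sqn (pb i (landau 0 m) x))%:E)%E.
  by apply: eq_bigr => m _; rewrite tile_mass //; exact: nice_landau.
rewrite -(@ge0_integral_sum _ T2 R mu Om mOm _ (fun (m : 'I_J) x => (sqn (pb i (landau 0 m) x))%:E)); last 2 first.
- move=> m; apply: ccontinuous_sqn_measurable => //.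
  by apply: ccontinuous_pullback; exact: nice_landau.
- by move=> m x _; rewrite lee_fin sqn_ge0.
have -> : ((d * density)%:E = \int[mu]_(x in Om) (d * (B / (2 * pi)))%:E)%E.
  by rewrite (@integral_cst _ T2 R mu Om mOm) /density mulrA [LHS]EFinM fineK // ge0_fin_numE.
apply: ge0_le_integral => //.
- by move=> x _; rewrite lee_fin mulr_ge0.
- apply: emeasurable_sum => m; apply: ccontinuous_sqn_measurable => //.
  by apply: ccontinuous_pullback; exact: nice_landau.
move=> x Ox; rewrite sumEFin lee_fin.
under eq_bigr do rewrite /pullback sqnM sqn_phase mul1r /on_plane sqnM sqn_rc c0_sqr //.
rewrite -mulr_sumr mulrC; apply: ler_wpM2l => //; apply: hd; by exists x.
Qed.

Lemma tile_sub_trivIset n (s : 'I_n -> I) : injective s -> trivIset [set: 'I_n] (tile \o s).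
Proof. by move=> si i j _ _ h; apply: si; exact: tile_disjoint h. Qed.

(* The factor t absorbs the error terms: t^3 J bounds the disc which contains the
   tiles, and about t^4 J lowest level functions almost sum to B / (2 pi) there. *)
Lemma tile_count (t : R) : 1 < t -> exists J0 : nat, forall J, (J0 <= J)%N -> forall n (s : 'I_n -> I),
  injective s -> (forall i x, tile (s i) x -> sqn (lcoord B x) <= t ^+ 3 * J%:R) ->
  n%:R * density <= t ^+ 6 * J%:R.
Proof.
move=> t1; have t0 : 0 < t by lra.
(* Chernoff's bound with parameter t at |z|^2 = K / t is q^K, and q < 1 is exp x > 1 + x at x = 1/t
   - 1. *)
pose q := expR (1 - t^-1) / t.
have q0 : 0 <= q by rewrite divr_ge0 ?expR_ge0 // ltW.
have tV1 : t^-1 < 1 by rewrite invf_lt1.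
have q1 : q < 1.
  rewrite ltr_pdivrMr // mul1r -[ltRHS]invrK.
  have -> : 1 - t^-1 = - (t^-1 - 1) by ring.
  rewrite expRN ltf_pV2 ?posrE ?expR_gt0 ?invr_gt0 //.
  have e : 1 + (t^-1 - 1) = t^-1 by ring.
  have := @expR_gt1Dx R (t^-1 - 1); rewrite e; apply.
  by rewrite subr_eq0 lt_eqF.
have tV0 : 0 < 1 - t^-1 by rewrite subr_gt0.
have [J1 hJ1] := geometric_small q0 q1 tV0.
(* Ensures t^5 J - t^4 J >= 1, so that rounding t^4 J up to an integer stays below t^5 J. *)
have [J2 hJ2] := nat_above ((t ^+ 5 - t ^+ 4)^-1).
exists (maxn J1 J2) => J; rewrite geq_max => /andP[JJ1 JJ2] n s si hs.
have t54 : 0 < t ^+ 5 - t ^+ 4 by rewrite subr_gt0 ltr_eXn2l.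
have J2R : (J2%:R : R) <= J%:R by rewrite ler_nat.
have step : t ^+ 4 * J%:R + 1 <= t ^+ 5 * J%:R.
  have : (t ^+ 5 - t ^+ 4)^-1 <= J%:R by exact: le_trans hJ2 J2R.
  by rewrite -(ler_pM2l t54) divff ?gt_eqF //; lra.
have x0 : 0 <= t ^+ 4 * J%:R by rewrite mulr_ge0 ?exprn_ge0 // ltW.
have /andP[k1 k2] := truncn_itv x0; set K := (Num.truncn (t ^+ 4 * J%:R)).+1 in k2.
have K5 : K%:R <= t ^+ 5 * J%:R by apply: le_trans step; rewrite /K -natr1 lerD2r.
have JK : (J <= K)%N.
  rewrite -(ler_nat R); apply: le_trans (ltW k2); rewrite -[leLHS]mul1r; apply: ler_wpM2r => //.
  by rewrite exprn_ege1 // ltW.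
have low z : sqn z <= t ^+ 3 * J%:R -> t^-1 <= landau_sum 0 K z.
  move=> hz; apply: le_trans (landau_sum_tail K z (ltW t1)).
  suff : expR ((t - 1) * sqn z) / t ^+ K <= 1 - t^-1 by lra.
  apply: le_trans (_ : q ^+ K <= _); last first.
    by apply: le_trans (ltW hJ1); apply: ler_wiXn2l => //; [exact: ltW|exact: leq_trans JJ1 JK].
  rewrite /q expr_div_n -expRM_natl; apply: ler_wpM2r; first by rewrite invr_ge0 exprn_ge0 // ltW.
  rewrite ler_expR; have -> : K%:R * (1 - t^-1) = (t - 1) * (K%:R / t) by field; rewrite gt_eqF.
  apply: ler_wpM2l; first by lra.
  rewrite ler_pdivlMr //; apply: le_trans (ltW k2); rewrite exprS -mulrA [leLHS]mulrC.
  by apply: ler_wpM2l => //; exact: ltW.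
(* The masses of K functions on n tiles are summed in both orders: each tile holds at least density
   / t, and each normalized function at most 1. *)
have h : (((n%:R * (t^-1 * density))%:E <= (K%:R)%:E))%E.
  apply: le_trans (_ : \sum_(i < n) \sum_(m < K) sqnorm (tile (s i)) (on_plane B (landau 0 m)) <= _)%E.
    have -> : (n%:R * (t^-1 * density))%:E = (\sum_(i < n) (t^-1 * density)%:E)%E.
      by rewrite sumEFin sumr_const card_ord mulr_natl.
    apply: lee_sum => i _; apply: tile_landau_mass; first by rewrite invr_ge0 ltW.
    by move=> x /hs/low.
  rewrite exchange_big /=; have -> : (K%:R)%:E = (\sum_(m < K) (1 : R)%:E)%E.
    by rewrite sumEFin sumr_const card_ord.
  apply: lee_sum => m _; rewrite -(landau0_nsq m).
  apply: (@tiles_sqnorm_le R n (fun i => tile (s i))) => //.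
    exact: tile_sub_trivIset.
  exact: (ccontinuous_on_plane B (nice_landau R 0 m)).
rewrite lee_fin mulrCA in h.
have : t^-1 * (n%:R * density) <= t ^+ 5 * J%:R by exact: le_trans h K5.
move=> h'; have := ler_wpM2l (ltW t0) h'.
by rewrite mulrA mulfV ?gt_eqF // mul1r => /le_trans; apply; rewrite mulrA -exprS.
Qed.

Lemma eigenvalue_count N (psi : 'I_N -> X) (m : 'I_N -> R) (s : R) (l : nat) : 0 < density ->
  orthonormal ipO psi ->
  (forall i, graph (inL2 Om : X -> Prop) (form_domain Om (homogeneous_field B) : X -> Prop) ipO qO (psi i) (rc (m i) *: psi i)) ->
  (forall f, form_domain Om (homogeneous_field B) f -> (forall i, ipO f (psi i) = 0) -> s * nsq ipO f <= nsq qO f) ->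
  level B l < s -> density * l.+1%:R <= #|[pred j | m j <= level B l]|%:R.
Proof.
move=> dpos on eig low Es; set E := level B l in Es *; set N' := #|_|.
rewrite leNgt; apply/negP => few.
have Lpsi j : inL2 Om (psi j) by case: (eig j) => -[].
have E0 : 0 < E by rewrite /E /level mulr_gt0 // ltr_wpDl // mulr_ge0.
have [s' Es' gap] := spectral_gap on eig low Es.
have s'0 : 0 < s' by exact: lt_trans Es'.
(* Half of the assumed deficit pays for the factor t^6 lost in [tile_count]; the other half keeps
   the count of conditions strictly below that of the unknowns. *)
pose b' := (N'%:R + density * l.+1%:R) / 2.
have nb' : N'%:R < b' by rewrite /b'; lra.
have [t [t1 ht]] := factor_above 6 (ler0n R N') nb'.
have t0 : 0 < t by lra.
(* The mass beyond the disc will be at most t^-p of the total; [p] makes this smaller than the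
   relative gain 1 - E / s'. It is fixed before [J], so [J] can outweigh it. *)
have [p hp] := @geometric_small R t^-1 (1 - E / s') ltac:(by rewrite invr_ge0 ltW) ltac:(by rewrite invf_lt1)
  ltac:(by rewrite subr_gt0 ltr_pdivrMr // mul1r).
have [J0 hJ0] := tile_count t1.
have [D D0 hD] := tile_diameter.
pose th := (t - 1) / 2; have th0 : 0 < th by rewrite /th; lra.
have tE : t = 1 + th + th by rewrite /th; field.
(* [J1] makes the factor of each multiplication in [comb_raise_iter] at most t J; [J2] makes the
   diameter of a tile negligible against the disc. *)
have [J1 hJ1] := nat_above ((1 + th^-1) * (l.+1 + p)%:R / th).
have [J2 hJ2] := nat_above ((1 + th^-1) * D / th).
pose J := (maxn J0 (maxn J1 J2)).+1.
have [JJ0 JJ1 JJ2] : [/\ (J0 <= J)%N, (J1%:R : R) <= J%:R & (J2%:R : R) <= J%:R].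
  by rewrite !ler_nat /J; split; apply: leqW; rewrite !leq_max leqnn ?orbT.
have J0R : (0 : R) < J%:R by rewrite ltr0n.
have c1 : (1 + th^-1) * (l.+1 + p)%:R + (1 + th) * J%:R <= t * J%:R.
  have := le_trans hJ1 JJ1; rewrite ler_pdivrMr // => h.
  by rewrite [in leRHS]tE; lra.
have t2J : J%:R <= t ^+ 2 * J%:R by rewrite -[leLHS]mul1r ler_wpM2r // exprn_ege1 // ltW.
have c2 : (1 + th^-1) * D + (1 + th) * (t ^+ 2 * J%:R) <= t ^+ 3 * J%:R.
  have := le_trans hJ2 JJ2; rewrite ler_pdivrMr // => h.
  have -> : t ^+ 3 * J%:R = (1 + th + th) * (t ^+ 2 * J%:R) by rewrite -tE; ring.
  have := ler_wpM2r (ltW th0) t2J; lra.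
pose rho := t ^+ 2 * J%:R; have rho0 : 0 < rho by rewrite mulr_gt0 ?exprn_gt0.
(* Every tile meeting the disc |w|^2 < t^2 J is used; by [c2] it lies in the disc |w|^2 <= t^3 J
   required by [tile_count]. *)
pose near_disc i := exists2 x, tile i x & sqn (lcoord B x) < rho.
have near_sub i : near_disc i -> forall x, tile i x -> sqn (lcoord B x) <= t ^+ 3 * J%:R.
  move=> [y ty yr] x tx; apply: le_trans c2; rewrite -[lcoord B x](subrK (lcoord B y)).
  apply: le_trans (sqn_young _ _ th0) _; apply: lerD; apply: ler_wpM2l.
  - by rewrite addr_ge0 ?invr_ge0 // ltW.
  - exact: hD tx ty.
  - by rewrite addr_ge0 // ltW.
  - exact: ltW.
have cnt n (sg : 'I_n -> I) : injective sg -> (forall i, near_disc (sg i)) -> n%:R * density <= t ^+ 6 * J%:R.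
  by move=> si sn; apply: (hJ0 J JJ0 n sg si) => i; exact: near_sub.
have [bn hbn] := nat_above (t ^+ 6 * J%:R / density).
have cnt_nat n (sg : 'I_n -> I) : injective sg -> (forall i, near_disc (sg i)) -> (n <= bn)%N.
  move=> si sn; rewrite -(ler_nat R); apply: le_trans hbn; rewrite ler_pdivlMr //.
  exact: (cnt n sg).
have [n [sg [si sn sc]]] := finite_cover cnt_nat.
have few_conditions : (n * N' < l.+1 * J)%N.
  rewrite -(ltr_nat R) !natrM -(ltr_pM2r dpos).
  apply: (@le_lt_trans _ _ (N'%:R * (t ^+ 6 * J%:R))).
    by rewrite mulrAC [leLHS]mulrC; apply: ler_wpM2l => //; exact: (cnt n sg si sn).
  rewrite mulrA; apply: le_lt_trans (ler_wpM2r (ltW J0R) ht) _.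
  have hb : b' < density * l.+1%:R by rewrite /b'; lra.
  have -> : l.+1%:R * J%:R * density = density * l.+1%:R * J%:R by ring.
  by rewrite ltr_pM2r.
pose T := ('I_l.+1 * 'I_J)%type; pose U := ('I_n * {j : 'I_N | m j <= E})%type.
have [c [[p0 cp0] hc]] := @kernel_vector R[i] T U
  (fun x y => ipO (pb (sg y.1) (landau x.1 x.2)) (psi (val y.2))) ltac:(by rewrite !card_prod !card_ord card_sig).
(* Extension by 0 to all pairs of natural numbers, as [comb] and [raise] expect; the sum has at most
   one term. *)
pose c' (k j : nat) := \sum_(x : T | (x.1 == k :> nat) && (x.2 == j :> nat)) c x.
have c'E (x : T) : c' x.1 x.2 = c x.
  by rewrite /c' (big_pred1 x) // => y; rewrite -[y == x]/((y.1 == x.1) && (y.2 == x.2)).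
have sc' : supported l.+1 J c'.
  move=> k j h; rewrite /c' big_pred0 // => -[x y] /=; apply/negP => /andP[/eqP e1 /eqP e2].
  by move: h; rewrite -e1 -e2 leqNgt ltn_ord leqNgt ltn_ord.
pose u := comb l.+1 J c'; have nu : nice u by exact: nice_comb.
pose C := coef_nsq l.+1 J c'.
have C0 : 0 < C.
  rewrite /C /coef_nsq (bigD1 p0) //= ltr_pwDl //; last by apply: sumr_ge0 => x _; exact: sqn_ge0.
  rewrite lt_neqAle sqn_ge0 andbT eq_sym c'E; apply: contra cp0 => /eqP h.
  by apply/eqP; exact: sqn0_eq0.
pose v i : X := pb (sg i) u.
have vE i : v i = \sum_(x : T) c x *: (pb (sg i) (landau x.1 x.2) : X).
  apply/funext => y; rewrite fct_sumE /v /pullback /on_plane /u /comb !mulr_sumr.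
  by apply: eq_bigr => x _; rewrite c'E -[RHS]/(c x * _); ring.
have orth i j : m j <= E -> ipO (v i) (psi j) = 0.
  move=> mj; rewrite vE (ip_suml (inner_sip mOm)) //; last first.
    by move=> x; apply: pullback_inL2 => //; exact: nice_landau.
  exact: (hc (i, exist _ j mj)).
have vform i := pullback_form B_gt0 (ang (sg i)) (sh (sg i)) Om_open (@ladder_comb R l.+1 J c') nu (nice_comb_up l.+1 J c') (nice_comb_down l.+1 J c').
have lowv : s' * \sum_(i < n) nsq ipO (v i) <= \sum_(i < n) nsq qO (v i).
  rewrite mulr_sumr; apply: ler_sum => i _; apply: gap; first by case: (vform i).
  by move=> j mj; exact: orth.
have tts := tile_sub_trivIset si.
(* The shifted combinations lose mass when restricted to the tiles, and on the plane their masses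
   add up to sums weighted by (k + 1) + k <= 2 l + 1. *)
have upper : \sum_(i < n) nsq qO (v i) <= E * C.
  rewrite -lee_fin -sumEFin.
  have -> : (\sum_(i < n) (nsq qO (v i))%:E = B%:E * (\sum_(i < n) sqnorm (tile (sg i)) (on_plane B (comb_up l.+1 J c'))
      + \sum_(i < n) sqnorm (tile (sg i)) (on_plane B (comb_down l.+1 J c'))))%E.
    rewrite -big_split /= ge0_sume_distrr.
      by apply: eq_bigr => i _; have [_ ->] := vform i.
    by move=> i _; rewrite adde_ge0 //; apply: integral_ge0 => x _; rewrite lee_fin sqn_ge0.
  apply: le_trans (_ : B%:E * (sqnorm setT (on_plane B (comb_up l.+1 J c')) + sqnorm setT (on_plane B (comb_down l.+1 J c'))) <= _)%E.
    apply: lee_wpmul2l; first by rewrite lee_fin ltW.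
    apply: leeD; apply: (@tiles_sqnorm_le R n (fun i => tile (sg i))) => //; apply: ccontinuous_on_plane.
      exact: nice_comb_up.
    exact: nice_comb_down.
  rewrite (on_plane_sqnorm B_gt0 (nice_comb_up _ _ _)) (on_plane_sqnorm B_gt0 (nice_comb_down _ _ _)) comb_up_nsq // comb_down_nsq //.
  rewrite -EFinD -EFinM lee_fin /E /level -mulrA ler_pM2l // -big_split /= /C /coef_nsq mulr_sumr.
  apply: ler_sum => x _; rewrite -mulrDr mulrC; apply: ler_wpM2r; first exact: sqn_ge0.
  have : (x.1%:R : R) <= l%:R by rewrite ler_nat -ltnS ltn_ord.
  by rewrite -natr1; lra.
pose out : set T2 := [set x | rho <= sqn (lcoord B x)].
have mout : measurable out.
  have cl : ccontinuous (lcoord B) by exact: ccontinuous_aff.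
  have /measurable_EFinP mf := ccontinuous_sqn_measurable (measurableT : measurable [set: T2]) cl.
  rewrite -[out]setTI (_ : out = (fun x : T2 => sqn (lcoord B x)) @^-1` `[rho, +oo[).
    by apply: mf => //; exact: measurable_itv.
  by apply/seteqP; split=> x /=; rewrite in_itv /= andbT.
have total : (C%:E <= \sum_(i < n) sqnorm (tile (sg i)) (on_plane B u) + sqnorm out (on_plane B u))%E.
  have -> : (C%:E = sqnorm setT (on_plane B u))%E by rewrite (on_plane_sqnorm B_gt0 nu) comb_nsq.
  apply: (@tiles_sqnorm_ge R n (fun i => tile (sg i))) => //; first exact: ccontinuous_on_plane.
  apply: negligibleS tile_cover => x /= h [i _ tx]; apply: h.
  have [xr|xr] := leP rho (sqn (lcoord B x)); first by right.
  by left; have [j ej] := sc i (ex_intro2 _ _ x tx xr); exists j => //; rewrite ej.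
(* Outside the disc |w|^(2 p) >= rho^p, and the moment is at most (t J)^p C; the quotient is t^-p C
   because rho = t^2 J. *)
have outside : (sqnorm out (on_plane B u) <= ((t^-1) ^+ p * C)%:E)%E.
  have [d [sd [ed nd]]] := comb_raise_iter p sc'.
  have nd' := nd th th0.
  have nice_d : nice (comb (l.+1 + p) J d) by exact: nice_comb.
  apply: le_trans (_ : ((rho ^+ p)^-1)%:E * sqnorm setT (on_plane B (comb (l.+1 + p) J d)) <= _)%E; last first.
    rewrite (on_plane_sqnorm B_gt0 nice_d) comb_nsq // -EFinM lee_fin ler_pdivrMl ?exprn_gt0 //.
    apply: le_trans nd' _; rewrite mulrA; apply: ler_wpM2r; first exact: ltW.
    have -> : rho ^+ p * t^-1 ^+ p = (t * J%:R) ^+ p by rewrite -exprMn; congr (_ ^+ _); rewrite /rho; field; rewrite gt_eqF.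
    by rewrite lerXn2r ?nnegrE ?mulr_ge0 ?addr_ge0 ?mulr_ge0 ?addr_ge0 ?invr_ge0 ?(ltW th0) ?(ltW t0).
  rewrite !sqnormE_sqn -ge0_integralZl //; last 3 first.
  - by apply: ccontinuous_sqn_measurable => //; exact: ccontinuous_on_plane.
  - by move=> x _; rewrite lee_fin sqn_ge0.
  - by rewrite lee_fin invr_ge0 exprn_ge0 // ltW.
  apply: le_trans (_ : \int[mu]_(x in out) ((rho ^+ p)^-1%:E * (sqn (on_plane B (comb (l.+1 + p) J d) x))%:E) <= _)%E; last first.
    apply: ge0_subset_integral => //.
      by apply: emeasurable_funM => //; apply: ccontinuous_sqn_measurable => //; exact: ccontinuous_on_plane.
    by move=> x _; rewrite mule_ge0 // lee_fin ?sqn_ge0 // invr_ge0 exprn_ge0 // ltW.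
  apply: ge0_le_integral => //.
  - by move=> x _; rewrite lee_fin sqn_ge0.
  - by apply: ccontinuous_sqn_measurable => //; exact: ccontinuous_on_plane.
  - by apply: emeasurable_funM => //; apply: ccontinuous_sqn_measurable => //; exact: ccontinuous_on_plane.
  move=> x /= xr; rewrite -EFinM lee_fin ler_pdivlMl ?exprn_gt0 //.
  have -> : on_plane B (comb (l.+1 + p) J d) x = cj (lcoord B x) ^+ p * on_plane B u x by rewrite /on_plane -ed mulrCA.
  rewrite sqnM; apply: ler_wpM2r; first exact: sqn_ge0.
  have -> : sqn (cj (lcoord B x) ^+ p) = sqn (lcoord B x) ^+ p.
    by elim: (p) => [|j IH]; rewrite ?expr0 ?exprS ?sqnM ?IH ?sqnJ // /sqn /= expr1n expr0n addr0.
  by rewrite lerXn2r ?nnegrE ?sqn_ge0 // ltW.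
have inside : (1 - t^-1 ^+ p) * C <= \sum_(i < n) nsq ipO (v i).
  suff : C <= \sum_(i < n) nsq ipO (v i) + t^-1 ^+ p * C by lra.
  rewrite -lee_fin EFinD; apply: le_trans total _; apply: leeD => //.
  rewrite -sumEFin; apply: lee_sum => i _.
  rewrite tile_mass // (sqnorm_nsq mOm) //; exact: pullback_inL2.
have h1 : s' * ((1 - t^-1 ^+ p) * C) <= E * C.
  by apply: le_trans upper; apply: le_trans lowv; apply: ler_wpM2l => //; exact: ltW.
rewrite mulrA ler_pM2r // in h1.
have h2 : E / s' < 1 - t^-1 ^+ p by lra.
by move: h1; rewrite leNgt mulrC -ltr_pdivrMr // h2.
Qed.

End TilingCount.

(** * From eigenvalue counts to traces *)

Section AbelSummation.
Variable R : realType.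

Lemma neg_pow_eq0 (g s : R) : 0 <= s -> neg_pow g s = 0.
Proof.
move=> s0; rewrite /neg_pow; case: ifPn => [_|g0]; first by rewrite ltNge s0.
by rewrite max_r ?oppr_le0 // powR0.
Qed.

Lemma neg_pow_anti (g s s' : R) : 0 <= g -> s <= s' -> neg_pow g s' <= neg_pow g s.
Proof.
move=> g0 ss; rewrite /neg_pow; case: ifP => _.
  by rewrite ler_nat; case: (ltP s' 0) => // h; rewrite (le_lt_trans ss h).
have m0 (y : R) : Num.max y 0 \is Num.nneg by rewrite nnegrE le_max lexx orbT.
apply: ge0_ler_powR; rewrite ?m0 //.
by rewrite ge_max !le_max lerN2 ss lexx orbT.
Qed.

(* Abel's summation for the trace, one eigenvalue [x] at a time. *)
Lemma layer_sum_le (phi : R -> R) (e : nat -> R) (K : nat) (x : R) :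
  (forall x, 0 <= phi x) -> {homo phi : x y /~ x <= y} -> {homo e : i j / (i <= j)%N >-> i <= j} ->
  \sum_(k < K) (phi (e k) - phi (e k.+1)) * (x <= e k)%R%:R <=
    if x <= e K then phi x - phi (e K) else 0.
Proof.
move=> phi0 dphi he; elim: K => [|K IH].
  by rewrite big_ord0; case: ifP => // h; rewrite subr_ge0 dphi.
rewrite big_ord_recr /=; have eK : e K <= e K.+1 by exact: he.
have [xK|Kx] := leP x (e K).
  by rewrite xK in IH; rewrite (le_trans xK eK) mulr1; lra.
rewrite mulr0 addr0; apply: le_trans IH _; rewrite (leNgt x (e K)) Kx /=.
by case: ifP => // h; rewrite subr_ge0 dphi.
Qed.

Lemma sum_by_parts (a : nat -> R) (K : nat) :
  \sum_(k < K) (a k - a k.+1) * k.+1%:R = \sum_(k < K) a k - K%:R * a K.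
Proof.
elim: K => [|K IH]; first by rewrite !big_ord0 mul0r subr0.
by rewrite !big_ord_recr /= IH -natr1; ring.
Qed.

(** Both sides are written with the increments of [phi] along [e]: on the left [sum_by_parts], whose
    boundary term vanishes with [phi (e K)], on the right [layer_sum_le] for each eigenvalue. *)
Lemma count_to_trace (phi : R -> R) (e : nat -> R) (K N : nat) (m : 'I_N -> R) (d : R) :
  (forall x, 0 <= phi x) -> {homo phi : x y /~ x <= y} -> {homo e : i j / (i <= j)%N >-> i <= j} ->
  phi (e K) = 0 -> (forall k, (k < K)%N -> d * k.+1%:R <= #|[pred j | m j <= e k]|%:R) ->
  d * \sum_(k < K) phi (e k) <= \sum_(j < N) phi (m j).
Proof.
move=> phi0 dphi he eK cnt.
have dk k : 0 <= phi (e k) - phi (e k.+1) by rewrite subr_ge0 dphi // he.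
apply: le_trans (_ : \sum_(k < K) (phi (e k) - phi (e k.+1)) * #|[pred j | m j <= e k]|%:R <= _).
  have := sum_by_parts (fun k => phi (e k)) K; rewrite eK mulr0 subr0 => <-.
  rewrite mulr_sumr; apply: ler_sum => k _; rewrite mulrCA.
  by apply: ler_wpM2l => //; exact: cnt.
apply: le_trans (_ : \sum_(j < N) \sum_(k < K) (phi (e k) - phi (e k.+1)) * (m j <= e k)%R%:R <= _).
  rewrite exchange_big /=; apply: ler_sum => k _; rewrite -mulr_sumr.
  apply: ler_wpM2l => //; rewrite -sum1_card natr_sum big_mkcond /=.
  by apply: ler_sum => j _; rewrite inE; case: ifP.
apply: ler_sum => j _; apply: le_trans (layer_sum_le K (m j) phi0 dphi he) _.
by case: ifP => // _; rewrite eK subr0.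
Qed.

End AbelSummation.

Section LandauSeries.
Variables (R : realType) (B : R).
Hypothesis B_gt0 : 0 < B.

Lemma level_nd : {homo level B : i j / (i <= j)%N >-> i <= j}.
Proof.
move=> i j ij; rewrite /level ler_pM2l // lerD2r ler_wpM2l // ler_nat //.
Qed.

(** The terms vanish from the level K on. The series starts at k = 1, so its k-th term belongs to
    the level k - 1. *)
Lemma level_series (g l : R) (K : nat) : l <= level B K ->
  (\sum_(1 <= k <oo) (neg_pow g (B * (2 * k%:R - 1) - l))%:E =
   (\sum_(k < K) neg_pow g (level B k - l))%:E)%E.
Proof.
move=> lK; have E k : B * (2 * k.+1%:R - 1) = level B k by rewrite /level -natr1; ring.
rewrite (@nneseries_split R _ 1 K); last by move=> k _; rewrite lee_fin neg_pow_ge0.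
rewrite [X in (_ + X)%E]eseries0 ?adde0; last first.
  move=> [|k] // Kk _; rewrite E neg_pow_eq0 // subr_ge0; apply: le_trans lK (level_nd _).
  by rewrite add1n in Kk.
rewrite add1n big_add1 /= big_mkord sumEFin; congr (_%:E).
by apply: eq_bigr => k _; rewrite E.
Qed.

(** The least such K is taken, because [eigenvalue_count] needs the levels below it to lie strictly
    under [l]. *)
Lemma level_threshold (l : R) : exists K, l <= level B K /\ forall k, (k < K)%N -> level B k < l.
Proof.
have ex : exists K, l <= level B K.
  have [K hK] := nat_above (l / B); exists K.
  rewrite /level -ler_pdivrMl // mulrC; apply: le_trans hK _.
  by have := ler0n R K; lra.
exists (ex_minn ex); case: ex_minnP => K lK min; split=> // k kK.
by rewrite ltNge; apply/negP => /min; rewrite leqNgt kK.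
Qed.

End LandauSeries.

Section TracePositive.
Variables (R : realType) (Om : set (R * R)).

Lemma tr_neg_pow_ge0 H (g l : R) : (0 <= tr_neg_pow Om H g l)%E.
Proof.
apply: esum_ge0 => m _; apply: mule_ge0; first by rewrite lee_fin neg_pow_ge0.
apply: ereal_sup_ubound; exists 0%N; split=> //.
by exists (fun=> cst 0); split=> [[]//|c _ []].
Qed.

End TracePositive.

Theorem theorem3p10 (R : realType) (Om : set (R * R)) (B : R)
    (Om_open : open Om) (Om_finite : (leb2 R Om < +oo)%E) (B_gt0 : 0 < B)
    (H_discrete :
       discrete_spectrum Om (magnetic_neumann Om (homogeneous_field B))) :
  (bounded_set Om -> tiling Om ->
   forall gamma lambda : R, 0 <= gamma -> 0 < lambda ->
     (leb2 R Om * (B / (2 * pi))%:E *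
        \sum_(1 <= k <oo) (neg_pow gamma (B * (2 * k%:R - 1) - lambda))%:E
      <= tr_neg_pow Om (magnetic_neumann Om (homogeneous_field B))
           gamma lambda)%E) /\
  (forall gamma lambda : R, 1 <= gamma -> 0 < lambda ->
     (leb2 R Om * (B / (2 * pi))%:E *
        \sum_(1 <= k <oo) (neg_pow gamma (B * (2 * k%:R - 1) - lambda))%:E
      <= tr_neg_pow Om (magnetic_neumann Om (homogeneous_field B))
           gamma lambda)%E).
Proof.
have fE : leb2 R Om = (fine (leb2 R Om))%:E by rewrite fineK // ge0_fin_numE.
split=> [bnd [I [ang [sh [disj cover]]]] g l g0 _|g l g1 _]; have [K [lK Kl]] := level_threshold B_gt0 l;
    rewrite (level_series B_gt0 g lK) {1}fE -!EFinM [fine _ * _]mulrC; last first.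
  exact: trace_lower_bound.
have d0 : 0 <= density B Om by rewrite mulr_ge0 ?fine_ge0 // divr_ge0 ?mulr_ge0 ?pi_ge0 // ltW.
(* On a null set the bound is trivial; bounding the number of tiles requires a positive density. *)
have [dz|dnz] := eqVneq (density B Om) 0.
  by rewrite -/(density B Om) dz mul0r; exact: tr_neg_pow_ge0.
have dpos : 0 < density B Om by rewrite lt_neqAle eq_sym dnz.
have [N [psi [m [on eig _ low]]]] := magnetic_spectral_family Om_open
  (@homogeneous_field_continuous1 R B) (@homogeneous_field_continuous2 R B) H_discrete l.
apply: le_trans (tr_neg_pow_ge Om_open g l on eig); rewrite lee_fin -/(density B Om).
apply: (@count_to_trace R (fun x => neg_pow g (x - l)) (level B) K).
- by move=> x; exact: neg_pow_ge0.
- by move=> x y xy; apply: neg_pow_anti => //; rewrite lerD2r.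
- exact: level_nd.
- by rewrite neg_pow_eq0 // subr_ge0.
move=> k kK; apply: (eigenvalue_count B_gt0 Om_open Om_finite bnd disj cover dpos on eig low).
exact: Kl.
Qed.
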